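(* Let $\Omega\subset\mathbb{R}^4\cong\mathbb{C}^2$ be a domain, and let $v\in C^4(\Omega)$, $v<0$, be a convex solution of $$\det\left(v\,v_{z_i\bar z_j}+v_{z_i}v_{\bar z_j}\right)_{1\le i,j\le2}=\frac{1}{16}\quad\text{in }\Omega.$$ Then the real Hessian $\nabla^2v$ has constant rank throughout $\Omega$.
   Context: $\mathbb{R}^4$ is identified with $\mathbb{C}^2$ via $z_1=x_1+\sqrt{-1}\,y_1$, $z_2=x_2+\sqrt{-1}\,y_2$; $v$ is real-valued and convex in the real sense on $\mathbb{R}^4$; $v_{z_i}=\frac12(v_{x_i}-\sqrt{-1}\,v_{y_i})$, $v_{\bar z_i}=\frac12(v_{x_i}+\sqrt{-1}\,v_{y_i})$, $v_{z_i\bar z_j}=\partial^2v/\partial z_i\partial\bar z_j$. $\nabla^2 v$ is the $4\times 4$ real Hessian with respect to $(x_1,x_2,y_1,y_2)$. *)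

(* Defs.v *)
From HB Require Import structures.
From mathcomp Require Import all_boot all_order all_algebra.
From mathcomp Require Import complex.
From mathcomp Require Import all_classical all_reals all_analysis.

Set Implicit Arguments.
Unset Strict Implicit.
Unset Printing Implicit Defensive.

Import Order.TTheory GRing.Theory Num.Theory.
Import numFieldNormedType.Exports.

Local Open Scope classical_set_scope.
Local Open Scope ring_scope.
Local Open Scope complex_scope.

Definition is_domain (T : topologicalType) (Omega : set T) : Prop :=
  [/\ Omega !=set0, open Omega & connected Omega].

Definition partial (R : realType) (n : nat) (k : 'I_n.+1)
    (f : 'rV[R]_n.+1 -> R) (x : 'rV[R]_n.+1) : R :=
  'D_(delta_mx 0 k) f x.

(* [Ck_on Omega m f]: f is of class C^m on the open set Omega, i.e. all its
   iterated partial derivatives of order at most m exist and are continuous at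
   every point of Omega.  The values of f outside Omega are irrelevant. *)
Fixpoint Ck_on (R : realType) (n : nat) (Omega : set 'rV[R]_n.+1) (m : nat)
    (f : 'rV[R]_n.+1 -> R) : Prop :=
  (forall x, Omega x -> {for x, continuous f}) /\
  match m with
  | 0 => True
  | m'.+1 => forall k : 'I_n.+1,
      (forall x, Omega x -> derivable f x (delta_mx 0 k)) /\
      Ck_on Omega m' (partial k f)
  end.

(* Omega need not be convex.  Since the library's [convex_function C f] compares
   values of f at all convex combinations of points of C, even those that are
   not in C, it is only required for the convex subsets C of Omega; in other
   words, the convexity inequality holds on every segment contained in Omega. *)
Definition convex_on (R : realType) (n : nat) (Omega : set 'rV[R]_n.+1)
    (f : 'rV[R]_n.+1 -> R) : Prop :=
  forall C : set 'rV[R]_n.+1, convex_set C -> C `<=` Omega ->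
    convex_function C f.

Definition hessian (R : realType) (n : nat) (f : 'rV[R]_n.+1 -> R)
    (x : 'rV[R]_n.+1) : 'M[R]_n.+1 :=
  \matrix_(i, j) partial i (partial j f) x.

(* A point of R^4 is the row vector (x_1, x_2, y_1, y_2), which stands for
   (z_1, z_2) with z_i = x_i + sqrt(-1) y_i. *)
Definition x_coord (i : 'I_2) : 'I_4 := lshift 2 i.
Definition y_coord (i : 'I_2) : 'I_4 := rshift 2 i.

Definition partialC (R : realType) (k : 'I_4) (f : 'rV[R]_4 -> R[i])
    (x : 'rV[R]_4) : R[i] :=
  partial k (fun y => complex.Re (f y)) x
    +i* partial k (fun y => complex.Im (f y)) x.

Definition dz (R : realType) (i : 'I_2) (f : 'rV[R]_4 -> R[i])
    (x : 'rV[R]_4) : R[i] :=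
  2^-1 * (partialC (x_coord i) f x - (0 +i* 1) * partialC (y_coord i) f x).

Definition dzbar (R : realType) (i : 'I_2) (f : 'rV[R]_4 -> R[i])
    (x : 'rV[R]_4) : R[i] :=
  2^-1 * (partialC (x_coord i) f x + (0 +i* 1) * partialC (y_coord i) f x).

Definition pde_matrix (R : realType) (v : 'rV[R]_4 -> R) (x : 'rV[R]_4) :
    'M[R[i]]_2 :=
  let vC := fun y => (v y)%:C in
  \matrix_(i, j) (vC x * dz i (dzbar j vC) x + dz i vC x * dzbar j vC x).

(* Main.v *)
(* Write W for the real Hessian of v and s = - v > 0.  The equation says that the
   Hermitian matrix A = s (v_{z_i bar z_j}) - (v_{z_i} v_{bar z_j}), suitably scaled,
   has determinant 1; moreover A > 0.  Differentiating the equation twice, and using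
   that det, a form of signature (1,3) on Hermitian matrices, is negative on the
   orthogonal complement of A, one bounds sum_m D^2_{f_m f_m} W (u, u) from above for a
   frame f_m with sum_m f_m f_m^* proportional to the cofactor matrix of A: by a
   quadratic expression in D W (u, .), an error linear in |W u|, and a drift linear in the
   gradient of W (u, u).

   Near x0 let the columns of B span ker W(x0), of dimension k, and let G(x) be the
   minimum over X, C with X B = 1 of <M(C), X W(x) X^T>, M(C) = (1 + |C|^2 / 2) I - C.
   Then G >= 0, and G(x) = 0 forces dim ker W(x) >= k.  Since G is a minimum, every
   smooth function touching it from below satisfies the second variation inequality of
   the minimised quantity; letting X move along - (Z - (Z B) X), with Z the optimal
   choice absorbing the quadratic expression, yields sum_m D^2_{f_m f_m} G <= K (G + |D G|) in the
   viscosity sense.  As G(x0) = 0, the Hopf boundary argument shows G = 0 near x0, so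
   the rank cannot increase; by lower semicontinuity it cannot drop.  Hence the rank is
   locally constant, and constant because Omega is connected. *)

Require Import Defs.
From mathcomp Require Import all_boot all_order all_algebra.
From mathcomp Require Import complex.
From mathcomp Require Import all_classical all_reals all_analysis.
From mathcomp Require Import ring lra.
Import Order.TTheory GRing.Theory Num.Theory.
Import numFieldNormedType.Exports.
Local Open Scope classical_set_scope.
Local Open Scope ring_scope.
Local Open Scope complex_scope.

Set Implicit Arguments.
Unset Strict Implicit.
Unset Printing Implicit Defensive.

(** Two difficulties dictate the form of $G$. Positivity of $W$ alone gives $|Wu| = O((u^T W
    u)^{1/2})$, too weak for an error that has to be linear in $G$. The optimal [X] satisfies $XW =
    TB^T$ with $T = XWX^T$, so combinations $u$ of its rows have $|Wu| = O(\mathrm{tr}\,T)$. Next,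
    minimising $\mathrm{tr}\,T$ alone would leave terms linear in the whole derivative $T_1$ of $T$,
    of which the gradient of $G$ sees only one scalar. Minimising over [C] too gives $C =
    T/\mathrm{tr}\,T$ and $G = \mathrm{tr}\,T - |T|^2/(2\,\mathrm{tr}\,T)$ where $T \ne 0$, which is
    concave in $T$ and curved across the rays. Its second variation contributes $-t|C'|^2$, with $t
    = \mathrm{tr}\,T$ and $C'$ the derivative of $T/\mathrm{tr}\,T$. This absorbs all of $T_1$
    except $\langle M(C), T_1\rangle$, which is the derivative of $G$. Since $T/\mathrm{tr}\,T$ is
    singular where $T = 0$, $G$ is handled through test functions and through competitors, never by
    differentiating the minimizers. *)

Local Notation o1 := (x_coord ord0).
Local Notation o2 := (x_coord ord_max).
Local Notation o3 := (y_coord ord0).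
Local Notation o4 := (y_coord ord_max).

(** * Derivatives along lines *)

Section Jets.
Variable R : realType.
Implicit Types (f g : R -> R).

Definition jet2 f (b c : R) : Prop := exists f1 : R -> R,
  [/\ \forall s \near (0 : R), is_derive (s : R) (1 : R) f (f1 s), f1 0 = b
    & is_derive (0 : R) (1 : R) f1 c].

Lemma jet2_cst (a : R) : jet2 (fun=> a) 0 0.
Proof.
exists (fun=> 0); split => //; last exact: is_derive_cst.
by near=> s; exact: is_derive_cst.
Unshelve. all: by end_near. Qed.

Lemma jet2_id : jet2 id 1 0.
Proof.
exists (fun=> 1); split => //; last exact: is_derive_cst.
by near=> s; exact: is_derive_id.
Unshelve. all: by end_near. Qed.

Lemma jet2D f g b c b' c' : jet2 f b c -> jet2 g b' c' ->
  jet2 (fun s => f s + g s) (b + b') (c + c').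
Proof.
move=> [f1 [df <- df1]] [g1 [dg <- dg1]]; exists (fun s => f1 s + g1 s); split => //.
- by near=> s; apply: is_deriveD; near: s.
- exact: is_deriveD.
Unshelve. all: by end_near. Qed.

Lemma jet2M f g b c b' c' : jet2 f b c -> jet2 g b' c' ->
  jet2 (fun s => f s * g s) (b * g 0 + f 0 * b')
    (c * g 0 + 2 * (b * b') + f 0 * c').
Proof.
move=> [f1 [df <- df1]] [g1 [dg <- dg1]].
have df0 : is_derive (0 : R) (1 : R) f (f1 0) by exact: nbhs_singleton df.
have dg0 : is_derive (0 : R) (1 : R) g (g1 0) by exact: nbhs_singleton dg.
exists (fun s => f1 s * g s + f s * g1 s); split => //.
- near=> s.
  have dfs : is_derive (s : R) (1 : R) f (f1 s) by near: s.
  have dgs : is_derive (s : R) (1 : R) g (g1 s) by near: s.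
  apply: is_derive_eq (is_deriveM dfs dgs) _.
  by rewrite addrC /GRing.scale/= [g s * _]mulrC.
- apply: is_derive_eq (is_deriveD (is_deriveM df1 dg0) (is_deriveM df0 dg1)) _.
  by rewrite /GRing.scale/=; ring.
Unshelve. all: by end_near. Qed.

Lemma jet2_eq f b c b' c' : jet2 f b c -> b = b' -> c = c' -> jet2 f b' c'.
Proof. by move=> ? <- <-. Qed.

Lemma jet2Z a f b c : jet2 f b c -> jet2 (fun s => a * f s) (a * b) (a * c).
Proof.
by move=> jf; apply: jet2_eq (jet2M (jet2_cst a) jf) _ _; ring.
Qed.

Lemma jet2N f b c : jet2 f b c -> jet2 (fun s => - f s) (- b) (- c).
Proof.
move=> jf; rewrite (_ : (fun s => - f s) = (fun s => -1 * f s)).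
  by apply: jet2_eq (jet2Z (-1) jf) _ _; ring.
by apply/funext => s; rewrite mulN1r.
Qed.

Lemma jet2B f g b c b' c' : jet2 f b c -> jet2 g b' c' ->
  jet2 (fun s => f s - g s) (b - b') (c - c').
Proof. by move=> jf jg; exact: jet2D (jet2N jg). Qed.

Lemma jet2_sum (I : Type) (r : seq I) (F : I -> R -> R) (b c : I -> R) :
  (forall i, jet2 (F i) (b i) (c i)) ->
  jet2 (fun s => \sum_(i <- r) F i s) (\sum_(i <- r) b i) (\sum_(i <- r) c i).
Proof.
move=> jF; elim: r => [|i r IH].
  rewrite !big_nil (_ : (fun s => _) = fun=> 0); first exact: jet2_cst.
  by apply/funext => s; rewrite big_nil.
rewrite !big_cons (_ : (fun s => _) = fun s => F i s + \sum_(j <- r) F j s).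
  exact: jet2D.
by apply/funext => s; rewrite big_cons.
Qed.

(** If [c] were negative, the derivative, which vanishes at 0, would be negative on some interval
    $(0,d)$, and the mean value theorem on $[0,t]$ would give $f(t) < f(0)$. *)
Lemma jet2_ge0 f b c : jet2 f b c -> (\forall s \near (0 : R), f 0 <= f s) ->
  b = 0 /\ 0 <= c.
Proof.
move=> [f1 [df <- df1]] minf.
have [e /= e0 He] : exists2 e : R, 0 < e &
    forall s, `|s| < e -> is_derive (s : R) (1 : R) f (f1 s) /\ f 0 <= f s.
  have [e /= e0 He] := filterI df minf.
  by exists e => // s se; apply: He; rewrite /ball_/= sub0r normrN.
have df0 : is_derive (0 : R) (1 : R) f (f1 0) by have [] := He 0; rewrite ?normr0.
have f10 : f1 0 = 0.
  have ne : - e <= e by lra.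
  have H : is_derive (0 : R) (1 : R) f 0.
    apply: (derive1_at_min ne) => [t||t]; rewrite in_itv/=.
    - by case/andP=> ? ?; have [] := He t; [rewrite ltr_norml; lra|move=> []].
    - by lra.
    - by case/andP=> ? ?; have [] := He t; [rewrite ltr_norml; lra|].
  by rewrite -(@derive_val _ _ _ _ _ _ _ df0) (@derive_val _ _ _ _ _ _ _ H).
split => //; rewrite leNgt; apply/negP => c0.
have [d /= d0 Hd] : exists2 d : R, 0 < d & forall s, 0 < s -> s < d -> f1 s < 0.
  have drf1 : derivable f1 0 1 by [].
  have /cvgrPdist_lt /(_ (- c)) := drf1.
  rewrite oppr_gt0 -/(derive _ _ _) (@derive_val _ _ _ _ _ _ _ df1) => /(_ c0).
  rewrite /dnbhs /within/= => -[d /= d0 Hd]; exists d => // s s0 sd.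
  have := Hd s; rewrite /ball_/= sub0r normrN gtr0_norm// => /(_ sd).
  rewrite gt_eqF// => /(_ isT); rewrite /GRing.scale/= mulr1 addr0 f10 subr0.
  rewrite ltr_norml => /andP[H _].
  have : s^-1 * f1 s < 0 by lra.
  by rewrite pmulr_rlt0 // invr_gt0.
pose t := Num.min e d / 2.
have t0 : 0 < t by rewrite divr_gt0// lt_min e0.
have [te td] : t < e /\ t < d.
  have : Num.min e d <= e by rewrite ge_min lexx.
  have : Num.min e d <= d by rewrite ge_min lexx orbT.
  by rewrite /t in t0 *; lra.
have [||s] := @MVT _ f f1 0 t t0.
- move=> s; rewrite in_itv/= => /andP[s0 st].
  by have [] := He s; rewrite ?gtr0_norm//; lra.
- apply: derivable_within_continuous => s; rewrite in_itv/= => /andP[s0 st].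
  by have [] := He s; rewrite ?ger0_norm//; lra.
rewrite in_itv/= => /andP[s0 st] E.
have := Hd s s0 (lt_trans st td).
have [] := He t; first by rewrite gtr0_norm.
move=> _; rewrite -subr_ge0 E subr0 pmulr_lge0// => /le_lt_trans H /H.
by rewrite ltxx.
Qed.

Lemma jet2_cst_near f b c : jet2 f b c -> (\forall s \near (0 : R), f s = f 0) ->
  b = 0 /\ c = 0.
Proof.
move=> jf cf.
have [-> c0] : b = 0 /\ 0 <= c.
  by apply: jet2_ge0 jf _; near=> s; rewrite (near cf s).
have [_ ] : - b = 0 /\ 0 <= - c.
  by apply: jet2_ge0 (jet2N jf) _; near=> s; rewrite lerN2 (near cf s).
by split => //; apply/eqP; rewrite eq_le c0 andbT; lra.
Unshelve. all: by end_near. Qed.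

End Jets.

Section LineDerivatives.
Variables (R : realType) (n : nat).
Implicit Types (w : 'rV[R]_n.+1 -> R) (x u : 'rV[R]_n.+1) (Omega : set 'rV[R]_n.+1).

Local Notation e_ k := (delta_mx (0 : 'I_1) (k : 'I_n.+1) : 'rV[R]_n.+1).

Lemma is_derive0_eps (f : R -> R) (d : R) :
  (forall e, 0 < e -> exists2 r, 0 < r & forall h, h != 0 -> `|h| < r ->
     `|h^-1 * (f h - f 0) - d| < e) -> is_derive (0 : R) (1 : R) f d.
Proof.
move=> Hf.
have lim : h^-1 *: ((f \o shift 0) (h *: (1 : R)) - f 0) @[h --> 0^'] --> d.
  apply/cvgrPdist_lt => e e0; have [r r0 Hr] := Hf e e0.
  rewrite /dnbhs /within/=; exists r => //= h.
  rewrite /ball_/= sub0r normrN => hr h0.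
  by rewrite distrC /GRing.scale/= mulr1 addr0; exact: Hr.
apply: DeriveDef; first by apply/cvg_ex; exists d.
exact: cvg_lim lim.
Qed.

Lemma is_derive_line w x u (s : R) : derivable w (x + s *: u) u ->
  is_derive s (1 : R) (fun t => w (x + t *: u)) ('D_u w (x + s *: u)).
Proof.
move=> dw.
have E : (fun h : R => h^-1 *: (((fun t => w (x + t *: u)) \o shift s) (h *: (1 : R))
     - w (x + s *: u))) =
   (fun h : R => h^-1 *: ((w \o shift (x + s *: u)) (h *: u) - w (x + s *: u))).
  apply/funext => h; congr (_ *: (w _ - _)) => /=.
  by rewrite [h *: (1 : R)]mulr1 scalerDl addrCA.
by apply: DeriveDef; rewrite /derivable /derive E.
Qed.

Lemma open_line_near Omega x u : open Omega -> Omega x ->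
  \forall s \near (0 : R), Omega (x + s *: u).
Proof.
move=> oO Ox.
have ct : {for (0 : R), continuous (fun s : R => x + s *: u)}.
  by apply: cvgD; [exact: cvg_cst|exact: scalel_continuous].
apply: ct; rewrite /= scale0r addr0.
exact: open_nbhs_nbhs.
Qed.

Lemma MVT_0 (f df : R -> R) (h : R) : 0 < h ->
  (forall t, 0 <= t <= h -> is_derive t (1 : R) f (df t)) ->
  exists2 t, 0 < t < h & f h - f 0 = h * df t.
Proof.
move=> h0 dfP.
have [||t] := @MVT _ f df 0 h h0.
- by move=> t; rewrite in_itv/= => /andP[/ltW ? /ltW ?]; apply: dfP; apply/andP.
- apply: derivable_within_continuous => t; rewrite in_itv/= => tp.
  by have [] := dfP t tp.
by rewrite in_itv/= => tp ->; exists t => //; rewrite subr0 mulrC.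
Qed.

Lemma ball_in Omega x : open Omega -> Omega x ->
  exists2 r : R, 0 < r & forall y, `|y - x| < r -> Omega y.
Proof.
move=> oO Ox; have /nbhs_ballP[r /= r0 Hr] := open_nbhs_nbhs (conj oO Ox).
by exists r => // y yx; apply: Hr; rewrite -ball_normE /ball_/= distrC.
Qed.

Lemma cts_ball w x : {for x, continuous w} -> forall e : R, 0 < e ->
  exists2 r : R, 0 < r & forall y, `|y - x| < r -> `|w y - w x| < e.
Proof.
move=> /cvgrPdist_lt cw e e0.
have /nbhs_ballP[r /= r0 Hr] := cw e e0.
exists r => // y yx; rewrite distrC; apply: Hr.
by rewrite -ball_normE /ball_/= distrC.
Qed.

(** Between $x + hg$ and $x + h(g + c e_k)$ the mean value theorem along $e_k$ and the continuity of
    the $k$-th partial derivative give the increment $hc\,\partial_k w(x) + o(h)$. Directional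
    derivatives then follow by adding one coordinate at a time. *)
Lemma derive_line_step Omega w x (g : 'rV[R]_n.+1) (D c : R) k :
  open Omega -> Omega x ->
  (forall y, Omega y -> derivable w y (e_ k)) ->
  {for x, continuous (partial k w)} ->
  is_derive (0 : R) (1 : R) (fun s => w (x + s *: g)) D ->
  is_derive (0 : R) (1 : R) (fun s => w (x + s *: (g + c *: e_ k)))
    (D + c * partial k w x).
Proof.
move=> oO Ox dw cw dg.
have [r0 r00 HO] := ball_in oO Ox.
suff H : is_derive (0 : R) (1 : R)
    (fun s => w (x + s *: (g + c *: e_ k)) - w (x + s *: g)) (c * partial k w x).
  rewrite (_ : (fun s => _) = (fun s => w (x + s *: g)) +
     (fun s => w (x + s *: (g + c *: e_ k)) - w (x + s *: g))).
    exact: is_deriveD.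
  apply/funext => s.
  by rewrite -[RHS]/(w (x + s *: g) + (w (x + s *: (g + c *: e_ k)) - w (x + s *: g))) [RHS]addrC subrK.
apply: is_derive0_eps => e e0.
have c1 : 0 < `|c| + 1 by rewrite ltr_wpDl.
have [r1 r10 Hr1] := cts_ball cw (divr_gt0 e0 c1).
have N0 : 0 < `|g| + `|c *: e_ k| + 1 by rewrite ltr_wpDl// addr_ge0.
pose r := Num.min r0 r1.
have rp : 0 < r by rewrite lt_min r00.
exists (r / (`|g| + `|c *: e_ k| + 1)) => [|h h0]; first by rewrite divr_gt0.
rewrite ltr_pdivlMr// => hr.
have close t : 0 <= t <= 1 -> `|(x + h *: g) + t *: (h *: (c *: e_ k)) - x| < r.
  move=> /andP[t0 t1]; rewrite addrAC [x + h *: g]addrC addrK.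
  apply: le_lt_trans hr; rewrite (le_trans (ler_normD _ _))//.
  rewrite !normrZ [`|t|]ger0_norm//.
  have A0 : 0 <= `|h| * (`|c| * `|e_ k|) by rewrite !mulr_ge0.
  have tA : t * (`|h| * (`|c| * `|e_ k|)) <= `|h| * (`|c| * `|e_ k|) by rewrite ler_piMl.
  by have := normr_ge0 h; lra.
have [||t /andP[t0 t1]] := @MVT_0 (fun t => w ((x + h *: g) + t *: (h *: (c *: e_ k))))
   (fun t => h * (c * partial k w ((x + h *: g) + t *: (h *: (c *: e_ k))))) 1.
- by [].
- move=> t t01.
  have Oy : Omega (x + h *: g + t *: (h *: (c *: e_ k))).
    by apply: HO; apply: lt_le_trans (close t t01) _; rewrite ge_min lexx.
  have E1 : forall t, x + h *: g + t *: (h *: (c *: e_ k)) =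
     x + h *: g + (t * (h * c)) *: e_ k by move=> t'; rewrite !scalerA mulrA.
  rewrite E1 in Oy *.
  have d1 := is_derive_line (dw _ Oy).
  rewrite (_ : (fun t => _) = (fun t => w (x + h *: g + t *: e_ k)) \o
     (fun t => t * (h * c))); last by apply/funext => t'; rewrite E1.
  have d2 : is_derive t (1 : R) (fun t => t * (h * c)) (h * c).
    apply: is_derive_eq (is_deriveM (is_derive_id _ _) (is_derive_cst (h * c) _ _)) _.
    by rewrite /GRing.scale/= mulr0 add0r mulr1.
  apply: is_derive_eq (@is_derive1_comp _ (fun t => w (x + h *: g + t *: e_ k))
    (fun t => t * (h * c)) t _ _ d1 d2) _.
  by rewrite [LHS]mulrC -mulrA.
rewrite mul1r scale0r addr0 scale1r => E.
rewrite !scale0r subrr subr0 scalerDr addrA E.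
rewrite mulKf// -mulrBr normrM.
apply: le_lt_trans (_ : `|c| * (e / (`|c| + 1)) < e).
  rewrite ler_wpM2l// ltW// Hr1// (lt_le_trans (close t _))//.
    by rewrite (ltW t0) ltW.
  by rewrite ge_min lexx orbT.
by rewrite mulrCA gtr_pMr// ltr_pdivrMr// mul1r ltrDl.
Qed.

Lemma row_sum_e u : \sum_k u 0 k *: e_ k = u.
Proof. by rewrite [RHS]row_sum_delta. Qed.

Lemma is_derive_dir0 Omega w x u : open Omega -> Omega x -> Ck_on Omega 1 w ->
  is_derive (0 : R) (1 : R) (fun s => w (x + s *: u)) (\sum_k u 0 k * partial k w x).
Proof.
move=> oO Ox [_ Cw].
rewrite (_ : (fun s => _) = fun s => w (x + s *: \sum_k u 0 k *: e_ k)); last first.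
  by apply/funext => s; rewrite row_sum_e.
elim: (index_enum _) => [|k r IH].
  rewrite !big_nil (_ : (fun s => _) = fun=> w x); first exact: is_derive_cst.
  by apply/funext => s; rewrite scaler0 addr0.
rewrite !big_cons [X in is_derive _ _ _ X]addrC [u 0 k *: _ + _]addrC.
have [dw [cw _]] := Cw k.
exact: derive_line_step oO Ox dw (cw x Ox) IH.
Qed.

Lemma is_derive_dir Omega w x u (s : R) : open Omega -> Omega (x + s *: u) ->
  Ck_on Omega 1 w ->
  is_derive s (1 : R) (fun s => w (x + s *: u))
    (\sum_k u 0 k * partial k w (x + s *: u)).
Proof.
move=> oO Ox Cw.
have H := is_derive_dir0 u oO Ox Cw.
rewrite (_ : (fun s => _) = (fun t => w ((x + s *: u) + t *: u)) \o (shift (- s))).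
  rewrite -[X in is_derive _ _ _ X]mulr1.
  apply: is_derive1_comp (is_derive_shift _ _ _).
  by rewrite /= subrr.
by apply/funext => t; rewrite /= -addrA -scalerDl addrCA subrr addr0.
Qed.

Lemma Ck_onW Omega m w : Ck_on Omega m.+1 w -> Ck_on Omega m w.
Proof.
elim: m w => [|m IH] w [cw Cw]; split => // k.
by have [dw Cdw] := Cw k; split => //; exact: IH.
Qed.

Lemma Ck_on_cts Omega m w x : Ck_on Omega m w -> Omega x -> {for x, continuous w}.
Proof. by case: m => [|m] [cw _]; exact: cw. Qed.

Lemma Ck_on_partial Omega m w k : Ck_on Omega m.+1 w -> Ck_on Omega m (partial k w).
Proof. by move=> [_ /(_ k) []]. Qed.

Lemma jet2_dir Omega w x u : open Omega -> Omega x -> Ck_on Omega 2 w ->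
  jet2 (fun s => w (x + s *: u)) (\sum_k u 0 k * partial k w x)
    (\sum_k u 0 k * \sum_l u 0 l * partial l (partial k w) x).
Proof.
move=> oO Ox Cw.
exists (fun s => \sum_k u 0 k * partial k w (x + s *: u)); split.
- near=> s; apply: is_derive_dir (oO) _ (Ck_onW Cw).
  near: s; exact: open_line_near.
- by rewrite scale0r addr0.
- rewrite (_ : (fun s => _) =
     \sum_k (u 0 k *: (fun s => partial k w (x + s *: u)))); last first.
    by apply/funext => s; rewrite fct_sumE; apply: eq_bigr.
  apply: is_derive_sum => k; apply: is_deriveZ.
  exact: is_derive_dir0 oO Ox (Ck_on_partial k Cw).
Unshelve. all: by end_near. Qed.

(** Two successive mean value theorems turn the second difference over a square of side [h] into
    $h^2$ times a mixed derivative at a nearby point. The difference is symmetric in [i] and [j],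
    whence Schwarz's theorem in [partial_comm]. *)
Lemma double_diff Omega w x i j : open Omega -> Omega x -> Ck_on Omega 2 w ->
  forall e : R, 0 < e -> exists2 r : R, 0 < r & forall h, 0 < h -> h < r ->
   exists2 d : R, w (x + h *: e_ i + h *: e_ j) - w (x + h *: e_ i)
     - (w (x + h *: e_ j) - w x) = h * (h * d) &
     `|d - partial j (partial i w) x| < e.
Proof.
move=> oO Ox Cw e e0.
have [r0 r00 HO] := ball_in oO Ox.
have Cij := Ck_on_partial j (Ck_on_partial i Cw).
have [r1 r10 Hr1] := cts_ball (Ck_on_cts Cij Ox) e0.
have N0 : 0 < `|e_ i| + `|e_ j| + 1 by rewrite ltr_wpDl// addr_ge0.
pose r := Num.min r0 r1.
have rp : 0 < r by rewrite lt_min r00.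
exists (r / (`|e_ i| + `|e_ j| + 1)) => [|h h0]; first by rewrite divr_gt0.
rewrite ltr_pdivlMr// => hr.
have close s t : 0 <= s <= h -> 0 <= t <= h -> `|x + s *: e_ i + t *: e_ j - x| < r.
  move=> /andP[s0 s1] /andP[t0 t1]; rewrite addrAC [x + s *: _]addrC addrK.
  apply: le_lt_trans hr; rewrite (le_trans (ler_normD _ _))//.
  rewrite !normrZ !ger0_norm ?(ltW h0)//.
  have := ler_wpM2r (normr_ge0 (e_ i)) s1; have := ler_wpM2r (normr_ge0 (e_ j)) t1.
  lra.
have hh : 0 <= h <= h by rewrite lexx ltW.
have zh : 0 <= (0 : R) <= h by rewrite lexx ltW.
have inO s t : 0 <= s <= h -> 0 <= t <= h -> Omega (x + s *: e_ i + t *: e_ j).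
  by move=> sh th; apply: HO; apply: lt_le_trans (close _ _ sh th) _; rewrite ge_min lexx.
have [_ Cw1] := Cw.
have [s /andP[s0 sh]] := @MVT_0
  (fun s => w (x + h *: e_ j + s *: e_ i) - w (x + s *: e_ i))
  (fun s => partial i w (x + h *: e_ j + s *: e_ i) - partial i w (x + s *: e_ i)) h h0
  (fun s sh => is_deriveB
     (is_derive_line (proj1 (Cw1 i) _ (eq_ind _ Omega (inO s h sh hh) _ (addrAC _ _ _))))
     (is_derive_line (proj1 (Cw1 i) _ (eq_ind _ Omega (inO s 0 sh zh) _
        (etrans (congr1 _ (scale0r _)) (addr0 _)))))).
rewrite scale0r !addr0 => E1.
have sh' : 0 <= s <= h by rewrite !ltW.
have [_ /(_ j) [dj _]] := Ck_on_partial i Cw.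
have [t /andP[t0 th]] := @MVT_0
  (fun t => partial i w (x + s *: e_ i + t *: e_ j))
  (fun t => partial j (partial i w) (x + s *: e_ i + t *: e_ j)) h h0
  (fun t th => is_derive_line (dj _ (inO s t sh' th))).
rewrite scale0r addr0 => E2.
exists (partial j (partial i w) (x + s *: e_ i + t *: e_ j)).
  rewrite -E2 [x + s *: _ + _]addrAC -E1 [x + h *: e_ j + _]addrAC.
  by [].
apply: Hr1; apply: lt_le_trans (close s t sh' _) _; first by rewrite !ltW.
by rewrite ge_min lexx orbT.
Qed.

Lemma eq_common_approx (a b : R) :
  (forall e, 0 < e -> exists2 d, `|d - a| < e & `|d - b| < e) -> a = b.
Proof.
move=> H; apply/eqP; rewrite -subr_eq0 -normr_le0 leNgt; apply/negP => p0.
have [d d1 d2] := H _ (divr_gt0 p0 (ltr0Sn R 1)).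
have : `|a - b| < `|a - b| / 2 + `|a - b| / 2.
  apply: le_lt_trans (ltrD d1 d2).
  rewrite (_ : a - b = (d - b) - (d - a)); first by rewrite [leRHS]addrC; exact: ler_normB.
  by ring.
by rewrite -splitr ltxx.
Qed.

Lemma partial_comm Omega w x i j : open Omega -> Omega x -> Ck_on Omega 2 w ->
  partial i (partial j w) x = partial j (partial i w) x.
Proof.
move=> oO Ox Cw; apply: eq_common_approx => e e0.
have [r r0 Hr] := double_diff i j oO Ox Cw e0.
have [r' r'0 Hr'] := double_diff j i oO Ox Cw e0.
pose h := Num.min r r' / 2.
have m0 : 0 < Num.min r r' by rewrite lt_min r0.
have h0 : 0 < h by rewrite divr_gt0.
have mr : Num.min r r' <= r by rewrite ge_min lexx.
have mr' : Num.min r r' <= r' by rewrite ge_min lexx orbT.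
have [|d E1 d1] := Hr h h0; first by rewrite /h; lra.
have [|d' E2 d2] := Hr' h h0; first by rewrite /h; lra.
have Ed : d = d'; last by rewrite -Ed in d2; exists d; [exact: d2|exact: d1].
have hn : h != 0 by rewrite gt_eqF.
apply: (mulfI hn); apply: (mulfI hn); rewrite -E1 -E2.
by rewrite [x + h *: e_ i + _]addrAC; ring.
Qed.

Lemma partial_eq_on Omega w w' x k : open Omega -> Omega x ->
  (forall y, Omega y -> w y = w' y) -> partial k w x = partial k w' x.
Proof.
move=> oO Ox E; rewrite /partial; apply: near_eq_derive.
near=> y; apply: E; near: y; exact: open_nbhs_nbhs.
Unshelve. all: by end_near. Qed.

End LineDerivatives.

(** * The equation in real form *)

Section Convexity.
Local Open Scope convex_scope.
Variables (R : realType) (n : nat).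
Implicit Types (v : 'rV[R]_n.+1 -> R) (x u : 'rV[R]_n.+1) (Omega : set 'rV[R]_n.+1).

Lemma ball_convex x (r : R) :
  convex_set ([set y | `|y - x| < r] : set (convex_lmodType 'rV[R]_n.+1)).
Proof.
apply/convex_setW => y z yx zx l l0 l1; move: yx zx; rewrite !inE /= => yx zx.
have -> : y <| l |> z - x = l%:num *: (y - x) + (1 - l%:num) *: (z - x).
  by rewrite 2!scalerBr addrACA -opprD -scalerDl subrKC scale1r.
rewrite (le_lt_trans (ler_normD _ _))// !normrZ.
rewrite (@ger0_norm _ l%:num)// (@ger0_norm _ (1 - l%:num)) ?subr_ge0 ?(ltW l1)//.
have := ltr_pM2l l0 `|y - x| r; rewrite yx.
have l1' : 0 < 1 - l%:num by rewrite subr_gt0.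
have := ltr_pM2l l1' `|z - x| r; rewrite zx.
lra.
Qed.

(** By midpoint convexity on a ball inside [Omega], $s \mapsto v(x+su) + v(x-su)$ is minimal at 0,
    and its second derivative there is twice the Hessian form. *)
Lemma convex_hessian_ge0 Omega v x u : open Omega -> Omega x -> Ck_on Omega 2 v ->
  convex_on Omega v -> 0 <= \sum_k u 0 k * \sum_l u 0 l * partial l (partial k v) x.
Proof.
move=> oO Ox Cv cv.
have j1 := jet2_dir u oO Ox Cv.
have j2 := jet2_dir (- u) oO Ox Cv.
have E : \sum_k (- u) 0 k * \sum_l (- u) 0 l * partial l (partial k v) x =
    \sum_k u 0 k * \sum_l u 0 l * partial l (partial k v) x.
  apply: eq_bigr => k _; rewrite mxE mulNr -mulrN; congr (_ * _).
  by rewrite -sumrN; apply: eq_bigr => l _; rewrite mxE mulNr opprK.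
rewrite E in j2.
have H := jet2_ge0 (jet2D j1 j2).
suff /H[_] : \forall s \near 0, v (x + 0 *: u) + v (x + 0 *: - u) <=
  v (x + s *: u) + v (x + s *: - u) by lra.
have [r r0 HO] := ball_in oO Ox.
have near0 (w : 'rV[R]_n.+1) : \forall s \near (0 : R), `|x + s *: w - x| < r.
  have := @open_line_near R n [set y | `|y - x| < r] x w.
  apply; rewrite /= ?subrr ?normr0//.
  have -> : [set y | `|y - x| < r] = ball x r.
    by apply/seteqP; rewrite -ball_normE; split => y /=; rewrite distrC.
  exact: ball_open.
near=> s.
have h1 : (0 : R) <= 2^-1 by lra.
have h2 : (2^-1 : R) <= 1 by lra.
have B1 : `|x + s *: u - x| < r by near: s; exact: near0.
have B2 : `|x + s *: - u - x| < r by near: s; exact: near0.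
have Ec : (x + s *: u : convex_lmodType 'rV[R]_n.+1) <| Itv01 h1 h2 |> (x + s *: - u) = x.
  rewrite -[LHS]/(2^-1 *: (x + s *: u) + (1 - 2^-1) *: (x + s *: - u)).
  rewrite (_ : 1 - 2^-1 = 2^-1 :> R); last by field.
  by rewrite -scalerDr addrACA scalerN subrr addr0 scalerDr -scalerDl (_ : 2^-1 + 2^-1 = 1 :> R) ?scale1r//; field.
have := cv _ (@ball_convex x r) HO (Itv01 h1 h2) (x + s *: u) (x + s *: - u).
rewrite !inE /= => /(_ B1 B2); rewrite Ec => H'.
have {H'} : v x <= 2^-1 * v (x + s *: u) + (1 - 2^-1) * v (x + s *: - u) by exact: H'.
by rewrite !scale0r addr0; lra.
Unshelve. all: by end_near. Qed.

End Convexity.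

Lemma sum4 (V : nmodType) (F : 'I_4 -> V) : \sum_k F k = F o1 + F o2 + F o3 + F o4.
Proof.
rewrite !big_ord_recl big_ord0 addr0 !addrA.
by congr (F _ + F _ + F _ + F _); apply/val_inj.
Qed.

Lemma partial_cst (R : realType) n (a : R) k (x : 'rV[R]_n.+1) : partial k (fun=> a) x = 0.
Proof. exact: derive_cst. Qed.

Lemma partialZ (R : realType) n (a : R) k (w : 'rV[R]_n.+1 -> R) x :
  derivable w x (delta_mx 0 k) -> partial k (fun y => a * w y) x = a * partial k w x.
Proof. exact: deriveZ. Qed.

Opaque partial.

Lemma det_mx2 (K : comPzRingType) (M : 'M[K]_2) :
  \det M = M ord0 ord0 * M ord_max ord_max - M ord0 ord_max * M ord_max ord0.
Proof.
rewrite (expand_det_row _ ord0) big_ord_recl big_ord1 /cofactor !det_mx11 !mxE /=.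
rewrite (_ : lift ord0 ord0 = ord_max :> 'I_2); last exact/val_inj.
rewrite (_ : lift ord_max 0 = ord0 :> 'I_2); last exact/val_inj.
by rewrite addn0 expr0 mul1r expr1 mulN1r mulrN.
Qed.

Section RealForm.
Variable R : realType.
Implicit Types (v : 'rV[R]_4 -> R) (x : 'rV[R]_4) (Omega : set 'rV[R]_4).

Lemma half_realC : (2^-1 : R[i]) = (2^-1 : R)%:C.
Proof. by rewrite fmorphV rmorph_nat. Qed.

Lemma dz_arith (a b c d : R) : 2^-1 * ((a +i* c) - (0 +i* 1) * (b +i* d)) =
  (2^-1 * (a + d)) +i* (2^-1 * (c - b)).
Proof.
rewrite half_realC; apply/eqP; rewrite eq_complex /=.
by apply/andP; split; apply/eqP; ring.
Qed.

Lemma dzbar_arith (a b c d : R) : 2^-1 * ((a +i* c) + (0 +i* 1) * (b +i* d)) =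
  (2^-1 * (a - d)) +i* (2^-1 * (c + b)).
Proof.
rewrite half_realC; apply/eqP; rewrite eq_complex /=.
by apply/andP; split; apply/eqP; ring.
Qed.

Lemma quarter_arith (a b c d : R) :
  (2^-1 * (2^-1 * a + 2^-1 * b)) +i* (2^-1 * (2^-1 * c - 2^-1 * d)) =
  (4^-1 * (a + b)) +i* (4^-1 * (c - d)).
Proof. by congr (_ +i* _); field. Qed.

Lemma dz_real v x i : dz i (fun y => (v y)%:C) x =
  (2^-1 * partial (x_coord i) v x) +i* (- (2^-1 * partial (y_coord i) v x)).
Proof.
by rewrite /dz /partialC dz_arith !partial_cst addr0 sub0r mulrN.
Qed.

Lemma dzbar_real v x i : dzbar i (fun y => (v y)%:C) x =
  (2^-1 * partial (x_coord i) v x) +i* (2^-1 * partial (y_coord i) v x).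
Proof.
by rewrite /dzbar /partialC dzbar_arith !partial_cst subr0 add0r.
Qed.

Lemma dz_dzbar_real Omega v x i j : Omega x -> Ck_on Omega 2 v ->
  dz i (dzbar j (fun y => (v y)%:C)) x =
  (4^-1 * (partial (x_coord i) (partial (x_coord j) v) x
       + partial (y_coord i) (partial (y_coord j) v) x)) +i*
  (4^-1 * (partial (x_coord i) (partial (y_coord j) v) x
       - partial (y_coord i) (partial (x_coord j) v) x)).
Proof.
move=> Ox Cv.
have -> : dzbar j (fun y => (v y)%:C) = fun y =>
  (2^-1 * partial (x_coord j) v y) +i* (2^-1 * partial (y_coord j) v y).
  by apply/funext => y; rewrite dzbar_real.
rewrite /dz /partialC dz_arith.
have E k l : partial k (fun y => 2^-1 * partial l v y) x = 2^-1 * partial k (partial l v) x.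
  have [_ Cl] := Ck_on_partial l Cv; have [dl _] := Cl k.
  by rewrite partialZ//; exact: dl.
rewrite (E (x_coord i) (x_coord j)) (E (y_coord i) (y_coord j)).
rewrite (E (x_coord i) (y_coord j)) (E (y_coord i) (x_coord j)).
exact: quarter_arith.
Qed.

Lemma pde_entry Omega v x i j : Omega x -> Ck_on Omega 2 v ->
  pde_matrix v x i j =
  (v x)%:C * ((4^-1 * (partial (x_coord i) (partial (x_coord j) v) x
       + partial (y_coord i) (partial (y_coord j) v) x)) +i*
  (4^-1 * (partial (x_coord i) (partial (y_coord j) v) x
       - partial (y_coord i) (partial (x_coord j) v) x))) +
  ((2^-1 * partial (x_coord i) v x) +i* (- (2^-1 * partial (y_coord i) v x))) *
  ((2^-1 * partial (x_coord j) v x) +i* (2^-1 * partial (y_coord j) v x)).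
Proof.
by move=> Ox Cv; rewrite mxE (dz_dzbar_real i j Ox Cv) dz_real dzbar_real.
Qed.

(** For $W = \nabla^2 v$ these are the entries of four times the complex Hessian: [ha] and [hb] on
    the diagonal, [hc] and [hd] the real and imaginary parts of $4 v_{z_1 \bar z_2}$. *)
Definition ha (W : 'M[R]_4) := W o1 o1 + W o3 o3.
Definition hb (W : 'M[R]_4) := W o2 o2 + W o4 o4.
Definition hc (W : 'M[R]_4) := W o1 o2 + W o3 o4.
Definition hd (W : 'M[R]_4) := W o1 o4 - W o2 o3.

(** [A1], [A2] and $Ac + i\,Ad$ are the entries of $-4$ times the matrix of the equation, so that
    the determinant becomes $16/16 = 1$. *)
Definition A1 v x := - v x * ha (hessian v x) - (partial o1 v x ^+ 2 + partial o3 v x ^+ 2).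
Definition A2 v x := - v x * hb (hessian v x) - (partial o2 v x ^+ 2 + partial o4 v x ^+ 2).
Definition Ac v x := - v x * hc (hessian v x)
  - (partial o1 v x * partial o2 v x + partial o3 v x * partial o4 v x).
Definition Ad v x := - v x * hd (hessian v x)
  - (partial o1 v x * partial o4 v x - partial o2 v x * partial o3 v x).

Lemma det_arith (s p1 p2 p3 p4 a11 a33 a22 a44 a12 a34 a14 a23 a13 a24
    a21 a43 a41 a32 a31 a42 : R) :
  a21 = a12 -> a43 = a34 -> a41 = a14 -> a32 = a23 -> a31 = a13 -> a42 = a24 ->
  (s%:C * ((4^-1 * (a11 + a33)) +i* (4^-1 * (a13 - a31)))
    + ((2^-1 * p1) +i* (- (2^-1 * p3))) * ((2^-1 * p1) +i* (2^-1 * p3))) *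
  (s%:C * ((4^-1 * (a22 + a44)) +i* (4^-1 * (a24 - a42)))
    + ((2^-1 * p2) +i* (- (2^-1 * p4))) * ((2^-1 * p2) +i* (2^-1 * p4))) -
  (s%:C * ((4^-1 * (a12 + a34)) +i* (4^-1 * (a14 - a32)))
    + ((2^-1 * p1) +i* (- (2^-1 * p3))) * ((2^-1 * p2) +i* (2^-1 * p4))) *
  (s%:C * ((4^-1 * (a21 + a43)) +i* (4^-1 * (a23 - a41)))
    + ((2^-1 * p2) +i* (- (2^-1 * p4))) * ((2^-1 * p1) +i* (2^-1 * p3))) = 16^-1 ->
  (- s * (a11 + a33) - (p1 ^+ 2 + p3 ^+ 2)) *
  (- s * (a22 + a44) - (p2 ^+ 2 + p4 ^+ 2)) -
  (- s * (a12 + a34) - (p1 * p2 + p3 * p4)) ^+ 2 -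
  (- s * (a14 - a23) - (p1 * p4 - p2 * p3)) ^+ 2 = 1.
Proof.
move=> -> -> -> -> -> ->; rewrite (_ : 16^-1 = (16^-1 : R)%:C); last by rewrite fmorphV rmorph_nat.
move/eqP; rewrite eq_complex => /andP[/eqP /= H _].
transitivity (16 * 16^-1 : R); last by rewrite divff.
by rewrite -H; field.
Qed.

Lemma pde_real Omega v x : open Omega -> Omega x -> Ck_on Omega 2 v ->
  \det (pde_matrix v x) = 16^-1 ->
  A1 v x * A2 v x - Ac v x ^+ 2 - Ad v x ^+ 2 = 1.
Proof.
move=> oO Ox Cv.
have sy i j := partial_comm i j oO Ox Cv.
rewrite det_mx2 (pde_entry ord0 ord0 Ox Cv) (pde_entry ord0 ord_max Ox Cv).
rewrite (pde_entry ord_max ord0 Ox Cv) (pde_entry ord_max ord_max Ox Cv).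
rewrite /A1 /A2 /Ac /Ad /ha /hb /hc /hd !mxE.
exact: (det_arith (sy o2 o1) (sy o4 o3) (sy o4 o1) (sy o3 o2) (sy o3 o1) (sy o4 o2)).
Qed.

End RealForm.

(** * The determinant as a Lorentzian form, and the algebraic core of the estimate *)

Section LorentzForm.
Variable R : realFieldType.

(* The quadratic form [det] on Hermitian 2x2 matrices [[x1, xc + i xd], [xc - i xd, x2]] and twice its polar form. *)
Definition lq (x1 x2 xc xd : R) := x1 * x2 - xc ^+ 2 - xd ^+ 2.
Definition lb (x1 x2 xc xd y1 y2 yc yd : R) :=
  x1 * y2 + x2 * y1 - 2 * (xc * yc) - 2 * (xd * yd).

(** Reversed Cauchy-Schwarz: the orthogonal complement of a timelike vector is spacelike. After
    multiplication by $A_1^2$ this is an explicit sum of squares. *)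
Lemma lq_orth_le0 (A1 A2 Ac Ad B1 B2 Bc Bd : R) : 0 < A1 ->
  lq A1 A2 Ac Ad = 1 -> lb A1 A2 Ac Ad B1 B2 Bc Bd = 0 -> lq B1 B2 Bc Bd <= 0.
Proof.
rewrite /lq /lb => A0 qA bAB.
suff : 0 <= A1 ^+ 2 * - (B1 * B2 - Bc ^+ 2 - Bd ^+ 2).
  by rewrite pmulr_rge0 ?exprn_gt0// oppr_ge0.
have -> : A1 ^+ 2 * - (B1 * B2 - Bc ^+ 2 - Bd ^+ 2) =
    (A1 * Bc - Ac * B1) ^+ 2 + (A1 * Bd - Ad * B1) ^+ 2
    + B1 ^+ 2 * (A1 * A2 - Ac ^+ 2 - Ad ^+ 2)
    - A1 * B1 * (A1 * B2 + A2 * B1 - 2 * (Ac * Bc) - 2 * (Ad * Bd)) by ring.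
by rewrite qA bAB mulr0 subr0 mulr1 !addr_ge0 ?sqr_ge0.
Qed.

(** The right side minus the left side is $-2 q_B s^{-1} (A_h/(sQ) - 1)$. It is nonnegative because
    $q_B \le 0$ and $s A_h = 2 + N \ge 1 + N = s^2 Q$. *)
Lemma core_scalar (s s' s'' qB Ah N Bh nh Bn qn An An2 Q : R) :
  0 < s -> 0 < Q -> qB <= 0 -> s * Ah = 2 + N -> s ^+ 2 * Q = 1 + N ->
  s^-1 * (- 2 * qB - 2 * s' * (s^-1 * (An - s' * Ah)) - s'' * Ah + An2) <=
  2 * (Q^-1 * (s^-1 * (Bh - 2 * s' * Q + nh) * (s^-1 * (An - s' * Ah))
     - (s ^+ 2)^-1 * (qB + s' ^+ 2 * Q + qn - s' * Bh + Bn - s' * nh) * Ah)) +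
  s^-1 * (2 * s' / s * An - 2 / (s * Q) * (Bh * An - Bn * Ah)
    - 2 / (s * Q) * (nh * An - qn * Ah) - s'' * Ah + An2).
Proof.
move=> s0 Q0 qB0 sbh sqh; rewrite -subr_ge0.
set X := (X in 0 <= X).
have -> : X = 2 * s^-1 * - qB * (Ah / (s * Q) - 1).
  by rewrite /X; field; rewrite !gt_eqF.
rewrite !mulr_ge0 ?oppr_ge0 ?invr_ge0 ?(ltW s0)//.
rewrite subr_ge0 ler_pdivlMr ?mul1r ?mulr_gt0//.
rewrite -(ler_pM2l s0) mulrA -expr2 sqh sbh; lra.
Qed.

(* The right-hand side vanishes to first order in [n'], [n''] and [s'']. *)
Lemma core_inequality (s s' s'' a b c d a' b' c' d' a'' b'' c'' d'' : R)
    (n1 n2 nc nd n1' n2' nc' nd' n1'' n2'' nc'' nd'' : R)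
    (A1 := s * a - n1) (A2 := s * b - n2) (Ac := s * c - nc) (Ad := s * d - nd)
    (B1 := s * a' + s' * a - n1') (B2 := s * b' + s' * b - n2')
    (Bc := s * c' + s' * c - nc') (Bd := s * d' + s' * d - nd')
    (C1 := s * a'' + 2 * (s' * a') + s'' * a - n1'')
    (C2 := s * b'' + 2 * (s' * b') + s'' * b - n2'')
    (Cc := s * c'' + 2 * (s' * c') + s'' * c - nc'')
    (Cd := s * d'' + 2 * (s' * d') + s'' * d - nd'')
    (bA := lb A1 A2 Ac Ad) (qh := lq a b c d) :
  0 < s -> 0 < A1 -> lq A1 A2 Ac Ad = 1 -> lq n1 n2 nc nd = 0 ->
  0 <= bA n1 n2 nc nd ->
  bA B1 B2 Bc Bd = 0 -> bA C1 C2 Cc Cd + 2 * lq B1 B2 Bc Bd = 0 ->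
  bA a'' b'' c'' d'' <=
  2 * (qh^-1 * (lb a b c d a' b' c' d' * bA a' b' c' d' - lq a' b' c' d' * bA a b c d)) +
  s^-1 * (2 * s' / s * bA n1' n2' nc' nd'
    - 2 / (s * qh) * (lb B1 B2 Bc Bd a b c d * bA n1' n2' nc' nd'
                      - lb B1 B2 Bc Bd n1' n2' nc' nd' * bA a b c d)
    - 2 / (s * qh) * (lb n1' n2' nc' nd' a b c d * bA n1' n2' nc' nd'
                      - lq n1' n2' nc' nd' * bA a b c d)
    - s'' * bA a b c d + bA n1'' n2'' nc'' nd'').
Proof.
move=> s0 A0 qA qn bn0 bB bC.
have qB := lq_orth_le0 A0 qA bB.
(* Expand the determinant of $sh = A + n$, where $h = (a,b,c,d)$ and $\det n = 0$. *)
have sqh : s ^+ 2 * qh = 1 + bA n1 n2 nc nd.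
  transitivity (lq A1 A2 Ac Ad + bA n1 n2 nc nd + lq n1 n2 nc nd).
    by rewrite /qh /bA /lq /lb /A1 /A2 /Ac /Ad; ring.
  by rewrite qA qn addr0.
have sbh : s * bA a b c d = 2 + bA n1 n2 nc nd.
  transitivity (2 * lq A1 A2 Ac Ad + bA n1 n2 nc nd); last by rewrite qA mulr1.
  by rewrite /bA /lq /lb /A1 /A2 /Ac /Ad; ring.
have qh0 : 0 < qh.
  by rewrite -(pmulr_rgt0 _ (exprn_gt0 2 s0)) sqh ltr_wpDr.
have sn : s != 0 by rewrite gt_eqF.
have qn0 : qh != 0 by rewrite gt_eqF.
(* The derivatives of $h$ are eliminated in favour of the derivative $B$ of $A$, which is orthogonal
   to $A$ and whose determinant therefore has a sign. *)
have e1 : bA a' b' c' d' = s^-1 * (bA n1' n2' nc' nd' - s' * bA a b c d).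
  apply: (mulfI sn); rewrite mulVKf// -[RHS]addr0 -bB /bA /lb /B1 /B2 /Bc /Bd.
  by ring.
have e2 : lb a b c d a' b' c' d' =
  s^-1 * (lb B1 B2 Bc Bd a b c d - 2 * s' * qh + lb n1' n2' nc' nd' a b c d).
  by apply: (mulfI sn); rewrite mulVKf// /qh /lq /lb /B1 /B2 /Bc /Bd; ring.
have e3 : lq a' b' c' d' = (s ^+ 2)^-1 *
  (lq B1 B2 Bc Bd + s' ^+ 2 * qh + lq n1' n2' nc' nd' - s' * lb B1 B2 Bc Bd a b c d
   + lb B1 B2 Bc Bd n1' n2' nc' nd' - s' * lb n1' n2' nc' nd' a b c d).
  apply: (mulfI (expf_neq0 2 sn)); rewrite mulVKf ?expf_neq0//.
  by rewrite /qh /lq /lb /B1 /B2 /Bc /Bd; ring.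
have e4 : bA a'' b'' c'' d'' = s^-1 * (- 2 * lq B1 B2 Bc Bd
    - 2 * s' * bA a' b' c' d' - s'' * bA a b c d + bA n1'' n2'' nc'' nd'').
  apply: (mulfI sn); rewrite mulVKf// -[RHS]addr0 -bC /bA /lb /C1 /C2 /Cc /Cd.
  by ring.
rewrite e4 e2 e3 e1.
exact: core_scalar sbh sqh.
Qed.

End LorentzForm.

Lemma I4P (P : 'I_4 -> Prop) : P o1 -> P o2 -> P o3 -> P o4 -> forall i, P i.
Proof.
move=> P1 P2 P3 P4 [[|[|[|[|//]]]] lti].
- by rewrite (_ : Ordinal lti = o1)//; exact/val_inj.
- by rewrite (_ : Ordinal lti = o2)//; exact/val_inj.
- by rewrite (_ : Ordinal lti = o3)//; exact/val_inj.
- by rewrite (_ : Ordinal lti = o4)//; exact/val_inj.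
Qed.

(** * Hermitian forms on C^2 as real matrices, and a frame adapted to the equation *)

Section ComplexStructure.
Variable R : realType.
Implicit Types (f g u : 'rV[R]_4) (W D H : 'M[R]_4).

Definition mk4 (x1 x2 x3 x4 : R) : 'rV[R]_4 := \row_j nth 0 [:: x1; x2; x3; x4] j.

Lemma mk4E x1 x2 x3 x4 : (mk4 x1 x2 x3 x4 0 o1 = x1) * (mk4 x1 x2 x3 x4 0 o2 = x2)
  * (mk4 x1 x2 x3 x4 0 o3 = x3) * (mk4 x1 x2 x3 x4 0 o4 = x4).
Proof. by rewrite !mxE. Qed.

Definition table4 (t : seq (seq R)) : 'M[R]_4 := \matrix_(i, j) nth 0 (nth [::] t i) j.

(* Right multiplication by [Jm] is multiplication by sqrt(-1) on C^2. *)
Definition Jm : 'M[R]_4 := table4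
  [:: [:: 0; 0; 1; 0]; [:: 0; 0; 0; 1]; [:: -1; 0; 0; 0]; [:: 0; -1; 0; 0]].

(* The real symmetric matrix of the Hermitian matrix [[a, c + i d], [c - i d, b]]. *)
Definition Hm (a b c d : R) : 'M[R]_4 := table4
  [:: [:: a; c; 0; d]; [:: c; b; - d; 0]; [:: 0; - d; a; c]; [:: d; 0; c; b]].

(** Twice the part of [D] invariant under the complex structure. For a real Hessian it is the real
    form of four times the complex Hessian, the only part of the second derivatives that the
    equation sees. *)
Definition Hhat D : 'M[R]_4 := D + Jm *m D *m Jm^T.

Definition qf D f g : R := (f *m D *m g^T) 0 0.

Lemma qfE D f g : qf D f g = \sum_i \sum_j f 0 i * D i j * g 0 j.
Proof.
rewrite /qf mxE exchange_big /=; apply: eq_bigr => j _.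
by rewrite !mxE mulr_suml.
Qed.

Lemma qf_tr D f g : qf D^T f g = qf D g f.
Proof.
by rewrite /qf -[in LHS](trmxK f) -trmx_mul -trmx_mul mxE mulmxA.
Qed.

Lemma qfDm D D' f g : qf (D + D') f g = qf D f g + qf D' f g.
Proof. by rewrite /qf mulmxDr mulmxDl mxE. Qed.

Lemma qfZm a D f g : qf (a *: D) f g = a * qf D f g.
Proof. by rewrite /qf -scalemxAr -scalemxAl mxE. Qed.

Lemma qfNm D f g : qf (- D) f g = - qf D f g.
Proof. by rewrite -scaleN1r qfZm mulN1r. Qed.

Lemma HhatE D : D^T = D -> Hhat D = Hm (ha D) (hb D) (hc D) (hd D).
Proof.
move=> sD; have s i j : D i j = D j i by rewrite -[in LHS]sD mxE.
rewrite /Hhat; apply/matrixP; apply: I4P; apply: I4P;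
  rewrite !mxE !sum4 !mxE !sum4 !mxE /= /ha /hb /hc /hd;
  rewrite ?(s o2 o1) ?(s o3 o1) ?(s o4 o1) ?(s o3 o2) ?(s o4 o2) ?(s o4 o3); ring.
Qed.

Lemma Hm_adj a b c d : Hm b a (- c) (- d) *m Hm a b c d = (lq a b c d)%:M.
Proof.
apply/matrixP; apply: I4P; apply: I4P; rewrite !mxE !sum4 !mxE /= /lq; ring.
Qed.

Lemma Hm_comm a b c d : Jm *m Hm a b c d = Hm a b c d *m Jm.
Proof.
apply/matrixP; apply: I4P; apply: I4P; rewrite !mxE !sum4 !mxE /=; ring.
Qed.

Lemma Hm_tr a b c d : (Hm a b c d)^T = Hm a b c d.
Proof. by apply/matrixP; apply: I4P; apply: I4P; rewrite !mxE /=. Qed.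

(* For Hermitian 2x2 matrices, [X adj(Y) X = tr(X adj(Y)) X - det(X) Y]. *)
Lemma Hm_quad a b c d a' b' c' d' :
  Hm a' b' c' d' *m Hm b a (- c) (- d) *m Hm a' b' c' d' =
  lb a b c d a' b' c' d' *: Hm a' b' c' d' - lq a' b' c' d' *: Hm a b c d.
Proof.
apply/matrixP; apply: I4P; apply: I4P;
  rewrite !mxE !sum4 !mxE !sum4 !mxE /= /lq /lb; ring.
Qed.

Section Frame.
Variables A1 A2 Ac Ad : R.

(* If [A = (A1, A2, Ac, Ad)] has determinant 1, then [Sum_m f_m f_m^* = A1 adj(A)]. *)
Definition frame (m : 'I_4) : 'rV[R]_4 :=
  nth 0 [:: mk4 (- Ac) A1 Ad 0; mk4 1 0 0 0;
            mk4 (- Ac) A1 Ad 0 *m Jm; mk4 1 0 0 0 *m Jm] m.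

Lemma sum_frame (F : 'rV[R]_4 -> R) : \sum_m F (frame m) =
  (F (frame o1) + F (frame o1 *m Jm)) + (F (frame o2) + F (frame o2 *m Jm)).
Proof. by rewrite sum4 /frame /=; ring. Qed.

Lemma qf_frame a b c d : lq A1 A2 Ac Ad = 1 ->
  qf (Hm a b c d) (frame o1) (frame o1) + qf (Hm a b c d) (frame o2) (frame o2) =
  A1 * lb A1 A2 Ac Ad a b c d.
Proof.
move=> qA; rewrite !qfE !sum4 /frame /= !mk4E !mxE /=.
transitivity (A1 * lb A1 A2 Ac Ad a b c d + a * (1 - lq A1 A2 Ac Ad)).
  by rewrite /lb /lq; ring.
by rewrite qA subrr mulr0 addr0.
Qed.

Lemma qf_pair D f g : qf D f g + qf D (f *m Jm) (g *m Jm) = qf (Hhat D) f g.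
Proof. by rewrite /qf /Hhat mulmxDr mulmxDl trmx_mul !mulmxA [RHS]mxE. Qed.

Lemma sum_qf_frame D : D^T = D -> lq A1 A2 Ac Ad = 1 ->
  \sum_m qf D (frame m) (frame m) = A1 * lb A1 A2 Ac Ad (ha D) (hb D) (hc D) (hd D).
Proof.
move=> sD qA; rewrite (sum_frame (fun f => qf D f f)) !qf_pair HhatE//.
exact: qf_frame.
Qed.

Definition Hinv W : 'M[R]_4 :=
  (lq (ha W) (hb W) (hc W) (hd W))^-1 *: Hm (hb W) (ha W) (- hc W) (- hd W).

(** For symmetric [W] with [Hhat W] invertible, [Hinv W] is its inverse. Then [zeta] is the critical
    point $z$ of $2 \langle f \hat D, z\rangle - \langle z \hat W, z\rangle$ when [D] is symmetric
    too. It is linear in [D] and commutes with the complex structure in [f]. *)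
Definition zeta W D f : 'rV[R]_4 := f *m Hhat D *m Hinv W.

Lemma zeta_J W D f : D^T = D -> zeta W D (f *m Jm) = zeta W D f *m Jm.
Proof.
move=> sD; rewrite /zeta HhatE// /Hinv -!scalemxAr -scalemxAl; congr (_ *: _).
by rewrite -[f *m Jm *m _]mulmxA Hm_comm mulmxA -[LHS]mulmxA Hm_comm mulmxA.
Qed.

(** At the critical point the value is the form $\hat D \hat W^{-1} \hat D$ at [f]. Since $\hat
    W^{-1}$ is a multiple of the adjugate, [Hm_quad] expands it in $\hat D$ and $\hat W$. *)
Lemma zeta_pair W D f : W^T = W -> D^T = D ->
  lq (ha W) (hb W) (hc W) (hd W) != 0 ->
  2 * qf (Hhat D) f (zeta W D f) - qf (Hhat W) (zeta W D f) (zeta W D f) =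
  (lq (ha W) (hb W) (hc W) (hd W))^-1 *
    qf (lb (ha W) (hb W) (hc W) (hd W) (ha D) (hb D) (hc D) (hd D)
          *: Hm (ha D) (hb D) (hc D) (hd D)
       - lq (ha D) (hb D) (hc D) (hd D) *: Hm (ha W) (hb W) (hc W) (hd W)) f f.
Proof.
move=> sW sD q0; set q := lq _ _ _ _ in q0 *.
have HW : zeta W D f *m Hhat W = f *m Hhat D.
  rewrite /zeta (HhatE sW) /Hinv -!scalemxAr -scalemxAl -mulmxA Hm_adj -/q.
  by rewrite mul_mx_scalar scalerA mulVf// scale1r.
rewrite {2}/qf HW -/(qf (Hhat D) f (zeta W D f)).
rewrite (_ : 2 * qf _ _ _ - _ = qf (Hhat D) f (zeta W D f)); last by ring.
rewrite -Hm_quad -(HhatE sD) -qfZm /qf; congr (_ 0 0).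
rewrite /zeta /Hinv -/q !trmx_mul linearZ/= Hm_tr (HhatE sD) Hm_tr.
by rewrite -!(scalemxAl, scalemxAr) !mulmxA.
Qed.

(** This recognises the quadratic term on the right of [core_inequality] as a completed square, the
    form in which moving [X] can absorb it. The frame contains [f *m Jm] with each [f], so only the
    invariant parts contribute to the sum. *)
Lemma sum_zeta_frame W D : W^T = W -> D^T = D -> lq A1 A2 Ac Ad = 1 ->
  lq (ha W) (hb W) (hc W) (hd W) != 0 ->
  \sum_m (2 * qf D (frame m) (zeta W D (frame m))
          - qf W (zeta W D (frame m)) (zeta W D (frame m))) =
  A1 * ((lq (ha W) (hb W) (hc W) (hd W))^-1 *
   (lb (ha W) (hb W) (hc W) (hd W) (ha D) (hb D) (hc D) (hd D)
      * lb A1 A2 Ac Ad (ha D) (hb D) (hc D) (hd D)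
    - lq (ha D) (hb D) (hc D) (hd D) * lb A1 A2 Ac Ad (ha W) (hb W) (hc W) (hd W))).
Proof.
move=> sW sD qA q0.
rewrite (sum_frame (fun f => 2 * qf D f (zeta W D f) - qf W (zeta W D f) (zeta W D f))).
rewrite !zeta_J//.
have pair f : 2 * qf D f (zeta W D f) - qf W (zeta W D f) (zeta W D f) +
   (2 * qf D (f *m Jm) (zeta W D f *m Jm)
    - qf W (zeta W D f *m Jm) (zeta W D f *m Jm)) =
   2 * qf (Hhat D) f (zeta W D f) - qf (Hhat W) (zeta W D f) (zeta W D f).
  by rewrite -!qf_pair; ring.
rewrite !pair !zeta_pair// !qfDm !qfNm !qfZm.
have h1 := qf_frame (ha D) (hb D) (hc D) (hd D) qA.
have h2 := qf_frame (ha W) (hb W) (hc W) (hd W) qA.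
rewrite -mulrDr [RHS]mulrCA; congr (_ * _).
set l := lb (ha W) (hb W) (hc W) (hd W) (ha D) (hb D) (hc D) (hd D).
set q := lq (ha D) (hb D) (hc D) (hd D).
transitivity (l * (A1 * lb A1 A2 Ac Ad (ha D) (hb D) (hc D) (hd D))
  - q * (A1 * lb A1 A2 Ac Ad (ha W) (hb W) (hc W) (hd W))); last by ring.
rewrite -h1 -h2.
by ring.
Qed.

(** The frame pairings contain $u_1$ and $u_3$ themselves, and $A_1u_2$, $A_1u_4$ up to multiples of
    these. The constants come from $(a+b+c)^2 \le 3(a^2+b^2+c^2)$. *)
Lemma frame_coercive u :
  u 0 o1 ^+ 2 + u 0 o3 ^+ 2 + A1 ^+ 2 * (u 0 o2 ^+ 2 + u 0 o4 ^+ 2) <=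
  (3 + 3 * (Ac ^+ 2 + Ad ^+ 2)) * \sum_m ((frame m *m u^T) 0 0) ^+ 2.
Proof.
rewrite (sum_frame (fun f => (f *m u^T) 0 0 ^+ 2)) /frame /=.
have E f : (f *m u^T) 0 0 = f 0 o1 * u 0 o1 + f 0 o2 * u 0 o2 + f 0 o3 * u 0 o3 + f 0 o4 * u 0 o4.
  by rewrite mxE sum4 !mxE.
rewrite !E !mxE !sum4 !mxE /=.
move: (u 0 o1) (u 0 o2) (u 0 o3) (u 0 o4) => u1 u2 u3 u4.
rewrite -subr_ge0.
set t1 := - Ac * u1 + A1 * u2 + Ad * u3.
set t3 := - Ad * u1 - Ac * u3 + A1 * u4.
set X := (X in 0 <= X).
have -> : X = 2 * (u1 ^+ 2 + u3 ^+ 2) + 3 * (Ac ^+ 2 + Ad ^+ 2) * (t1 ^+ 2 + t3 ^+ 2) +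
   ((t1 - Ac * u1) ^+ 2 + (t1 + Ad * u3) ^+ 2 + (Ac * u1 + Ad * u3) ^+ 2) +
   ((t3 - Ad * u1) ^+ 2 + (t3 - Ac * u3) ^+ 2 + (Ad * u1 - Ac * u3) ^+ 2).
  by rewrite /X /t1 /t3; ring.
by repeat first [exact: sqr_ge0 | exact: ler0n | apply: addr_ge0 | apply: mulr_ge0].
Qed.

End Frame.

End ComplexStructure.

(** * The twice differentiated equation *)

Section DifferentiatedEquation.
Variable R : realType.
Implicit Types (v w : 'rV[R]_4 -> R) (x u : 'rV[R]_4) (Omega : set 'rV[R]_4).

Definition D1 u w x : R := \sum_k u 0 k * partial k w x.
Definition D2 u w x : R := \sum_k u 0 k * \sum_l u 0 l * partial l (partial k w) x.

Definition dW v u x : 'M[R]_4 := \matrix_(i, j) D1 u (partial i (partial j v)) x.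
Definition ddW v u x : 'M[R]_4 := \matrix_(i, j) D2 u (partial i (partial j v)) x.

Lemma jet2_D Omega w x u : open Omega -> Omega x -> Ck_on Omega 2 w ->
  jet2 (fun s => w (x + s *: u)) (D1 u w x) (D2 u w x).
Proof. exact: jet2_dir. Qed.

Lemma jet2_comb (V X Y P Q S T : R -> R) (v1 v2 x1 x2 y1 y2 p1 p2 q1 q2 s1 s2 t1 t2 : R) :
  jet2 V v1 v2 -> jet2 X x1 x2 -> jet2 Y y1 y2 -> jet2 P p1 p2 -> jet2 Q q1 q2 ->
  jet2 S s1 s2 -> jet2 T t1 t2 ->
  jet2 (fun t => - V t * (X t + Y t) - (P t * Q t + S t * T t))
    (- V 0 * (x1 + y1) + - v1 * (X 0 + Y 0) - (p1 * Q 0 + P 0 * q1 + (s1 * T 0 + S 0 * t1)))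
    (- V 0 * (x2 + y2) + 2 * (- v1 * (x1 + y1)) + - v2 * (X 0 + Y 0)
     - (p2 * Q 0 + 2 * (p1 * q1) + P 0 * q2 + (s2 * T 0 + 2 * (s1 * t1) + S 0 * t2))).
Proof.
move=> jV jX jY jP jQ jS jT.
by apply: jet2_eq (jet2B (jet2M (jet2N jV) (jet2D jX jY))
  (jet2D (jet2M jP jQ) (jet2M jS jT))) _ _; ring.
Qed.

Lemma jet2_comb_sub (V X Y P Q S T : R -> R) (v1 v2 x1 x2 y1 y2 p1 p2 q1 q2 s1 s2 t1 t2 : R) :
  jet2 V v1 v2 -> jet2 X x1 x2 -> jet2 Y y1 y2 -> jet2 P p1 p2 -> jet2 Q q1 q2 ->
  jet2 S s1 s2 -> jet2 T t1 t2 ->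
  jet2 (fun t => - V t * (X t - Y t) - (P t * Q t - S t * T t))
    (- V 0 * (x1 - y1) + - v1 * (X 0 - Y 0) - (p1 * Q 0 + P 0 * q1 - (s1 * T 0 + S 0 * t1)))
    (- V 0 * (x2 - y2) + 2 * (- v1 * (x1 - y1)) + - v2 * (X 0 - Y 0)
     - (p2 * Q 0 + 2 * (p1 * q1) + P 0 * q2 - (s2 * T 0 + 2 * (s1 * t1) + S 0 * t2))).
Proof.
move=> jV jX jY jP jQ jS jT.
by apply: jet2_eq (jet2B (jet2M (jet2N jV) (jet2B jX jY))
  (jet2B (jet2M jP jQ) (jet2M jS jT))) _ _; ring.
Qed.

(* First and second variations of the products [p i * p j]. *)
Definition pp1 (p p' : 'I_4 -> R) i j : R := p' i * p j + p i * p' j.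
Definition pp2 (p p' p'' : 'I_4 -> R) i j : R :=
  p'' i * p j + 2 * (p' i * p' j) + p i * p'' j.

Lemma jet2_lq (F1 F2 Fc Fd : R -> R) (B1 B2 Bc Bd C1 C2 Cc Cd : R) :
  (\forall t \near (0 : R), lq (F1 t) (F2 t) (Fc t) (Fd t) = lq (F1 0) (F2 0) (Fc 0) (Fd 0)) ->
  jet2 F1 B1 C1 -> jet2 F2 B2 C2 -> jet2 Fc Bc Cc -> jet2 Fd Bd Cd ->
  lb (F1 0) (F2 0) (Fc 0) (Fd 0) B1 B2 Bc Bd = 0 /\
  lb (F1 0) (F2 0) (Fc 0) (Fd 0) C1 C2 Cc Cd + 2 * lq B1 B2 Bc Bd = 0.
Proof.
move=> eqn j1 j2 jc jd.
have [|E1 E2] := jet2_cst_near (jet2B (jet2B (jet2M j1 j2) (jet2M jc jc)) (jet2M jd jd)).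
  by near=> t; rewrite -!expr2; near: t.
rewrite /lb /lq.
split; first by rewrite -[RHS]E1; ring.
by rewrite -[RHS]E2; ring.
Unshelve. all: by end_near. Qed.

Lemma lq_rank1 (p1 p2 p3 p4 : R) :
  lq (p1 * p1 + p3 * p3) (p2 * p2 + p4 * p4) (p1 * p2 + p3 * p4) (p1 * p4 - p2 * p3) = 0.
Proof. by rewrite /lq; ring. Qed.

(** A positive definite Hermitian matrix paired with the positive semidefinite rank one matrix of a
    gradient. *)
Lemma lb_rank1_ge0 (B1 B2 Bc Bd p1 p2 p3 p4 : R) : 0 < B1 -> lq B1 B2 Bc Bd = 1 ->
  0 <= lb B1 B2 Bc Bd (p1 * p1 + p3 * p3) (p2 * p2 + p4 * p4)
         (p1 * p2 + p3 * p4) (p1 * p4 - p2 * p3).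
Proof.
move=> B0 qB; rewrite -(pmulr_rge0 _ B0).
set X := (X in 0 <= X).
suff -> : X = (B1 * p2 - Bc * p1 + Bd * p3) ^+ 2 + (B1 * p4 - Bc * p3 - Bd * p1) ^+ 2 +
   (p1 ^+ 2 + p3 ^+ 2) * lq B1 B2 Bc Bd.
  by rewrite qB mulr1 !addr_ge0 ?sqr_ge0.
by rewrite /X /lb /lq; ring.
Qed.

(** The real Hessian may degenerate but the complex one cannot: with $sh = A + n$ one has $s^2 \det
    h = 1 + \langle A, n\rangle \ge 1$. This keeps [Hinv] bounded on compact sets. *)
Lemma lq_hessian_ge (s a b c d n1 n2 nc nd : R) : 0 < s ->
  lq (s * a - n1) (s * b - n2) (s * c - nc) (s * d - nd) = 1 ->
  lq n1 n2 nc nd = 0 ->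
  0 <= lb (s * a - n1) (s * b - n2) (s * c - nc) (s * d - nd) n1 n2 nc nd ->
  1 <= s ^+ 2 * lq a b c d.
Proof.
move=> s0 qA qn bn0.
have -> : s ^+ 2 * lq a b c d = lq (s * a - n1) (s * b - n2) (s * c - nc) (s * d - nd)
   + lb (s * a - n1) (s * b - n2) (s * c - nc) (s * d - nd) n1 n2 nc nd + lq n1 n2 nc nd.
  by rewrite /lq /lb; ring.
by rewrite qA qn addr0 lerDl.
Qed.

Lemma lq_hessian_gt0 (s a b c d n1 n2 nc nd : R) : 0 < s ->
  lq (s * a - n1) (s * b - n2) (s * c - nc) (s * d - nd) = 1 ->
  lq n1 n2 nc nd = 0 ->
  0 <= lb (s * a - n1) (s * b - n2) (s * c - nc) (s * d - nd) n1 n2 nc nd ->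
  0 < lq a b c d.
Proof.
move=> s0 qA qn bn0; rewrite -(pmulr_rgt0 _ (exprn_gt0 2 s0)).
exact: lt_le_trans ltr01 (lq_hessian_ge s0 qA qn bn0).
Qed.

(** Splits the second variation of the gradient products. The part quadratic in the first variations
    [q] joins the error; the part linear in the second variations [r] becomes the drift. *)
Lemma lb_second (B1 B2 Bc Bd p1 p2 p3 p4 q1 q2 q3 q4 r1 r2 r3 r4 : R) :
  lb B1 B2 Bc Bd
    (r1 * p1 + 2 * (q1 * q1) + p1 * r1 + (r3 * p3 + 2 * (q3 * q3) + p3 * r3))
    (r2 * p2 + 2 * (q2 * q2) + p2 * r2 + (r4 * p4 + 2 * (q4 * q4) + p4 * r4))
    (r1 * p2 + 2 * (q1 * q2) + p1 * r2 + (r3 * p4 + 2 * (q3 * q4) + p3 * r4))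
    (r1 * p4 + 2 * (q1 * q4) + p1 * r4 - (r2 * p3 + 2 * (q2 * q3) + p2 * r3)) =
  lb B1 B2 Bc Bd (2 * (q1 ^+ 2 + q3 ^+ 2)) (2 * (q2 ^+ 2 + q4 ^+ 2))
       (2 * (q1 * q2 + q3 * q4)) (2 * (q1 * q4 - q2 * q3)) +
   (2 * (B2 * p1 - Bc * p2 - Bd * p4) * r1 +
    2 * (B1 * p2 - Bc * p1 + Bd * p3) * r2 +
    2 * (B2 * p3 - Bc * p4 + Bd * p2) * r3 +
    2 * (B1 * p4 - Bc * p3 - Bd * p1) * r4).
Proof. by rewrite /lb; ring. Qed.

Lemma pde_arith (B s X Y Z l1 l2 l3 l4 r1 r2 r3 r4 : R) :
  B * (2 * X + s^-1 * (Y + (Z + (l1 * r1 + l2 * r2 + l3 * r3 + l4 * r4)))) <=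
  2 * (B * X) + B / s * (Y + Z)
  + (B / s * l1 * r1 + B / s * l2 * r2 + B / s * l3 * r3 + B / s * l4 * r4).
Proof. by rewrite le_eqVlt; apply/orP; left; apply/eqP; ring. Qed.

Section AtPoint.
Variables (Omega : set 'rV[R]_4) (v : 'rV[R]_4 -> R) (x u : 'rV[R]_4).
Hypotheses (oO : open Omega) (Ox : Omega x) (Cv : Ck_on Omega 4 v).

Let s := - v x.
Let s' := - D1 u v x.
Let s'' := - D2 u v x.
Let p i := partial i v x.
Let p' i := D1 u (partial i v) x.
Let p'' i := D2 u (partial i v) x.
Let W := hessian v x.
Let D := dW v u x.
Let E := ddW v u x.

Let jv : jet2 (fun t => v (x + t *: u)) (D1 u v x) (D2 u v x).
Proof. by apply: jet2_D (oO) Ox _; do 2 apply: Ck_onW. Qed.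

Let jp i : jet2 (fun t => partial i v (x + t *: u)) (p' i) (p'' i).
Proof. by apply: jet2_D (oO) Ox _; apply: Ck_onW; exact: Ck_on_partial. Qed.

Let jW i j : jet2 (fun t => partial i (partial j v) (x + t *: u)) (D i j) (E i j).
Proof.
rewrite !mxE; apply: jet2_D (oO) Ox _.
by do 2 apply: Ck_on_partial.
Qed.

Lemma jet2_A1 : jet2 (fun t => A1 v (x + t *: u))
  (s * ha D + s' * ha W - (pp1 p p' o1 o1 + pp1 p p' o3 o3))
  (s * ha E + 2 * (s' * ha D) + s'' * ha W - (pp2 p p' p'' o1 o1 + pp2 p p' p'' o3 o3)).
Proof.
rewrite (_ : (fun t => A1 v (x + t *: u)) = fun t => - v (x + t *: u) *
   (partial o1 (partial o1 v) (x + t *: u) + partial o3 (partial o3 v) (x + t *: u))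
   - (partial o1 v (x + t *: u) * partial o1 v (x + t *: u)
     + partial o3 v (x + t *: u) * partial o3 v (x + t *: u))); last first.
  by apply/funext => t; rewrite /A1 /ha [hessian _ _ o1 o1]mxE [hessian _ _ o3 o3]mxE !expr2.
have := jet2_comb jv (jW o1 o1) (jW o3 o3) (jp o1) (jp o1) (jp o3) (jp o3).
by rewrite !scale0r !addr0 /ha /pp1 /pp2 [W o1 o1]mxE [W o3 o3]mxE.
Qed.

Lemma jet2_A2 : jet2 (fun t => A2 v (x + t *: u))
  (s * hb D + s' * hb W - (pp1 p p' o2 o2 + pp1 p p' o4 o4))
  (s * hb E + 2 * (s' * hb D) + s'' * hb W - (pp2 p p' p'' o2 o2 + pp2 p p' p'' o4 o4)).
Proof.
rewrite (_ : (fun t => A2 v (x + t *: u)) = fun t => - v (x + t *: u) *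
   (partial o2 (partial o2 v) (x + t *: u) + partial o4 (partial o4 v) (x + t *: u))
   - (partial o2 v (x + t *: u) * partial o2 v (x + t *: u)
     + partial o4 v (x + t *: u) * partial o4 v (x + t *: u))); last first.
  by apply/funext => t; rewrite /A2 /hb [hessian _ _ o2 o2]mxE [hessian _ _ o4 o4]mxE !expr2.
have := jet2_comb jv (jW o2 o2) (jW o4 o4) (jp o2) (jp o2) (jp o4) (jp o4).
by rewrite !scale0r !addr0 /hb /pp1 /pp2 [W o2 o2]mxE [W o4 o4]mxE.
Qed.

Lemma jet2_Ac : jet2 (fun t => Ac v (x + t *: u))
  (s * hc D + s' * hc W - (pp1 p p' o1 o2 + pp1 p p' o3 o4))
  (s * hc E + 2 * (s' * hc D) + s'' * hc W - (pp2 p p' p'' o1 o2 + pp2 p p' p'' o3 o4)).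
Proof.
rewrite (_ : (fun t => Ac v (x + t *: u)) = fun t => - v (x + t *: u) *
   (partial o1 (partial o2 v) (x + t *: u) + partial o3 (partial o4 v) (x + t *: u))
   - (partial o1 v (x + t *: u) * partial o2 v (x + t *: u)
     + partial o3 v (x + t *: u) * partial o4 v (x + t *: u))); last first.
  by apply/funext => t; rewrite /Ac /hc [hessian _ _ o1 o2]mxE [hessian _ _ o3 o4]mxE .
have := jet2_comb jv (jW o1 o2) (jW o3 o4) (jp o1) (jp o2) (jp o3) (jp o4).
by rewrite !scale0r !addr0 /hc /pp1 /pp2 [W o1 o2]mxE [W o3 o4]mxE.
Qed.

Lemma jet2_Ad : jet2 (fun t => Ad v (x + t *: u))
  (s * hd D + s' * hd W - (pp1 p p' o1 o4 - pp1 p p' o2 o3))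
  (s * hd E + 2 * (s' * hd D) + s'' * hd W - (pp2 p p' p'' o1 o4 - pp2 p p' p'' o2 o3)).
Proof.
rewrite (_ : (fun t => Ad v (x + t *: u)) = fun t => - v (x + t *: u) *
   (partial o1 (partial o4 v) (x + t *: u) - partial o2 (partial o3 v) (x + t *: u))
   - (partial o1 v (x + t *: u) * partial o4 v (x + t *: u)
     - partial o2 v (x + t *: u) * partial o3 v (x + t *: u))); last first.
  by apply/funext => t; rewrite /Ad /hd [hessian _ _ o1 o4]mxE [hessian _ _ o2 o3]mxE .
have := jet2_comb_sub jv (jW o1 o4) (jW o2 o3) (jp o1) (jp o4) (jp o2) (jp o3).
by rewrite !scale0r !addr0 /hd /pp1 /pp2 [W o1 o4]mxE [W o2 o3]mxE.
Qed.

Hypothesis eqn : forall y, Omega y -> lq (A1 v y) (A2 v y) (Ac v y) (Ad v y) = 1.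
Hypothesis s0 : 0 < - v x.
Hypothesis A0 : 0 < A1 v x.

Let bA := lb (A1 v x) (A2 v x) (Ac v x) (Ad v x).
Let a := ha W. Let b := hb W. Let c := hc W. Let d := hd W.
Let a' := ha D. Let b' := hb D. Let c' := hc D. Let d' := hd D.
Let qh := lq a b c d.
Let n1' := pp1 p p' o1 o1 + pp1 p p' o3 o3. Let n2' := pp1 p p' o2 o2 + pp1 p p' o4 o4.
Let nc' := pp1 p p' o1 o2 + pp1 p p' o3 o4. Let nd' := pp1 p p' o1 o4 - pp1 p p' o2 o3.

(* Everything in the error but the part of [n''] that is linear in [p''] is controlled by the gradient variation [p'] and by [s'']. *)
Definition error_term : R :=
  2 * s' / s * bA n1' n2' nc' nd'
    - 2 / (s * qh) * (lb (s * a' + s' * a - n1') (s * b' + s' * b - n2')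
          (s * c' + s' * c - nc') (s * d' + s' * d - nd') a b c d * bA n1' n2' nc' nd'
        - lb (s * a' + s' * a - n1') (s * b' + s' * b - n2')
          (s * c' + s' * c - nc') (s * d' + s' * d - nd') n1' n2' nc' nd' * bA a b c d)
    - 2 / (s * qh) * (lb n1' n2' nc' nd' a b c d * bA n1' n2' nc' nd'
                      - lq n1' n2' nc' nd' * bA a b c d)
    - s'' * bA a b c d
    + bA (2 * (p' o1 ^+ 2 + p' o3 ^+ 2)) (2 * (p' o2 ^+ 2 + p' o4 ^+ 2))
         (2 * (p' o1 * p' o2 + p' o3 * p' o4)) (2 * (p' o1 * p' o4 - p' o2 * p' o3)).

Definition drift (k : 'I_4) : R :=
  A1 v x / s * nth 0 [:: 2 * (A2 v x * p o1 - Ac v x * p o2 - Ad v x * p o4);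
            2 * (A1 v x * p o2 - Ac v x * p o1 + Ad v x * p o3);
            2 * (A2 v x * p o3 - Ac v x * p o4 + Ad v x * p o2);
            2 * (A1 v x * p o4 - Ac v x * p o3 - Ad v x * p o1)] k.

Let f := frame (A1 v x) (Ac v x) (Ad v x).

Let AE : (A1 v x = s * a - (p o1 * p o1 + p o3 * p o3)) *
  (A2 v x = s * b - (p o2 * p o2 + p o4 * p o4)) *
  (Ac v x = s * c - (p o1 * p o2 + p o3 * p o4)) *
  (Ad v x = s * d - (p o1 * p o4 - p o2 * p o3)).
Proof. by split; [split; [split|]|]. Qed.

(** This is [core_inequality] along the line through [x] in direction [u], multiplied by [A1 v x],
    the positive factor that relates the frame to the adjugate of $A$. *)
Lemma pde_inequality : W^T = W -> D^T = D -> E^T = E ->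
  \sum_m qf E (f m) (f m) <=
  2 * (\sum_m (2 * qf D (f m) (zeta W D (f m)) - qf W (zeta W D (f m)) (zeta W D (f m))))
  + A1 v x / s * error_term + \sum_k drift k * p'' k.
Proof.
move=> sW sD sE; have qA := eqn Ox.
have bn0 := lb_rank1_ge0 (p o1) (p o2) (p o3) (p o4) A0 qA.
have qn := lq_rank1 (p o1) (p o2) (p o3) (p o4).
have near1 : \forall t \near (0 : R), lq (A1 v (x + t *: u)) (A2 v (x + t *: u))
     (Ac v (x + t *: u)) (Ad v (x + t *: u)) =
   lq (A1 v (x + 0 *: u)) (A2 v (x + 0 *: u)) (Ac v (x + 0 *: u)) (Ad v (x + 0 *: u)).
  near=> t; rewrite eqn ?eqn ?scale0r ?addr0//.
  by near: t; exact: open_line_near.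
have := jet2_lq near1 jet2_A1 jet2_A2 jet2_Ac jet2_Ad.
rewrite scale0r addr0 => -[bB bC].
have A0' : 0 < s * a - (p o1 * p o1 + p o3 * p o3) by rewrite -AE.
move: bB bC bn0 (qA) ; rewrite !AE => bB bC bn0 qA'.
have qh0 : qh != 0 by rewrite gt_eqF// (lq_hessian_gt0 s0 qA' qn bn0).
have core := core_inequality s0 A0' qA' qn bn0 bB bC.
rewrite /pp2 lb_second -!AE -/bA in core.
rewrite (sum_qf_frame sE qA) (sum_zeta_frame sW sD qA qh0).
rewrite sum4; apply: le_trans (pde_arith _ _ _ _ _ _ _ _ _ _ _ _ _).
by rewrite (ler_pM2l A0); exact: core.
Unshelve. all: by end_near. Qed.

End AtPoint.
End DifferentiatedEquation.

(** * Positivity of the matrix of the equation *)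

Section Positivity.
Variable R : realType.
Implicit Types (v : 'rV[R]_4 -> R) (x u : 'rV[R]_4).

(** Determinant 1 excludes [B1 = 0]. If [B1 < 0], the identity [E] has a nonpositive left side and
    forces $p_1 = p_3 = 0$, but then $B_1 = sa \ge 0$. *)
Lemma diag_gt0 (s a b c d p1 p2 p3 p4 : R)
   (B1 := s * a - (p1 * p1 + p3 * p3)) (B2 := s * b - (p2 * p2 + p4 * p4))
   (Bc := s * c - (p1 * p2 + p3 * p4)) (Bd := s * d - (p1 * p4 - p2 * p3)) :
  0 < s -> 0 <= a ->
  0 <= lb a b c d (p1 * p1 + p3 * p3) (p2 * p2 + p4 * p4) (p1 * p2 + p3 * p4) (p1 * p4 - p2 * p3) ->
  lq B1 B2 Bc Bd = 1 -> 0 < B1.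
Proof.
move=> s0 a0 hn qB.
set N := lb _ _ _ _ _ _ _ _ in hn.
have E : B1 * (s * N) = (B1 * p2 - Bc * p1 + Bd * p3) ^+ 2 + (B1 * p4 - Bc * p3 - Bd * p1) ^+ 2 +
   (p1 ^+ 2 + p3 ^+ 2) * lq B1 B2 Bc Bd.
  by rewrite /N /lb /lq /B1 /B2 /Bc /Bd; ring.
rewrite qB mulr1 in E.
have B1n0 : B1 != 0.
  apply/eqP => B10; move: qB; rewrite /lq B10 mul0r sub0r => H.
  by have := sqr_ge0 Bc; have := sqr_ge0 Bd; lra.
rewrite lt_neqAle eq_sym B1n0 /= leNgt; apply/negP => B1lt0.
have : B1 * (s * N) <= 0 by rewrite nmulr_rle0// mulr_ge0// ltW.
have := sqr_ge0 p1; have := sqr_ge0 p3.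
have := sqr_ge0 (B1 * p2 - Bc * p1 + Bd * p3); have := sqr_ge0 (B1 * p4 - Bc * p3 - Bd * p1).
have : 0 <= s * a by rewrite mulr_ge0// ltW.
by move: B1lt0; rewrite {1}/B1 E; lra.
Qed.

Lemma A1_gt0 v x : - v x > 0 -> (hessian v x)^T = hessian v x ->
  (forall u, 0 <= qf (hessian v x) u u) ->
  lq (A1 v x) (A2 v x) (Ac v x) (Ad v x) = 1 -> 0 < A1 v x.
Proof.
move=> s0 sW W0 qA.
have H0 u : 0 <= qf (Hhat (hessian v x)) u u by rewrite -qf_pair addr_ge0.
rewrite (HhatE sW) in H0.
apply: (diag_gt0 s0 _ _ qA).
  have := H0 (mk4 1 0 0 0).
  by rewrite qfE !sum4 !mk4E !mxE /= !(mul0r, mulr0, addr0, mul1r, mulr1).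
(* At this vector the form of the complex Hessian equals its pairing with the rank one gradient
   matrix. *)
have := H0 (mk4 (- partial o2 v x) (partial o1 v x) (partial o4 v x) (- partial o3 v x)).
rewrite qfE !sum4 !mk4E !mxE /= /lb.
move: (partial o1 v x) (partial o2 v x) (partial o3 v x) (partial o4 v x) => p1 p2 p3 p4.
move: (ha _) (hb _) (hc _) (hd _) => a b c d.
set X := (X in 0 <= X); set Y := (X in _ -> 0 <= X).
suff -> : X = Y by [].
by rewrite /X /Y; ring.
Qed.

End Positivity.

(** * Uniform bounds on compact sets *)

Section Bounded.
Variables (R : realType) (I : Type) (P : I -> Prop).
Implicit Types (F G : I -> R).

(** The index stands for all the data of an estimate at once (point, direction, matrices), so that
    constants are obtained before the data are chosen. [bnd] plays the role of $O(1)$, and [small]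
    below that of $O(\tau)$. *)
Definition bnd F := exists K : R, forall i, P i -> `|F i| <= K.

Lemma bnd_cst (a : R) : bnd (fun=> a).
Proof. by exists `|a|. Qed.

Lemma bndD F G : bnd F -> bnd G -> bnd (fun i => F i + G i).
Proof.
move=> [K HK] [L HL]; exists (K + L) => i Pi.
by rewrite (le_trans (ler_normD _ _))// lerD ?HK ?HL.
Qed.

Lemma bndN F : bnd F -> bnd (fun i => - F i).
Proof. by move=> [K HK]; exists K => i Pi; rewrite normrN HK. Qed.

Lemma bndM F G : bnd F -> bnd G -> bnd (fun i => F i * G i).
Proof.
move=> [K HK] [L HL]; exists (K * L) => i Pi.
by rewrite normrM ler_pM ?HK ?HL.
Qed.

Lemma bndX F n : bnd F -> bnd (fun i => F i ^+ n).
Proof.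
move=> [K HK]; exists (K ^+ n) => i Pi.
by rewrite normrX lerXn2r ?nnegrE ?HK// (le_trans _ (HK i Pi)).
Qed.

Lemma bnd_sum (J : Type) (r : seq J) (F : J -> I -> R) :
  (forall j, bnd (F j)) -> bnd (fun i => \sum_(j <- r) F j i).
Proof.
move=> H; elim: r => [|j r IH].
  by under eq_fun do rewrite big_nil; exact: bnd_cst.
by under eq_fun do rewrite big_cons; exact: bndD.
Qed.

Variable tau : I -> R.
Definition small F := exists K : R, forall i, P i -> `|F i| <= K * tau i.

Lemma smallD F G : small F -> small G -> small (fun i => F i + G i).
Proof.
move=> [K HK] [L HL]; exists (K + L) => i Pi.
by rewrite (le_trans (ler_normD _ _))// mulrDl lerD ?HK ?HL.
Qed.

Lemma smallN F : small F -> small (fun i => - F i).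
Proof. by move=> [K HK]; exists K => i Pi; rewrite normrN HK. Qed.

Lemma smallMl F G : bnd F -> small G -> small (fun i => F i * G i).
Proof.
move=> [K HK] [L HL]; exists (K * L) => i Pi.
by rewrite normrM -mulrA ler_pM ?HK ?HL.
Qed.

Lemma smallMr F G : small F -> bnd G -> small (fun i => F i * G i).
Proof. by move=> sF bG; under eq_fun do rewrite mulrC; exact: smallMl. Qed.

Lemma small_sum (J : Type) (r : seq J) (F : J -> I -> R) :
  (forall j, small (F j)) -> small (fun i => \sum_(j <- r) F j i).
Proof.
move=> H; elim: r => [|j r IH].
  by exists 0 => i _; rewrite big_nil normr0 mul0r.
by under eq_fun do rewrite big_cons; exact: smallD.
Qed.

End Bounded.

Section BoundedForms.
Variables (R : realType) (I : Type) (P : I -> Prop) (tau : I -> R).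
Implicit Types (x y : I -> R).

Lemma bndB x y : bnd P x -> bnd P y -> bnd P (fun i => x i - y i).
Proof. by move=> bx b_y; apply: (bndD bx (bndN b_y)). Qed.

Lemma smallB x y : small P tau x -> small P tau y -> small P tau (fun i => x i - y i).
Proof. by move=> bx b_y; apply: (smallD bx (smallN b_y)). Qed.

Lemma bnd_lb x1 x2 xc xd y1 y2 yc yd :
  bnd P x1 -> bnd P x2 -> bnd P xc -> bnd P xd ->
  bnd P y1 -> bnd P y2 -> bnd P yc -> bnd P yd ->
  bnd P (fun i => lb (x1 i) (x2 i) (xc i) (xd i) (y1 i) (y2 i) (yc i) (yd i)).
Proof.
move=> *; apply: bndB; [apply: bndB; [apply: bndD|]|];
  by repeat first [assumption | exact: bnd_cst | apply: bndM].
Qed.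

Lemma small_lb x1 x2 xc xd y1 y2 yc yd :
  bnd P x1 -> bnd P x2 -> bnd P xc -> bnd P xd ->
  small P tau y1 -> small P tau y2 -> small P tau yc -> small P tau yd ->
  small P tau (fun i => lb (x1 i) (x2 i) (xc i) (xd i) (y1 i) (y2 i) (yc i) (yd i)).
Proof.
move=> *; apply: smallB; [apply: smallB; [apply: smallD|]|];
  by do ?[assumption | exact: bnd_cst | apply: smallMl].
Qed.

Lemma small_lq x1 x2 xc xd :
  bnd P x1 -> bnd P xc -> bnd P xd ->
  small P tau x1 -> small P tau x2 -> small P tau xc -> small P tau xd ->
  small P tau (fun i => lq (x1 i) (x2 i) (xc i) (xd i)).
Proof.
move=> b1 b3 b4 c1 c2 c3 c4; rewrite /lq.
apply: smallB; [apply: smallB|]; first exact: smallMl.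
  by under eq_fun do rewrite expr2; exact: smallMl.
by under eq_fun do rewrite expr2; exact: smallMl.
Qed.

End BoundedForms.

Section Compact.
Variables (R : realType) (n : nat) (D : set 'rV[R]_n.+1).
Hypothesis cD : compact D.

Lemma cts_bnd (w : 'rV[R]_n.+1 -> R) :
  (forall x, D x -> {for x, continuous w}) -> bnd D w.
Proof.
move=> cw; have [->|/set0P D0] := eqVneq D set0; first by exists 0.
have cw' : {within D, continuous (fun x => `|w x|)}.
  apply: continuous_in_subspaceT => x; rewrite inE => Dx.
  by apply: (@continuous_comp _ _ _ w Num.norm); [exact: cw|exact: norm_continuous].
have [c _ Hc] := EVT_max_rV D0 cD cw'.
by exists `|w c| => x Dx; apply: Hc; rewrite inE.
Qed.

Lemma cts_min (w : 'rV[R]_n.+1 -> R) : D !=set0 ->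
  (forall x, D x -> {for x, continuous w}) ->
  exists2 c, D c & forall x, D x -> w c <= w x.
Proof.
move=> D0 cw.
have cw' : {within D, continuous w}.
  by apply: continuous_in_subspaceT => x; rewrite inE => Dx; exact: cw.
have [c Dc Hc] := EVT_min_rV D0 cD cw'.
by exists c => [|x Dx]; [rewrite inE in Dc|apply: Hc; rewrite inE].
Qed.

Lemma cts_inv_bnd (w : 'rV[R]_n.+1 -> R) :
  (forall x, D x -> {for x, continuous w}) -> (forall x, D x -> 0 < w x) ->
  bnd D (fun x => (w x)^-1).
Proof.
move=> cw w0; have [->|/set0P D0] := eqVneq D set0; first by exists 0.
have [c Dc Hc] := cts_min D0 cw.
exists (w c)^-1 => x Dx; rewrite ger0_norm ?invr_ge0 ?(ltW (w0 _ Dx))//.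
by rewrite lef_pV2 ?posrE ?w0// Hc.
Qed.

End Compact.

Section Solution.
Variable R : realType.

(* The hypotheses of the theorem, with the equation in real form. *)
Definition solution (Omega : set 'rV[R]_4) (v : 'rV[R]_4 -> R) : Prop :=
  [/\ open Omega, Ck_on Omega 4 v, forall x, Omega x -> v x < 0,
      convex_on Omega v &
      forall x, Omega x -> lq (A1 v x) (A2 v x) (Ac v x) (Ad v x) = 1].

Variables (Omega : set 'rV[R]_4) (v : 'rV[R]_4 -> R).
Hypothesis sol : solution Omega v.

Let oO : open Omega. Proof. by have [] := sol. Qed.
Let Cv : Ck_on Omega 4 v. Proof. by have [] := sol. Qed.
Let C3 k : Ck_on Omega 3 (partial k v). Proof. exact: Ck_on_partial. Qed.
Let C2 k l : Ck_on Omega 2 (partial k (partial l v)). Proof. by do 2 apply: Ck_on_partial. Qed.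
Let C1 k l m : Ck_on Omega 1 (partial k (partial l (partial m v))).
Proof. exact: Ck_on_partial. Qed.
Let v2 : Ck_on Omega 2 v. Proof. by do 2 apply: Ck_onW. Qed.
Let p2 k : Ck_on Omega 2 (partial k v). Proof. exact: Ck_onW. Qed.

Lemma hessian_sym x : Omega x -> (hessian v x)^T = hessian v x.
Proof.
move=> Ox; apply/matrixP => i j; rewrite !mxE; exact: partial_comm oO Ox v2.
Qed.

Lemma partial3_sym x i j k : Omega x ->
  partial k (partial i (partial j v)) x = partial k (partial j (partial i v)) x.
Proof.
move=> Ox; apply: (partial_eq_on _ oO Ox) => y Oy; exact: partial_comm oO Oy v2.
Qed.

Lemma dW_sym x u : Omega x -> (dW v u x)^T = dW v u x.
Proof.
move=> Ox; apply/matrixP => i j; rewrite mxE [LHS]mxE [RHS]mxE /D1.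
apply: eq_bigr => k _; apply: (congr1 (fun z => u 0 k * z)).
exact: partial3_sym.
Qed.

Lemma ddW_sym x u : Omega x -> (ddW v u x)^T = ddW v u x.
Proof.
move=> Ox; apply/matrixP => i j; rewrite mxE [LHS]mxE [RHS]mxE /D2; apply: eq_bigr => k _.
apply: (congr1 (fun z => u 0 k * z)); apply: eq_bigr => l _; apply: (congr1 (fun z => u 0 l * z)).
apply: (partial_eq_on _ oO Ox) => y Oy; exact: partial3_sym.
Qed.

Lemma hessian_psd x u : Omega x -> 0 <= qf (hessian v x) u u.
Proof.
move=> Ox; have [_ _ _ cv _] := sol.
have := convex_hessian_ge0 u oO Ox v2 cv; congr (0 <= _).
rewrite qfE exchange_big /=; apply: eq_bigr => i _.
rewrite mulr_sumr; apply: eq_bigr => j _.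
by rewrite [RHS]mulrC [hessian v x _ _]mxE.
Qed.

Lemma solution_A1_gt0 x : Omega x -> 0 < A1 v x.
Proof.
move=> Ox; have [_ _ v0 _ eqn] := sol; apply: A1_gt0 (eqn x Ox).
- by rewrite oppr_gt0 v0.
- exact: hessian_sym.
- by move=> u; exact: hessian_psd.
Qed.

Section Bounds.
Variable D : set 'rV[R]_4.
Hypotheses (cD : compact D) (DO : D `<=` Omega).
Variables (I : Type) (P : I -> Prop) (y : I -> 'rV[R]_4).
Hypothesis PD : forall i, P i -> D (y i).

Let pull (w : 'rV[R]_4 -> R) : bnd D w -> bnd P (fun i => w (y i)).
Proof. by move=> [K HK]; exists K => i /PD /HK. Qed.

Lemma bnd_v : bnd P (fun i => v (y i)).
Proof.
apply: pull; apply: cts_bnd => // x Dx; apply: (Ck_on_cts Cv); exact: DO.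
Qed.

Lemma bnd_partial k : bnd P (fun i => partial k v (y i)).
Proof.
apply: pull; apply: cts_bnd => // x Dx; apply: (Ck_on_cts (C3 k)); exact: DO.
Qed.

Lemma bnd_partial2 k l : bnd P (fun i => partial k (partial l v) (y i)).
Proof.
apply: pull; apply: cts_bnd => // x Dx; apply: (Ck_on_cts (C2 k l)); exact: DO.
Qed.

Lemma bnd_partial3 k l m : bnd P (fun i => partial k (partial l (partial m v)) (y i)).
Proof.
apply: pull; apply: cts_bnd => // x Dx; apply: (Ck_on_cts (C1 k l m)); exact: DO.
Qed.

Lemma bnd_hessian k l : bnd P (fun i => hessian v (y i) k l).
Proof. by under eq_fun do rewrite mxE; exact: bnd_partial2. Qed.

Lemma bnd_inv_s : bnd P (fun i => (- v (y i))^-1).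
Proof.
have [_ _ v0 _ _] := sol.
apply: (@pull (fun x => (- v x)^-1)).
apply: (@cts_inv_bnd _ _ _ cD (fun x => - v x)) => x Dx.
  by apply: continuousN; exact: Ck_on_cts Cv (DO Dx).
by rewrite oppr_gt0 v0//; exact: DO.
Qed.

Lemma bnd_ha : bnd P (fun i => ha (hessian v (y i))).
Proof. by apply: bndD; exact: bnd_hessian. Qed.
Lemma bnd_hb : bnd P (fun i => hb (hessian v (y i))).
Proof. by apply: bndD; exact: bnd_hessian. Qed.
Lemma bnd_hc : bnd P (fun i => hc (hessian v (y i))).
Proof. by apply: bndD; exact: bnd_hessian. Qed.
Lemma bnd_hd : bnd P (fun i => hd (hessian v (y i))).
Proof. by apply: bndB; exact: bnd_hessian. Qed.

Lemma bnd_A1 : bnd P (fun i => A1 v (y i)).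
Proof.
apply: bndB; first by apply: bndM; [apply: bndN; exact: bnd_v|exact: bnd_ha].
by apply: bndD; apply: bndX; exact: bnd_partial.
Qed.
Lemma bnd_A2 : bnd P (fun i => A2 v (y i)).
Proof.
apply: bndB; first by apply: bndM; [apply: bndN; exact: bnd_v|exact: bnd_hb].
by apply: bndD; apply: bndX; exact: bnd_partial.
Qed.
Lemma bnd_Ac : bnd P (fun i => Ac v (y i)).
Proof.
apply: bndB; first by apply: bndM; [apply: bndN; exact: bnd_v|exact: bnd_hc].
by apply: bndD; apply: bndM; exact: bnd_partial.
Qed.
Lemma bnd_Ad : bnd P (fun i => Ad v (y i)).
Proof.
apply: bndB; first by apply: bndM; [apply: bndN; exact: bnd_v|exact: bnd_hd].
by apply: bndB; apply: bndM; exact: bnd_partial.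
Qed.

End Bounds.
End Solution.

(** * Bounds for the frame, the drift and the error of a solution *)

Section ErrorBounds.
Variables (R : realType) (Omega : set 'rV[R]_4) (v : 'rV[R]_4 -> R).
Hypothesis sol : solution Omega v.
Variable D : set 'rV[R]_4.
Hypotheses (cD : compact D) (DO : D `<=` Omega).
Variables (I : Type) (P : I -> Prop) (y u : I -> 'rV[R]_4) (tau : I -> R).
Hypothesis PD : forall i, P i -> D (y i).
Hypothesis bu : forall k, bnd P (fun i => u i 0 k).

Let bv := bnd_v sol cD DO PD.
Let bp := bnd_partial sol cD DO PD.
Let bs := bnd_inv_s sol cD DO PD.
Let b1 := bnd_A1 sol cD DO PD.
Let b2 := bnd_A2 sol cD DO PD.
Let bc := bnd_Ac sol cD DO PD.
Let bd := bnd_Ad sol cD DO PD.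
Let bha := bnd_ha sol cD DO PD.
Let bhb := bnd_hb sol cD DO PD.
Let bhc := bnd_hc sol cD DO PD.
Let bhd := bnd_hd sol cD DO PD.

Let PO i : P i -> Omega (y i). Proof. by move=> /PD /DO. Qed.

Lemma solution_qh x : Omega x ->
  1 <= (- v x) ^+ 2 * lq (ha (hessian v x)) (hb (hessian v x)) (hc (hessian v x)) (hd (hessian v x)).
Proof.
move=> Ox; have [_ _ v0 _ eqn] := sol.
have s0 : 0 < - v x by rewrite oppr_gt0 v0.
have A0 := solution_A1_gt0 sol Ox.
have qA := eqn x Ox.
have := lb_rank1_ge0 (partial o1 v x) (partial o2 v x) (partial o3 v x) (partial o4 v x) A0 qA.
have := lq_rank1 (partial o1 v x) (partial o2 v x) (partial o3 v x) (partial o4 v x).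
exact: lq_hessian_ge s0 qA.
Qed.

Lemma bnd_inv_qh : bnd P (fun i => (lq (ha (hessian v (y i))) (hb (hessian v (y i)))
  (hc (hessian v (y i))) (hd (hessian v (y i))))^-1).
Proof.
have [K HK] := bndX 2 bv; exists K => i Pi.
have [_ _ v0 _ _] := sol.
have H := solution_qh (PO Pi).
have s0 : 0 < (- v (y i)) ^+ 2 by rewrite exprn_gt0// oppr_gt0 v0//; exact: PO.
have q0 : 0 < lq (ha (hessian v (y i))) (hb (hessian v (y i)))
  (hc (hessian v (y i))) (hd (hessian v (y i))).
  by rewrite -(pmulr_rgt0 _ s0) (lt_le_trans ltr01).
rewrite ger0_norm ?invr_ge0 ?(ltW q0)// (le_trans _ (HK i Pi))// -[leLHS]mul1r.
by rewrite ler_pdivrMr// -[v (y i) ^+ 2]sqrrN ger0_norm// (ltW s0).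
Qed.

Lemma bnd_dW k l : bnd P (fun i => dW v (u i) (y i) k l).
Proof.
under eq_fun do rewrite mxE; apply: bnd_sum => j; apply: bndM => //.
exact: (bnd_partial3 sol cD DO PD j k l).
Qed.

Lemma bnd_D1 : bnd P (fun i => D1 (u i) v (y i)).
Proof. by apply: bnd_sum => k; apply: bndM. Qed.

Lemma bnd_mulmx m n p (M : I -> 'M[R]_(m, n)) (N : I -> 'M[R]_(n, p)) :
  (forall k l, bnd P (fun i => M i k l)) -> (forall k l, bnd P (fun i => N i k l)) ->
  forall k l, bnd P (fun i => (M i *m N i) k l).
Proof.
by move=> bM bN k l; under eq_fun do rewrite mxE; apply: bnd_sum => j; exact: bndM.
Qed.

Lemma bnd_frame m j : bnd P (fun i => frame (A1 v (y i)) (Ac v (y i)) (Ad v (y i)) m 0 j).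
Proof.
have bmk (x1 x2 x3 x4 : I -> R) : bnd P x1 -> bnd P x2 -> bnd P x3 -> bnd P x4 ->
    forall l, bnd P (fun i => mk4 (x1 i) (x2 i) (x3 i) (x4 i) 0 l).
  by move=> ? ? ? ?; apply: I4P; under eq_fun do rewrite mxE /=.
have f1 := bmk _ _ _ _ (bndN bc) b1 bd (bnd_cst P 0).
have f2 := bmk _ _ _ _ (bnd_cst P 1) (bnd_cst P 0) (bnd_cst P 0) (bnd_cst P 0).
have bJ k l : bnd P (fun=> (Jm R) k l) by exact: bnd_cst.
move: m; apply: I4P; rewrite /frame /=; [exact: f1|exact: f2| |].
  by apply: (bnd_mulmx _ bJ) => k l; rewrite (ord1 k); exact: f1.
by apply: (bnd_mulmx _ bJ) => k l; rewrite (ord1 k); exact: f2.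
Qed.

Lemma bnd_Hinv k l : bnd P (fun i => Hinv (hessian v (y i)) k l).
Proof.
rewrite /Hinv; under eq_fun do rewrite mxE; apply: bndM; first exact: bnd_inv_qh.
move: k l; apply: I4P; apply: I4P; under eq_fun do rewrite !mxE /=;
  by repeat first [exact: bha | exact: bhb | exact: bhc | exact: bhd | exact: bnd_cst | apply: bndN].
Qed.

Lemma bnd_zeta m j : bnd P (fun i => zeta (hessian v (y i)) (dW v (u i) (y i))
  (frame (A1 v (y i)) (Ac v (y i)) (Ad v (y i)) m) 0 j).
Proof.
rewrite /zeta /Hhat; apply: bnd_mulmx => [k l|]; last exact: bnd_Hinv.
apply: bnd_mulmx => [k' l'|k' l']; first by rewrite (ord1 k'); exact: bnd_frame.
under eq_fun do rewrite mxE; apply: bndD; first exact: bnd_dW.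
apply: bnd_mulmx => *; last exact: bnd_cst.
by apply: bnd_mulmx => *; [exact: bnd_cst|exact: bnd_dW].
Qed.

Lemma bnd_drift k : bnd P (fun i => drift v (y i) k).
Proof.
rewrite /drift; apply: bndM; first exact: bndM b1 bs.
have b2' := bnd_cst P (2 : R).
move: k; apply: I4P => /=.
- exact: bndM b2' (bndB (bndB (bndM b2 (bp o1)) (bndM bc (bp o2))) (bndM bd (bp o4))).
- exact: bndM b2' (bndD (bndB (bndM b1 (bp o2)) (bndM bc (bp o1))) (bndM bd (bp o3))).
- exact: bndM b2' (bndD (bndB (bndM b2 (bp o3)) (bndM bc (bp o4))) (bndM bd (bp o2))).
- exact: bndM b2' (bndB (bndB (bndM b1 (bp o4)) (bndM bc (bp o3))) (bndM bd (bp o1))).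
Qed.

Lemma sqr_le_of_norm_le (a K : R) : `|a| <= K -> a ^+ 2 <= K ^+ 2.
Proof. by rewrite ler_norml => /andP[? ?]; nra. Qed.

(** In [frame_coercive] the weight $A_1^2$ must be bounded below. The equation gives $A_1 A_2 \ge
    1$, and [A2] is bounded above on [D]. *)
Lemma frame_elliptic : exists K : R, 0 < K /\ forall i (z : 'rV[R]_4), P i ->
  \sum_k z 0 k ^+ 2 <=
  K * \sum_m ((frame (A1 v (y i)) (Ac v (y i)) (Ad v (y i)) m *m z^T) 0 0) ^+ 2.
Proof.
have [K1 HK1] := b2.
have [K2 HK2] := bc; have [K3 HK3] := bd.
pose K0 := 3 + 3 * (K2 ^+ 2 + K3 ^+ 2).
have K00 : 0 < K0 by have := sqr_ge0 K2; have := sqr_ge0 K3; rewrite /K0; lra.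
exists ((1 + K1 ^+ 2) * K0); split.
  by rewrite mulr_gt0//; have := sqr_ge0 K1; lra.
move=> i z Pi; set S := (X in _ <= _ * X).
have S0 : 0 <= S by apply: sumr_ge0 => m _; exact: sqr_ge0.
have [_ _ _ _ eqn] := sol; have := eqn _ (PO Pi); rewrite /lq.
have A0 := solution_A1_gt0 sol (PO Pi).
have H1 := HK1 i Pi; have H2 := HK2 i Pi; have H3 := HK3 i Pi.
have := frame_coercive (A1 v (y i)) (Ac v (y i)) (Ad v (y i)) z.
rewrite -/S.
have cc := sqr_le_of_norm_le H2; have dd := sqr_le_of_norm_le H3.
move: cc dd H1 A0.
move: (A1 v (y i)) (A2 v (y i)) (Ac v (y i)) (Ad v (y i)) S S0 => B1 B2 Bc Bd S S0.
rewrite sum4; move: (z 0 o1 ^+ 2) (z 0 o2 ^+ 2) (z 0 o3 ^+ 2) (z 0 o4 ^+ 2)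
  (sqr_ge0 (z 0 o1)) (sqr_ge0 (z 0 o2)) (sqr_ge0 (z 0 o3)) (sqr_ge0 (z 0 o4)).
move=> z1 z2 z3 z4 z10 z20 z30 z40 cc dd hB2 B10 H qB.
have HS : (3 + 3 * (Bc ^+ 2 + Bd ^+ 2)) * S <= K0 * S by rewrite ler_wpM2r// /K0; lra.
have B12 : 1 <= B1 * B2 by have := sqr_ge0 Bc; have := sqr_ge0 Bd; lra.
have B20 : 0 < B2 by rewrite -(pmulr_rgt0 _ B10); lra.
have B12' : 1 <= B1 ^+ 2 * K1 ^+ 2.
  rewrite -exprMn -[leLHS](expr1n _ 2) lerXn2r ?nnegrE//; last first.
    rewrite (le_trans B12)// ler_wpM2l ?(ltW B10)//.
    by rewrite (le_trans _ hB2)// ler_norm.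
  by rewrite mulr_ge0 ?(ltW B10)// (le_trans _ hB2).
have z24 : z2 + z4 <= K1 ^+ 2 * (B1 ^+ 2 * (z2 + z4)).
  by rewrite mulrA [K1 ^+ 2 * _]mulrC ler_peMl// addr_ge0.
have Bz : B1 ^+ 2 * (z2 + z4) <= K0 * S.
  by apply: (le_trans _ HS); apply: (le_trans _ H); rewrite lerDr addr_ge0.
have z13 : z1 + z3 <= K0 * S.
  apply: (le_trans _ HS); apply: (le_trans _ H); rewrite lerDl mulr_ge0 ?addr_ge0// exprn_ge0// ltW//.
have : K1 ^+ 2 * (B1 ^+ 2 * (z2 + z4)) <= K1 ^+ 2 * (K0 * S).
  by rewrite ler_wpM2l// sqr_ge0.
by clearbody K0; lra.
Qed.

Hypothesis sp : forall k, small P tau (fun i => D1 (u i) (partial k v) (y i)).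

Let bp' k : bnd P (fun i => D1 (u i) (partial k v) (y i)).
Proof.
by apply: bnd_sum => l; apply: bndM => //; exact: (bnd_partial2 sol cD DO PD l k).
Qed.

Let bpp1 k l : bnd P (fun i => pp1 (fun k => partial k v (y i))
   (fun k => D1 (u i) (partial k v) (y i)) k l).
Proof. exact: bndD (bndM (bp' k) (bp l)) (bndM (bp k) (bp' l)). Qed.

Let spp1 k l : small P tau (fun i => pp1 (fun k => partial k v (y i))
   (fun k => D1 (u i) (partial k v) (y i)) k l).
Proof. exact: smallD (smallMr (sp k) (bp l)) (smallMl (bp k) (sp l)). Qed.

(** Each term of [error_term] carries a factor $p'$, a component of $Wu$, or $s'' = -W(u,u)$; all of
    these are $O(\tau)$, and the cofactors are bounded. *)
Lemma small_error : small P tau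
  (fun i => A1 v (y i) / - v (y i) * error_term v (y i) (u i)).
Proof.
apply: smallMl; first exact: bndM b1 bs.
have sn1 k l k' l' := smallD (spp1 k l) (spp1 k' l').
have bn1 k l k' l' := bndD (bpp1 k l) (bpp1 k' l').
have snd := smallB (spp1 o1 o4) (spp1 o2 o3).
have bnd' := bndB (bpp1 o1 o4) (bpp1 o2 o3).
have sAn := small_lb b1 b2 bc bd (sn1 o1 o1 o3 o3) (sn1 o2 o2 o4 o4) (sn1 o1 o2 o3 o4) snd.
have bAh := bnd_lb b1 b2 bc bd bha bhb bhc bhd.
have bsq := bndM (bnd_cst P (2 : R)) (bndM bs bnd_inv_qh).
have bB h h' (n' : I -> R) : bnd P h -> bnd P h' -> bnd P n' ->
    bnd P (fun i => - v (y i) * h' i + - D1 (u i) v (y i) * h i - n' i).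
  move=> bh bh' bn; apply: bndB => //; apply: bndD; apply: bndM => //; apply: bndN => //.
  exact: bnd_D1.
have bhaD : bnd P (fun i => ha (dW v (u i) (y i))) by apply: bndD; exact: bnd_dW.
have bhbD : bnd P (fun i => hb (dW v (u i) (y i))) by apply: bndD; exact: bnd_dW.
have bhcD : bnd P (fun i => hc (dW v (u i) (y i))) by apply: bndD; exact: bnd_dW.
have bhdD : bnd P (fun i => hd (dW v (u i) (y i))) by apply: bndB; exact: bnd_dW.
have bB1 := bB _ _ _ bha bhaD (bn1 o1 o1 o3 o3).
have bB2 := bB _ _ _ bhb bhbD (bn1 o2 o2 o4 o4).
have bBc := bB _ _ _ bhc bhcD (bn1 o1 o2 o3 o4).
have bBd := bB _ _ _ bhd bhdD bnd'.
have bcoef : bnd P (fun i => 2 / (- v (y i) * lq (ha (hessian v (y i))) (hb (hessian v (y i)))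
  (hc (hessian v (y i))) (hd (hessian v (y i))))).
  by under eq_fun do rewrite invfM.
rewrite /error_term.
apply: smallD; [apply: smallB; [apply: smallB; [apply: smallB|]|]|].
- apply: smallMl sAn; apply: bndM bs; apply: bndM; first exact: bnd_cst.
  by apply: bndN; exact: bnd_D1.
- apply: smallMl bcoef _; apply: smallB.
    by apply: smallMl sAn; exact: bnd_lb.
  apply: smallMr bAh; exact: small_lb bB1 bB2 bBc bBd (sn1 _ _ _ _) (sn1 _ _ _ _) (sn1 _ _ _ _) snd.
- apply: smallMl bcoef _; apply: smallB.
    by apply: smallMl sAn; apply: bnd_lb.
  by apply: smallMr bAh; apply: small_lq.
- apply: smallMr bAh; apply: smallN; rewrite /D2.
  by apply: small_sum => k; exact: smallMl (bu k) (sp k).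
- apply: small_lb => //.
  + by apply: smallMl (bnd_cst _ _) _; apply: smallD; under eq_fun do rewrite expr2; apply: smallMl.
  + by apply: smallMl (bnd_cst _ _) _; apply: smallD; under eq_fun do rewrite expr2; apply: smallMl.
  + by apply: smallMl (bnd_cst _ _) _; apply: smallD; apply: smallMl.
  + by apply: smallMl (bnd_cst _ _) _; apply: smallB; apply: smallMl.
Qed.

End ErrorBounds.

(** * Constrained minimisation of quadratic forms *)

Section PositiveMatrices.
Variable R : realType.

Definition dotM m n (A B : 'M[R]_(m, n)) : R := \sum_i \sum_j A i j * B i j.

Lemma dotMC m n (A B : 'M[R]_(m, n)) : dotM A B = dotM B A.
Proof. by apply: eq_bigr => i _; apply: eq_bigr => j _; rewrite mulrC. Qed.

Lemma dotMDl m n (A A' B : 'M[R]_(m, n)) : dotM (A + A') B = dotM A B + dotM A' B.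
Proof.
rewrite /dotM -big_split; apply: eq_bigr => i _; rewrite -big_split.
by apply: eq_bigr => j _; rewrite mxE mulrDl.
Qed.

Lemma dotMZl m n a (A B : 'M[R]_(m, n)) : dotM (a *: A) B = a * dotM A B.
Proof.
rewrite /dotM mulr_sumr; apply: eq_bigr => i _; rewrite mulr_sumr.
by apply: eq_bigr => j _; rewrite mxE mulrA.
Qed.

Lemma dotMNl m n (A B : 'M[R]_(m, n)) : dotM (- A) B = - dotM A B.
Proof. by rewrite -scaleN1r dotMZl mulN1r. Qed.

Lemma dotMBl m n (A A' B : 'M[R]_(m, n)) : dotM (A - A') B = dotM A B - dotM A' B.
Proof. by rewrite dotMDl dotMNl. Qed.

Lemma dotMDr m n (A B B' : 'M[R]_(m, n)) : dotM A (B + B') = dotM A B + dotM A B'.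
Proof. by rewrite dotMC dotMDl !(dotMC _ A). Qed.

Lemma dotMZr m n a (A B : 'M[R]_(m, n)) : dotM A (a *: B) = a * dotM A B.
Proof. by rewrite dotMC dotMZl dotMC. Qed.

Lemma dotMNr m n (A B : 'M[R]_(m, n)) : dotM A (- B) = - dotM A B.
Proof. by rewrite dotMC dotMNl dotMC. Qed.

Lemma dotMBr m n (A B B' : 'M[R]_(m, n)) : dotM A (B - B') = dotM A B - dotM A B'.
Proof. by rewrite dotMDr dotMNr. Qed.

Lemma dotM_ge0 m n (A : 'M[R]_(m, n)) : 0 <= dotM A A.
Proof. by apply: sumr_ge0 => i _; apply: sumr_ge0 => j _; rewrite -expr2 sqr_ge0. Qed.

Lemma dotM_entry m n (A : 'M[R]_(m, n)) i j : A i j ^+ 2 <= dotM A A.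
Proof.
rewrite /dotM (bigD1 i)//= (bigD1 j)//= -expr2 -addrA lerDl addr_ge0//.
  by apply: sumr_ge0 => l _; rewrite -expr2 sqr_ge0.
by apply: sumr_ge0 => k _; apply: sumr_ge0 => l _; rewrite -expr2 sqr_ge0.
Qed.

Lemma dotM_eq0 m n (A : 'M[R]_(m, n)) : dotM A A <= 0 -> A = 0.
Proof.
move=> A0; apply/matrixP => i j; rewrite mxE; apply/eqP.
by rewrite -sqrf_eq0 eq_le sqr_ge0 (le_trans (dotM_entry A i j)).
Qed.

Lemma dotM_CS m n (A B : 'M[R]_(m, n)) : dotM A B ^+ 2 <= dotM A A * dotM B B.
Proof.
have [B0|B0] := leP (dotM B B) 0.
  by rewrite (dotM_eq0 B0) (_ : dotM A 0 = 0) ?expr0n ?mulr_ge0 ?dotM_ge0// -(scale0r 0) dotMZr mul0r.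
have := dotM_ge0 (dotM B B *: A - dotM A B *: B).
rewrite !(dotMBl, dotMBr, dotMZl, dotMZr) (dotMC B A).
set a := dotM A A; set b := dotM B B in B0 *; set c := dotM A B => H.
suff : 0 <= b * (a * b - c ^+ 2) by rewrite pmulr_rge0// subr_ge0.
by have := H; rewrite (_ : b * (a * b - c ^+ 2) = b * (b * a - c * c) - c * (b * c - c * b)); [|ring].
Qed.

Lemma dotM_scalar n a (A : 'M[R]_n) : dotM a%:M A = a * \tr A.
Proof.
rewrite /dotM /mxtrace mulr_sumr; apply: eq_bigr => i _.
rewrite (bigD1 i)//= big1 ?addr0 => [|j ji]; first by rewrite mxE eqxx mulr1n.
by rewrite mxE eq_sym (negPf ji) mulr0n mul0r.
Qed.

Lemma dotM_tr m n (A B : 'M[R]_(m, n)) : dotM A B = \tr (A *m B^T).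
Proof.
by apply: eq_bigr => i _; rewrite mxE; apply: eq_bigr => j _; rewrite mxE.
Qed.

Lemma dotMT m n (A B : 'M[R]_(m, n)) : dotM A^T B^T = dotM A B.
Proof.
rewrite /dotM exchange_big; apply: eq_bigr => i _; apply: eq_bigr => j _.
by rewrite !mxE.
Qed.

Definition psd n (Q : 'M[R]_n) := Q^T = Q /\ forall u : 'rV_n, 0 <= (u *m Q *m u^T) 0 0.

Lemma psd_conj m n (Q : 'M[R]_n) (Y : 'M[R]_(m, n)) : psd Q -> psd (Y *m Q *m Y^T).
Proof.
move=> [sQ Q0]; split; first by rewrite !trmx_mul trmxK sQ mulmxA.
by move=> u; have := Q0 (u *m Y); rewrite trmx_mul !mulmxA.
Qed.

Lemma entryE n (Q : 'M[R]_n) i j :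
  ((delta_mx 0 i : 'rV_n) *m Q *m (delta_mx 0 j : 'rV_n)^T) 0 0 = Q i j.
Proof. by rewrite -rowE trmx_delta -colE !mxE. Qed.

Lemma psd_diag n (Q : 'M[R]_n) i : psd Q -> 0 <= Q i i.
Proof. by move=> [_ Q0]; rewrite -entryE. Qed.

Lemma psd_tr_ge0 n (Q : 'M[R]_n) : psd Q -> 0 <= \tr Q.
Proof. by move=> pQ; apply: sumr_ge0 => i _; exact: psd_diag. Qed.

Lemma psd_minor n (Q : 'M[R]_n) i j : psd Q -> Q i j ^+ 2 <= Q i i * Q j j.
Proof.
move=> pQ; have [sQ Q0] := pQ.
have H a b : 0 <= a ^+ 2 * Q i i + 2 * a * b * Q i j + b ^+ 2 * Q j j.
  have := Q0 (a *: delta_mx 0 i + b *: delta_mx 0 j); congr (0 <= _).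
  rewrite linearD !linearZ /= !(mulmxDl, mulmxDr) -!(scalemxAl, scalemxAr) !mxE.
  have E k l := entryE Q k l.
  have E' k l : \sum_j0 ((delta_mx 0 k : 'rV_n) *m Q) 0 j0 * (delta_mx 0 l : 'rV_n)^T j0 0 = Q k l.
    by rewrite -E [RHS]mxE.
  rewrite !E' (_ : Q j i = Q i j); last by rewrite -[in LHS]sQ mxE.
  by ring.
have [Qj|Qj] := ltP 0 (Q j j).
  have := H (Q j j) (- Q i j).
  rewrite (_ : _ + _ = Q j j * (Q i i * Q j j - Q i j ^+ 2)); last by ring.
  by rewrite pmulr_rge0// subr_ge0.
have Qj0 : Q j j = 0 by apply/eqP; rewrite eq_le Qj psd_diag.
rewrite Qj0 mulr0; have [->|q0] := eqVneq (Q i j) 0; first by rewrite expr0n.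
(* With [Q j j = 0] the form is affine in the second coefficient, which is chosen so that the value
   is $-1$. *)
have := H 1 (- (Q i i + 1) / (2 * Q i j)).
rewrite Qj0 mulr0 addr0 expr1n mul1r mulr1 (_ : 2 * _ * _ = - (Q i i + 1)); first by lra.
by field.
Qed.

Lemma psd_dotM_le n (Q : 'M[R]_n) : psd Q -> dotM Q Q <= (\tr Q) ^+ 2.
Proof.
move=> pQ; rewrite expr2 /mxtrace mulr_suml; apply: ler_sum => i _.
rewrite mulr_sumr; apply: ler_sum => j _.
by rewrite -expr2; exact: psd_minor.
Qed.

Lemma psd_tr0 n (Q : 'M[R]_n) : psd Q -> \tr Q = 0 -> Q = 0.
Proof.
by move=> pQ t0; apply: dotM_eq0; have := psd_dotM_le pQ; rewrite t0 expr0n.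
Qed.

(* The weights [M(C) = (1 + |C|^2/2) I - C], [C] of any size, are uniformly positive definite. *)
Definition Mc n (C : 'M[R]_n) : 'M[R]_n := (1 + dotM C C / 2)%:M - C.

Lemma dotM_Mc n (C T : 'M[R]_n) : dotM (Mc C) T = (1 + dotM C C / 2) * \tr T - dotM C T.
Proof. by rewrite dotMBl dotM_scalar. Qed.

(** Cauchy-Schwarz and the inequality of means: $\langle C, Q\rangle \le |C|\,\mathrm{tr}\,Q \le
    \frac12(1+|C|^2)\,\mathrm{tr}\,Q$. *)
Lemma Mc_psd_ge n (C Q : 'M[R]_n) : psd Q -> \tr Q / 2 <= dotM (Mc C) Q.
Proof.
move=> pQ; rewrite dotM_Mc; set c := dotM C C; set t := \tr Q.
have t0 : 0 <= t := psd_tr_ge0 pQ.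
have c0 : 0 <= c := dotM_ge0 C.
have H : dotM C Q ^+ 2 <= c * t ^+ 2.
  by apply: le_trans (dotM_CS _ _) _; rewrite ler_wpM2l// psd_dotM_le.
rewrite lerBrDr -lerBrDl.
have H2 : c * t ^+ 2 <= ((1 + c / 2) * t - t / 2) ^+ 2.
  rewrite -subr_ge0 (_ : _ - _ = t ^+ 2 * ((1 - c) ^+ 2 / 4)); last by field.
  by rewrite mulr_ge0 ?sqr_ge0// divr_ge0 ?sqr_ge0.
have H3 : 0 <= (1 + c / 2) * t - t / 2 by nra.
rewrite leNgt; apply/negP => H4.
have : ((1 + c / 2) * t - t / 2) ^+ 2 < dotM C Q ^+ 2 by rewrite ltrXn2r// ?nnegrE// (le_trans H3)// ltW.
by move=> /(le_lt_trans H2) /(le_lt_trans H); rewrite ltxx.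
Qed.

Lemma dotM_outer n (C : 'M[R]_n) (u : 'rV[R]_n) : (u *m C *m u^T) 0 0 = dotM C (u^T *m u).
Proof.
rewrite mxE; under eq_bigr do rewrite mxE mulr_suml.
rewrite exchange_big; apply: eq_bigr => i _; apply: eq_bigr => j _.
by rewrite !mxE big_ord1 !mxE; ring.
Qed.

Lemma psd_outer n (u : 'rV[R]_n) : psd (u^T *m u).
Proof.
split; first by rewrite trmx_mul trmxK.
move=> w; have -> : w *m (u^T *m u) *m w^T = (u *m w^T)^T *m (u *m w^T).
  by rewrite trmx_mul trmxK !mulmxA.
by rewrite mxE big_ord1 [X in X * _]mxE -expr2 sqr_ge0.
Qed.

Lemma tr_outer n (u : 'rV[R]_n) : \tr (u^T *m u) = dotM u u.
Proof. by rewrite mxtrace_mulC -dotM_tr. Qed.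

Lemma Mc_pos n (C : 'M[R]_n) (u : 'rV[R]_n) : dotM u u / 2 <= (u *m Mc C *m u^T) 0 0.
Proof. by rewrite dotM_outer -tr_outer Mc_psd_ge//; exact: psd_outer. Qed.

(** Induction on the size through the Schur complement of the top left entry. A factorisation $M(C)
    = N^TN$ turns weighted traces into sums of scalar forms over the rows of $NX$. *)
Lemma cholesky n (M : 'M[R]_n) : M^T = M ->
  (forall u : 'rV_n, u != 0 -> 0 < (u *m M *m u^T) 0 0) -> exists N : 'M[R]_n, M = N^T *m N.
Proof.
elim: n M => [|n IH] M sM M0.
  by exists 0; apply/matrixP => -[].
change 'M[R]_(1 + n) in M; change (M^T = M) in sM.
have {}M0 : forall u : 'rV[R]_(1 + n), u != 0 -> 0 < (u *m M *m u^T) 0 0 := M0.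
have s11 : ursubmx M = (dlsubmx M)^T by rewrite -[in LHS]sM -trmx_dlsub.
have s22 : (drsubmx M)^T = drsubmx M by rewrite trmx_drsub sM.
set a := ulsubmx M 0 0.
have Ea : ulsubmx M = a%:M by exact: mx11_scalar.
have EM : M = block_mx a%:M (dlsubmx M)^T (dlsubmx M) (drsubmx M).
  by rewrite -[LHS]submxK Ea s11.
set b := dlsubmx M in EM s11 *; set D := drsubmx M in EM s22 *.
have a0 : 0 < a.
  have := M0 (row_mx 1%:M 0 : 'rV_(1 + n)).
  rewrite EM mul_row_block tr_row_mx mul_row_col !mul1mx !mul0mx !addr0 trmx1 trmx0 mulmx1 mulmx0 addr0.
  rewrite mxE eqxx mulr1n; apply.
  apply/eqP => /matrixP/(_ 0 (lshift n 0)); rewrite row_mxEl !mxE => /eqP.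
  by rewrite oner_eq0.
have an : a != 0 by rewrite gt_eqF.
have [||N' HN'] := IH (D - a^-1 *: (b *m b^T)).
- by rewrite linearB linearZ /= trmx_mul trmxK s22.
(* The first coordinate is chosen to annihilate the first column, so the form of [M] at [w] is that
   of the Schur complement at [u]. *)
- move=> u u0; pose w : 'rV_(1 + n) := row_mx (- a^-1 *: (u *m b)) u.
  have w0 : w != 0.
    apply: contra u0 => /eqP /(congr1 rsubmx); rewrite row_mxKr => ->.
    by rewrite linear0.
  have := M0 w w0; congr (0 < _ 0 0).
  rewrite /w EM mul_row_block tr_row_mx mul_row_col.
  rewrite mul_mx_scalar scalerA mulrN divff// scaleN1r addNr mul0mx add0r.
  rewrite mulmxBr mulmxBl mulmxDl addrC.
  by rewrite -!scalemxAl scaleNr -!scalemxAr -scalemxAl !mulmxA.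
pose r := Num.sqrt a.
have rn : r != 0 by rewrite sqrtr_eq0 -ltNge.
have rr : r * r = a by rewrite -expr2 sqr_sqrtr// ltW.
pose N : 'M[R]_(1 + n) := block_mx r%:M (r^-1 *: b^T) 0 N'.
suff EN : M = N^T *m N by exists N; exact: EN.
rewrite [LHS]EM /N tr_block_mx mulmx_block trmx0 !mul0mx !addr0 tr_scalar_mx.
rewrite -scalar_mxM rr mul_scalar_mx scalerA divff// scale1r.
rewrite linearZ /= trmxK mul_mx_scalar scalerA divff// scale1r.
rewrite -scalemxAl -scalemxAr scalerA -invfM rr -HN' subrKC.
by rewrite mulmx0 addr0.
Qed.

End PositiveMatrices.

Section Minimizers.
Variables (R : realType) (n k : nat).
Implicit Types (W : 'M[R]_n) (B : 'M[R]_(n, k)) (X Y : 'M[R]_(k, n)) (C : 'M[R]_k).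

(* [X] minimises [X W X^T] subject to [X B = 1], and [C] minimises [<M(C), X W X^T>]. *)
Definition minimizer W B X C : Prop :=
  [/\ X *m B = 1%:M, X *m W = (X *m W *m X^T) *m B^T,
      X *m W *m X^T = \tr (X *m W *m X^T) *: C, dotM C C <= 1 & C^T = C].

(** The clause on [X *m W] is the Euler-Lagrange equation of the constraint, with $T = XWX^T$ as
    multiplier; it pairs to zero with every admissible variation. *)
Lemma minimizer_cross W B X C Y : psd W -> minimizer W B X C -> Y *m B = 0 ->
  (X *m W *m Y^T = 0) * (Y *m W *m X^T = 0).
Proof.
move=> [sW _] [XB XW _ _ _] YB.
have cross : X *m W *m Y^T = 0 by rewrite XW -mulmxA -trmx_mul YB trmx0 mulmx0.
split=> //; apply: trmx_inj.
by rewrite !trmx_mul trmxK sW mulmxA cross trmx0.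
Qed.

Lemma constrained_form W B X X1 C : psd W -> minimizer W B X C -> X1 *m B = 1%:M ->
  X1 *m W *m X1^T = X *m W *m X^T + (X1 - X) *m W *m (X1 - X)^T.
Proof.
move=> pW mXC X1B; have [XB _ _ _ _] := mXC.
have YB : (X1 - X) *m B = 0 by rewrite mulmxBl X1B XB subrr.
have cross := minimizer_cross pW mXC YB.
have EY : X1 = X + (X1 - X) by rewrite subrKC.
move: (X1 - X) cross EY => Y cross ->.
by rewrite linearD /= !mulmxDr !mulmxDl !cross addr0 add0r.
Qed.

Lemma minimizer_tr_ge0 W X : psd W -> 0 <= \tr (X *m W *m X^T).
Proof. by move=> pW; exact: psd_tr_ge0 (psd_conj X pW). Qed.

Lemma minimizer_value W B X C : minimizer W B X C ->
  dotM (Mc C) (X *m W *m X^T) = \tr (X *m W *m X^T) * (1 - dotM C C / 2).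
Proof.
move=> [_ _ TC _ _]; rewrite dotM_Mc.
have -> : dotM C (X *m W *m X^T) = \tr (X *m W *m X^T) * dotM C C by rewrite -dotMZr -TC.
by move: (\tr _) (dotM C C) => t c; field.
Qed.

Lemma minimizer_value_bounds W B X C : psd W -> minimizer W B X C ->
  \tr (X *m W *m X^T) / 2 <= dotM (Mc C) (X *m W *m X^T) <= \tr (X *m W *m X^T).
Proof.
move=> pW mXC; rewrite (minimizer_value mXC).
have t0 := minimizer_tr_ge0 X pW; have [_ _ _ c1 _] := mXC.
by have := dotM_ge0 C; move: (\tr _) (dotM C C) t0 c1 => t c *; apply/andP; split; nra.
Qed.

(** Minimality in [X] holds in the order of semidefinite matrices, hence for every weight [C1] at
    once. Minimality in [C] is then the identity that the remaining difference is $\frac t2|C_1 -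
    C|^2$. *)
Lemma minimizer_le W B X C X1 C1 : psd W -> minimizer W B X C -> X1 *m B = 1%:M ->
  dotM (Mc C) (X *m W *m X^T) <= dotM (Mc C1) (X1 *m W *m X1^T).
Proof.
move=> pW mXC X1B; rewrite (constrained_form pW mXC X1B) dotMDr.
have pY := psd_conj (X1 - X) pW.
have : 0 <= dotM (Mc C1) ((X1 - X) *m W *m (X1 - X)^T).
  by rewrite (le_trans _ (Mc_psd_ge _ pY))// divr_ge0// psd_tr_ge0.
suff : dotM (Mc C) (X *m W *m X^T) <= dotM (Mc C1) (X *m W *m X^T) by lra.
rewrite (minimizer_value mXC) dotM_Mc.
have [_ _ TC _ _] := mXC.
rewrite (_ : dotM C1 (X *m W *m X^T) = \tr (X *m W *m X^T) * dotM C1 C); last by rewrite -dotMZr -TC.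
have t0 := minimizer_tr_ge0 X pW; move: (\tr _) t0 => t t0.
rewrite -subr_ge0 (_ : _ - _ = t * (dotM (C1 - C) (C1 - C) / 2)).
  by rewrite mulr_ge0// divr_ge0// dotM_ge0.
by rewrite !(dotMBl, dotMBr) (dotMC C C1); field.
Qed.

Lemma dotM_row (X : 'M[R]_(k, n)) : dotM X X = \sum_i dotM (row i X) (row i X).
Proof.
rewrite {1}/dotM; apply: eq_bigr => i _; rewrite /dotM big_ord1.
by apply: eq_bigr => j _; rewrite !mxE.
Qed.

(** Under $XB = 1$, replacing $W$ by the positive definite $V = W + BB^T$ only adds the identity to
    $XWX^T$. The problem for $V$ has the solution $X = S^{-1}B^TV^{-1}$, $S = B^TV^{-1}B$, which
    gives $T = S^{-1} - 1$. *)
Lemma minimizer_exists W B Xr (c : R) : psd W -> 0 < c -> Xr *m B = 1%:M ->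
  (forall u : 'rV_n, c * dotM u u <= (u *m W *m u^T) 0 0 + dotM (u *m B) (u *m B)) ->
  exists X C, minimizer W B X C /\ c * dotM X X <= \tr (Xr *m W *m Xr^T) + k%:R.
Proof.
move=> pW c0 XrB coer; have [sW W0] := pW.
pose V := W + B *m B^T.
have sV : V^T = V by rewrite linearD /= trmx_mul trmxK sW.
have V0 (u : 'rV_n) : c * dotM u u <= (u *m V *m u^T) 0 0.
  have -> : (u *m V *m u^T) 0 0 = (u *m W *m u^T) 0 0 + dotM (u *m B) (u *m B).
    rewrite /V mulmxDr mulmxDl [LHS]mxE; congr (_ + _).
    by rewrite mulmxA -mulmxA -trmx_mul dotM_tr /mxtrace big_ord1.
  exact: coer.
have uV : V \in unitmx.
  rewrite -row_free_unit; apply/row_freeP; apply: contrapT => nf.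
  have [u u0 uV] : exists2 u : 'rV_n, u != 0 & u *m V = 0.
    have : kermx V != 0.
      apply: contra_not_neq nf => /eqP; rewrite kermx_eq0 => /row_freeP//.
    by case/rowV0Pn => u /sub_kermxP uV u0; exists u.
  have := V0 u; rewrite uV mul0mx mxE pmulr_rle0// => /dotM_eq0 u00.
  by rewrite u00 eqxx in u0.
pose S := B^T *m invmx V *m B.
have sS : S^T = S by rewrite !trmx_mul trmxK trmx_inv sV mulmxA.
have uS : S \in unitmx.
  rewrite -row_free_unit -kermx_eq0; apply: contraT => /rowV0Pn[u /sub_kermxP uS u0].
  pose z := u *m B^T *m invmx V.
  have zV : z *m V = u *m B^T by rewrite mulmxKV.
  have : (z *m V *m z^T) 0 0 = 0.
    rewrite zV /z !trmx_mul trmxK trmx_inv sV.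
    by rewrite !mulmxA -[u *m B^T *m invmx V]mulmxA -[u *m _ *m B]mulmxA uS mul0mx mxE.
  have := V0 z => /[swap] ->; rewrite pmulr_rle0// => /dotM_eq0 z0.
  have uB0 : u *m B^T = 0 by rewrite -zV z0 mul0mx.
  have : u = u *m B^T *m Xr^T by rewrite -mulmxA -trmx_mul XrB trmx1 mulmx1.
  by rewrite uB0 mul0mx => u00; rewrite u00 eqxx in u0.
pose X := invmx S *m B^T *m invmx V.
have XB : X *m B = 1%:M by rewrite /X -!mulmxA [B^T *m _]mulmxA -/S mulVmx.
have XW : X *m W = (invmx S - 1%:M) *m B^T.
  have -> : W = V - B *m B^T by rewrite /V addrK.
  by rewrite mulmxBr mulmxKV// mulmxA XB mulmxBl.
have XT : X *m W *m X^T = invmx S - 1%:M.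
  by rewrite XW -mulmxA -trmx_mul XB trmx1 mulmx1.
pose T := X *m W *m X^T.
have pT : psd T := psd_conj X pW.
have t0 : 0 <= \tr T := psd_tr_ge0 pT.
(* When $\mathrm{tr}\,T = 0$ also $T = 0$, and the convention $0^{-1} = 0$ yields [C = 0], which
   satisfies every clause. *)
have mXC : minimizer W B X ((\tr T)^-1 *: T).
  split => //.
  - by rewrite XT.
  - rewrite -/T scalerA; have [t00|tn] := eqVneq (\tr T) 0.
      by rewrite t00 mul0r scale0r; exact: psd_tr0.
    by rewrite divff// scale1r.
  - rewrite dotMZl dotMZr mulrA -invfM.
    have [t00|tn] := eqVneq (\tr T) 0; first by rewrite t00 mul0r invr0 mul0r.
    rewrite mulrC ler_pdivrMr ?mul1r -?expr2 ?psd_dotM_le//.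
    by rewrite exprn_gt0// lt_neqAle eq_sym tn.
  - by rewrite linearZ /= (proj1 pT).
exists X, ((\tr T)^-1 *: T); split => //.
have tT : \tr T <= \tr (Xr *m W *m Xr^T).
  rewrite (constrained_form pW mXC XrB) mxtraceD lerDl.
  exact: minimizer_tr_ge0.
(* Coercivity of $V$ on each row of $X$ bounds $c|X|^2$ by $\mathrm{tr}(XVX^T) = \mathrm{tr}\,T +
   k$. *)
apply: le_trans (lerD tT (lexx _)).
rewrite dotM_row mulr_sumr -[k%:R](mxtrace1) -mxtraceD.
apply: ler_sum => i _; apply: le_trans (V0 (row i X)) _.
have rowE' (M : 'M[R]_n) : (row i X *m M *m (row i X)^T) 0 0 = (X *m M *m X^T) i i.
  by rewrite -row_mul mxE [RHS]mxE; apply: eq_bigr => j _; rewrite !mxE.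
have -> : X *m W *m X^T + 1%:M = X *m V *m X^T.
  rewrite /V mulmxDr mulmxDl; congr (_ + _).
  by rewrite mulmxA XB mul1mx -trmx_mul XB trmx1.
by rewrite rowE'.
Qed.

End Minimizers.

(** * The differential inequality *)

Section MatrixJets.
Variable R : realType.

Definition jetM m n (F : R -> 'M[R]_(m, n)) (M1 M2 : 'M[R]_(m, n)) : Prop :=
  forall i j, jet2 (fun s => F s i j) (M1 i j) (M2 i j).

Lemma jetM_mul m n p (F : R -> 'M[R]_(m, n)) (G : R -> 'M[R]_(n, p)) M1 M2 N1 N2 :
  jetM F M1 M2 -> jetM G N1 N2 -> jetM (fun s => F s *m G s)
    (M1 *m G 0 + F 0 *m N1) (M2 *m G 0 + 2 *: (M1 *m N1) + F 0 *m N2).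
Proof.
move=> jF jG i j.
rewrite (_ : (fun s => _) = fun s => \sum_l F s i l * G s l j); last first.
  by apply/funext => s; rewrite mxE.
apply: jet2_eq (jet2_sum _ (fun l => jet2M (jF i l) (jG l j))) _ _.
  by rewrite !mxE -big_split.
rewrite !mxE mulr_sumr -!big_split /=.
by [].
Qed.

Lemma jetM_tr m n (F : R -> 'M[R]_(m, n)) M1 M2 :
  jetM F M1 M2 -> jetM (fun s => (F s)^T) M1^T M2^T.
Proof.
move=> jF i j; rewrite !mxE (_ : (fun s => _) = fun s => F s j i)//.
by apply/funext => s; rewrite mxE.
Qed.

Lemma jetM_affine m n (X X' : 'M[R]_(m, n)) : jetM (fun s => X + s *: X') X' 0.
Proof.
move=> i j; rewrite (_ : (fun s => _) = fun s => X i j + s * X' i j); last first.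
  by apply/funext => s; rewrite !mxE.
apply: jet2_eq (jet2D (jet2_cst (X i j)) (jet2M (@jet2_id R) (jet2_cst (X' i j)))) _ _;
  rewrite ?mxE; ring.
Qed.

Lemma jet2_dotM m n (F G : R -> 'M[R]_(m, n)) M1 M2 N1 N2 :
  jetM F M1 M2 -> jetM G N1 N2 -> jet2 (fun s => dotM (F s) (G s))
    (dotM M1 (G 0) + dotM (F 0) N1)
    (dotM M2 (G 0) + 2 * dotM M1 N1 + dotM (F 0) N2).
Proof.
move=> jF jG.
apply: jet2_eq (jet2_sum _ (fun i => jet2_sum _ (fun j => jet2M (jF i j) (jG i j)))) _ _.
  by rewrite /dotM -big_split; apply: eq_bigr => i _; rewrite big_split.
rewrite /dotM mulr_sumr -!big_split; apply: eq_bigr => i _.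
by rewrite mulr_sumr -!big_split.
Qed.

Lemma jetM_Mc n (C C' : 'M[R]_n) : jetM (fun s => Mc (C + s *: C'))
  ((dotM C C')%:M - C') (dotM C' C')%:M.
Proof.
move=> i j.
have jC := jetM_affine C C'.
have jn := jet2_dotM jC jC.
rewrite (_ : (fun s => _) = fun s => (i == j)%:R * (1 + 2^-1 * dotM (C + s *: C') (C + s *: C'))
   - (C + s *: C') i j); last first.
  by apply/funext => s; rewrite /Mc !mxE -mulr_natl; ring.
apply: jet2_eq (jet2B (jet2Z (i == j)%:R (jet2D (jet2_cst 1) (jet2Z 2^-1 jn))) (jC i j)) _ _.
  rewrite scale0r addr0 (dotMC C' C) [in RHS]mxE [in RHS]mxE [in RHS]mxE -mulr_natl.
  by field.
rewrite scale0r addr0 [in RHS]mxE [X in _ - X]mxE -mulr_natl.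
have -> : dotM 0 C = 0 by rewrite -(scale0r 0) dotMZl mul0r.
have -> : dotM C 0 = 0 by rewrite -(scale0r 0) dotMZr mul0r.
by field.
Qed.

End MatrixJets.

(** * The second variation of the minimised quantity *)

Section SecondVariation.
Variables (R : realType) (k : nat).
Variables (W W1 W2 : 'M[R]_4) (Wt : R -> 'M[R]_4) (B : 'M[R]_(4, k)).
Variables (X : 'M[R]_(k, 4)) (C : 'M[R]_k) (phi : R -> R) (phi1 phi2 : R).
Hypotheses (Wt0 : Wt 0 = W) (jW : jetM Wt W1 W2) (jphi : jet2 phi phi1 phi2).
Hypotheses (pW : psd W) (sW1 : W1^T = W1) (mXC : minimizer W B X C).
Hypothesis phi0 : phi 0 = dotM (Mc C) (X *m W *m X^T).
Hypothesis touch : \forall s \near (0 : R), forall X1 C1, X1 *m B = 1%:M ->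
  phi s <= dotM (Mc C1) (X1 *m Wt s *m X1^T).

Lemma Mc_tr n (C1 : 'M[R]_n) : C1^T = C1 -> (Mc C1)^T = Mc C1.
Proof. by move=> sC; rewrite linearB /= tr_scalar_mx sC. Qed.

(** The competitor $(X + sX', C + sC')$ minus [phi] is minimal at $s = 0$, so its first derivative
    vanishes and its second is nonnegative. The cross terms in [W] drop out by [minimizer_cross]. *)
Lemma raw_second_variation (X' : 'M[R]_(k, 4)) (C' : 'M[R]_k) : X' *m B = 0 ->
  dotM ((dotM C C')%:M - C') (X *m W *m X^T) + dotM (Mc C) (X *m W1 *m X^T) = phi1 /\
  phi2 <= dotM (Mc C) (X *m W2 *m X^T) + 4 * dotM (Mc C) (X' *m W1 *m X^T)
   + 2 * dotM (Mc C) (X' *m W *m X'^T)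
   + 2 * dotM ((dotM C C')%:M - C') (X *m W1 *m X^T)
   + dotM C' C' * \tr (X *m W *m X^T).
Proof.
move=> X'B; have [XB XW _ _ sC] := mXC; have [sW _] := pW.
have [XWX' X'WX] := minimizer_cross pW mXC X'B.
have jX := jetM_affine X X'.
have jT := jetM_mul (jetM_mul jX jW) (jetM_tr jX).
have := jet2B (jet2_dotM (jetM_Mc C C') jT) jphi.
rewrite !scale0r !addr0 Wt0 trmx0 mulmx0 addr0 mul0mx add0r.
rewrite !mulmxDl XWX' X'WX add0r addr0 => j.
have [|E1 E2] := jet2_ge0 j.
  apply: filterS touch => s touch_s.
  rewrite !scale0r !addr0 Wt0 phi0 subrr subr_ge0; apply: touch_s.
  by rewrite mulmxDl -scalemxAl X'B scaler0 addr0.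
split; first by apply/eqP; rewrite -subr_eq0 E1.
move: E2; rewrite subr_ge0 => /le_trans; apply.
have sym : dotM (Mc C) (X *m W1 *m X'^T) = dotM (Mc C) (X' *m W1 *m X^T).
  by rewrite -dotMT (Mc_tr sC) !trmx_mul trmxK sW1 mulmxA.
rewrite dotM_scalar !dotMDr dotMZr -scalemxAl dotMZr dotMDr sym.
set q1 := dotM _ _; set q2 := dotM _ _; set q3 := dotM _ _; set q4 := dotM _ _; set q5 := dotM _ _.
by rewrite le_eqVlt; apply/orP; left; apply/eqP; ring.
Qed.

Let T := X *m W *m X^T.
Let t := \tr T.
Let T1 := X *m W1 *m X^T.
Let C' := t^-1 *: (T1 - \tr T1 *: C).

(* Competitors: [C] moves along [C'] and [X] along [- (Z - (Z B) X)]. *)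
Lemma second_variation (Z : 'M[R]_(k, 4)) : 0 < t ->
  dotM (Mc C) T1 = phi1 /\ phi2 <= dotM (Mc C) (X *m W2 *m X^T)
    - 2 * dotM (Mc C) (2 *: (Z *m W1 *m X^T) - Z *m W *m Z^T)
    + 4 * dotM (Mc C) (Z *m B *m T1) - t * dotM C' C'.
Proof.
move=> t0; have [XB XW TC _ sC] := mXC.
split.
  have [] := @raw_second_variation 0 0; first by rewrite mul0mx.
  by rewrite subr0 (_ : dotM C 0 = 0) ?dotM_scalar ?mul0r ?add0r// -(scale0r 0) dotMZr mul0r.
pose Y := Z - Z *m B *m X.
have YB : Y *m B = 0 by rewrite mulmxBl -[Z *m B *m X *m B]mulmxA XB mulmx1 subrr.
have [|_ H] := @raw_second_variation (- Y) C'; first by rewrite mulNmx YB oppr0.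
apply: le_trans H _.
have [XWY YWX] := minimizer_cross pW mXC YB.
have EZ : Z = Y + Z *m B *m X by rewrite subrK.
have E1 : dotM (Mc C) (- Y *m W1 *m X^T) =
    dotM (Mc C) (Z *m B *m T1) - dotM (Mc C) (Z *m W1 *m X^T).
  rewrite -dotMBr; congr dotM; rewrite /Y opprB !mulmxBl /T1 !mulmxA.
  by [].
(* The discarded term $(ZB)T(ZB)^T$ is positive semidefinite, so its pairing with $M(C)$ is
   nonnegative. *)
have E2 : dotM (Mc C) (- Y *m W *m (- Y)^T) <= dotM (Mc C) (Z *m W *m Z^T).
  rewrite linearN /= mulmxN !mulNmx opprK.
  have -> : Z *m W *m Z^T = Y *m W *m Y^T + (Z *m B) *m T *m (Z *m B)^T.
    rewrite {1 2}EZ; clearbody Y.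
    rewrite linearD /= !mulmxDl !mulmxDr [X in Y *m W *m Y^T + X + _](_ : _ = 0); last first.
      by rewrite trmx_mul mulmxA YWX mul0mx.
    rewrite [X in _ + (X + _)](_ : _ = 0); last first.
      by rewrite -!mulmxA [X *m _]mulmxA XWY !mulmx0.
    by rewrite addr0 add0r /T trmx_mul !mulmxA.
  rewrite dotMDr lerDl (le_trans _ (Mc_psd_ge _ (psd_conj _ (psd_conj _ pW))))//.
  by rewrite divr_ge0// psd_tr_ge0//; exact: psd_conj (psd_conj _ pW).
(* Doubled and added to the term $t|C'|^2$ already present, this leaves the gain $-t|C'|^2$. *)
have E3 : dotM ((dotM C C')%:M - C') T1 = - (t * dotM C' C').
  have -> : t * dotM C' C' = dotM C' (T1 - \tr T1 *: C).
    by rewrite /C' dotMZr mulrA divff ?mul1r// gt_eqF.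
  by rewrite dotMBl dotM_scalar dotMBr dotMZr (dotMC C C'); ring.
rewrite -/T1 -/T -/t E3 E1 dotMBr dotMZr.
move: E2; move: (dotM C' C') => c.
set q1 := dotM _ _; set q2 := dotM _ (Z *m W *m Z^T); set q3 := dotM _ (X *m _ *m _).
set q4 := dotM _ (Z *m B *m _); set q5 := dotM _ (Z *m W1 *m _).
lra.
Qed.

End SecondVariation.

(** * Symmetries of the third and fourth derivatives *)

Section DerivativeTensors.
Variables (R : realType) (Omega : set 'rV[R]_4) (v : 'rV[R]_4 -> R).
Hypothesis sol : solution Omega v.
Implicit Types (x f a b u : 'rV[R]_4).

Let oO : open Omega. Proof. by have [] := sol. Qed.
Let Cv : Ck_on Omega 4 v. Proof. by have [] := sol. Qed.
Let C2 k l : Ck_on Omega 2 (partial k (partial l v)). Proof. by do 2 apply: Ck_on_partial. Qed.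
Let p2 k : Ck_on Omega 2 (partial k v). Proof. by apply: Ck_onW; exact: Ck_on_partial. Qed.

Lemma qf_dW f a b x : qf (dW v f x) a b =
  \sum_i \sum_j \sum_l a 0 i * (f 0 l * (b 0 j * partial l (partial i (partial j v)) x)).
Proof.
rewrite qfE; apply: eq_bigr => i _; apply: eq_bigr => j _.
rewrite mxE /D1 mulr_sumr mulr_suml; apply: eq_bigr => l _.
by rewrite -!mulrA [_ * b 0 j]mulrC.
Qed.

Lemma qf_dW_sym f a b x : Omega x -> qf (dW v f x) a b = qf (dW v a x) f b.
Proof.
move=> Ox; rewrite !qf_dW exchange_big [RHS]exchange_big /=.
apply: eq_bigr => j _; rewrite exchange_big /=; apply: eq_bigr => l _.
apply: eq_bigr => i _; rewrite mulrCA.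
apply: (congr1 (fun z => f 0 l * (a 0 i * (b 0 j * z)))).
exact: partial_comm oO Ox (p2 j).
Qed.

Lemma qf_ddW f a b x : qf (ddW v f x) a b = \sum_i \sum_j \sum_k \sum_l
  a 0 i * (b 0 j * (f 0 k * (f 0 l * partial l (partial k (partial i (partial j v))) x))).
Proof.
rewrite qfE; apply: eq_bigr => i _; apply: eq_bigr => j _.
rewrite mxE /D2 mulr_sumr mulr_suml; apply: eq_bigr => k _.
rewrite !mulr_sumr mulr_suml; apply: eq_bigr => l _.
by rewrite mulrAC -mulrA.
Qed.

Lemma partial4_sym x i j k l : Omega x ->
  partial l (partial k (partial i (partial j v))) x =
  partial j (partial i (partial l (partial k v))) x.
Proof.
move=> Ox.
have s1 (e0 f0 g0 h0 : 'I_4) : partial e0 (partial f0 (partial g0 (partial h0 v))) x =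
    partial f0 (partial e0 (partial g0 (partial h0 v))) x.
  exact: partial_comm oO Ox (C2 g0 h0).
have s2 (e0 f0 g0 h0 : 'I_4) : partial e0 (partial f0 (partial g0 (partial h0 v))) x =
    partial e0 (partial g0 (partial f0 (partial h0 v))) x.
  apply: (partial_eq_on e0 oO Ox) => y Oy; exact: partial_comm oO Oy (p2 h0).
have s3 (e0 f0 g0 h0 : 'I_4) : partial e0 (partial f0 (partial g0 (partial h0 v))) x =
    partial e0 (partial f0 (partial h0 (partial g0 v))) x.
  apply: (partial_eq_on e0 oO Ox) => y Oy; exact: (partial3_sym sol).
apply: etrans (s2 l k i j) _; apply: etrans (s1 l i k j) _; apply: etrans (s3 i l k j) _.
by apply: etrans (s2 i l j k) _; exact: s1.
Qed.

Lemma sum_transpose (a f : 'I_4 -> R) (P : 'I_4 -> 'I_4 -> 'I_4 -> 'I_4 -> R) :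
  \sum_i \sum_j \sum_k \sum_l a i * (a j * (f k * (f l * P k l i j))) =
  \sum_i \sum_j \sum_k \sum_l f i * (f j * (a k * (a l * P j i k l))).
Proof.
transitivity (\sum_i \sum_k \sum_j \sum_l a i * (a j * (f k * (f l * P k l i j)))).
  by apply: eq_bigr => i _; exact: exchange_big.
rewrite exchange_big /=.
transitivity (\sum_k \sum_i \sum_l \sum_j a i * (a j * (f k * (f l * P k l i j)))).
  by apply: eq_bigr => k _; apply: eq_bigr => i _; exact: exchange_big.
transitivity (\sum_k \sum_l \sum_i \sum_j a i * (a j * (f k * (f l * P k l i j)))).
  by apply: eq_bigr => k _; exact: exchange_big.
rewrite exchange_big /=; apply: eq_bigr => l _; apply: eq_bigr => k _.
by apply: eq_bigr => i _; apply: eq_bigr => j _; ring.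
Qed.

Lemma qf_ddW_sym f a x : Omega x -> qf (ddW v f x) a a = qf (ddW v a x) f f.
Proof.
move=> Ox; rewrite !qf_ddW.
transitivity (\sum_i \sum_j \sum_k \sum_l
  a 0 i * (a 0 j * (f 0 k * (f 0 l * partial j (partial i (partial l (partial k v))) x)))).
  apply: eq_bigr => i _; apply: eq_bigr => j _; apply: eq_bigr => k _; apply: eq_bigr => l _.
  apply: (congr1 (fun z => a 0 i * (a 0 j * (f 0 k * (f 0 l * z))))).
  exact: partial4_sym.
exact: (sum_transpose (a 0) (f 0)
  (fun k l i j => partial j (partial i (partial l (partial k v))) x)).
Qed.

(** Turns the drift terms of [pde_inequality] into coordinate derivatives of the form $W(u,u)$. *)
Lemma D2_partial u k x : Omega x -> D2 u (partial k v) x = qf (dW v (delta_mx 0 k) x) u u.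
Proof.
move=> Ox; rewrite -(qf_dW_sym _ _ _ Ox) qf_dW /D2 [RHS]exchange_big /=.
apply: eq_bigr => j _; rewrite [RHS](bigD1 k)//= [X in _ + X]big1 ?addr0 => [|i ik]; last first.
  by rewrite big1// => l _; rewrite mxE eqxx (negPf ik) mul0r.
rewrite mulr_sumr; apply: eq_bigr => l _; rewrite mxE !eqxx mul1r mulrCA.
apply: (congr1 (fun z => u 0 l * (u 0 j * z))).
exact: (partial3_sym sol).
Qed.

Lemma D1_partial u k x : D1 u (partial k v) x = (u *m hessian v x) 0 k.
Proof. by rewrite mxE; apply: eq_bigr => l _; rewrite mxE. Qed.

Lemma dW_sum (I : Type) (r : seq I) (c : I -> R) (F : I -> 'rV[R]_4) x :
  dW v (\sum_(i <- r) c i *: F i) x = \sum_(i <- r) c i *: dW v (F i) x.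
Proof.
apply/matrixP => i j; rewrite mxE summxE /D1.
under eq_bigr do rewrite summxE mulr_suml.
rewrite exchange_big /=; apply: eq_bigr => m _; rewrite !mxE mulr_sumr.
by apply: eq_bigr => l _; rewrite mxE mulrA.
Qed.

Lemma zeta_sum (I : Type) (r : seq I) (c : I -> R) (F : I -> 'M[R]_4) W f :
  zeta W (\sum_(i <- r) c i *: F i) f = \sum_(i <- r) c i *: zeta W (F i) f.
Proof.
have zD D D' : zeta W (D + D') f = zeta W D f + zeta W D' f.
  by rewrite /zeta /Hhat !(mulmxDr, mulmxDl) addrACA.
have zZ e D : zeta W (e *: D) f = e *: zeta W D f.
  have HZ : Hhat (e *: D) = e *: Hhat D by rewrite /Hhat -scalemxAr -scalemxAl -scalerDr.
  by rewrite /zeta HZ -[f *m (e *: _)]scalemxAr -scalemxAl.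
elim: r => [|i r IH]; last by rewrite !big_cons zD zZ IH.
by rewrite !big_nil -(scale0r 0) zZ scale0r.
Qed.

End DerivativeTensors.

Section SummedInequality.
Variables (R : realType) (Omega : set 'rV[R]_4) (v : 'rV[R]_4 -> R).
Hypothesis sol : solution Omega v.
Variables (k : nat) (y : 'rV[R]_4) (X : 'M[R]_(k, 4)).
Hypothesis Oy : Omega y.

Let oO : open Omega. Proof. by have [] := sol. Qed.
Let Cv : Ck_on Omega 4 v. Proof. by have [] := sol. Qed.

Lemma dotM_gram (N : 'M[R]_k) (Q : 'M[R]_4) (Y Y' : 'M[R]_(k, 4)) :
  dotM (N^T *m N) (Y *m Q *m Y'^T) = \sum_r qf Q (row r (N *m Y)) (row r (N *m Y')).
Proof.
have E r (M M' : 'M[R]_(k, 4)) : qf Q (row r M) (row r M') = (M *m Q *m M'^T) r r.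
  by rewrite /qf -row_mul mxE [RHS]mxE; apply: eq_bigr => j _; rewrite !mxE.
under eq_bigr do rewrite E.
rewrite dotM_tr -mxtrace_tr trmx_mul trmxK trmx_mul trmxK mulmxA mxtrace_mulC.
by rewrite trmx_mul !mulmxA.
Qed.

Let W := hessian v y.
Let f := frame (A1 v y) (Ac v y) (Ad v y).
(** The [Z] of [second_variation] for the [m]-th frame vector. As [zeta] is linear in the direction
    of differentiation, [N *m Zm m] is the same choice for the rows of [N *m X]. *)
Definition Zm (m : 'I_4) : 'M[R]_(k, 4) :=
  \matrix_(i, j) zeta W (dW v (row i X) y) (f m) 0 j.

Lemma row_Zm (N : 'M[R]_k) r m :
  row r (N *m Zm m) = zeta W (dW v (row r (N *m X)) y) (f m).
Proof.
rewrite !row_mul !mulmx_sum_row dW_sum zeta_sum; apply: eq_bigr => i _.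
by congr (_ *: _); apply/rowP => j; rewrite !mxE.
Qed.

(** [pde_inequality] in the direction of each row $u$ of $NX$, summed over the rows. The symmetry of
    the derivatives exchanges the roles of $u$ and the frame: $D^2_{uu}W(f,f) = D^2_{ff}W(u,u)$. *)
Lemma summed_pde_inequality (N : 'M[R]_k) :
  \sum_m (dotM (N^T *m N) (X *m ddW v (f m) y *m X^T)
    - 2 * dotM (N^T *m N) (2 *: (Zm m *m dW v (f m) y *m X^T) - Zm m *m W *m (Zm m)^T)) <=
  \sum_r A1 v y / - v y * error_term v y (row r (N *m X))
  + \sum_l drift v y l * dotM (N^T *m N) (X *m dW v (delta_mx 0 l) y *m X^T).
Proof.
have [_ _ v0 _ eqn] := sol.
under eq_bigr do rewrite dotMBr dotMZr !dotM_gram.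
under [X in _ <= _ + X]eq_bigr do rewrite dotM_gram mulr_sumr.
rewrite [X in _ <= _ + X]exchange_big /= -big_split /=.
under eq_bigr do rewrite mulr_sumr -sumrB mulr_sumr -sumrB.
rewrite exchange_big /=; apply: ler_sum => r _.
set xi := row r (N *m X).
have s0 : 0 < - v y by rewrite oppr_gt0 v0.
have := pde_inequality oO Oy Cv eqn s0 (solution_A1_gt0 sol Oy)
  (hessian_sym sol Oy) (dW_sym sol xi Oy) (ddW_sym sol xi Oy).
rewrite -/W -/f => key.
have -> : \sum_l drift v y l * qf (dW v (delta_mx 0 l) y) xi xi =
    \sum_l drift v y l * D2 xi (partial l v) y.
  by apply: eq_bigr => l _; rewrite -(D2_partial sol _ _ Oy).
have -> : \sum_m (qf (ddW v (f m) y) xi xi - 2 * (2 * qf (dW v (f m) y) (row r (N *m Zm m)) xi -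
     qf W (row r (N *m Zm m)) (row r (N *m Zm m)))) =
  \sum_m qf (ddW v xi y) (f m) (f m) - 2 * \sum_m (2 * qf (dW v xi y) (f m) (zeta W (dW v xi y) (f m))
     - qf W (zeta W (dW v xi y) (f m)) (zeta W (dW v xi y) (f m))).
  rewrite mulr_sumr -sumrB; apply: eq_bigr => m _.
  rewrite (qf_ddW_sym sol _ _ Oy) row_Zm -/xi.
  by rewrite -(qf_tr (dW v (f m) y)) (dW_sym sol _ Oy) (qf_dW_sym sol _ _ _ Oy).
rewrite lerBlDr; apply: (le_trans key); rewrite le_eqVlt; apply/orP; left; apply/eqP.
by rewrite -addrA [LHS]addrC.
Qed.

End SummedInequality.

Section DifferentialInequality.
Variables (R : realType) (Omega : set 'rV[R]_4) (v : 'rV[R]_4 -> R).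
Hypothesis sol : solution Omega v.

Let oO : open Omega. Proof. by have [] := sol. Qed.
Let Cv : Ck_on Omega 4 v. Proof. by have [] := sol. Qed.

Lemma jetM_hessian y f : Omega y ->
  jetM (fun s => hessian v (y + s *: f)) (dW v f y) (ddW v f y).
Proof.
move=> Oy i j; rewrite !mxE.
rewrite (_ : (fun s => _) = fun s => partial i (partial j v) (y + s *: f)).
  by apply: jet2_D oO Oy _; do 2 apply: Ck_on_partial.
by apply/funext => s; rewrite mxE.
Qed.

Lemma dotM_mull k (M c A : 'M[R]_k) : dotM M (c *m A) = dotM (c^T *m M) A.
Proof. by rewrite !dotM_tr trmx_mul mulmxA mxtrace_mulC mulmxA. Qed.

(* Completing the square absorbs the terms linear in [T1], up to the derivative [<M, T1>] of the test function. *)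
Lemma absorb_linear k (M C c T1 : 'M[R]_k) (t phi1 : R)
    (C' := t^-1 *: (T1 - \tr T1 *: C)) (nu := dotM M (c *m C)) (beta := dotM M C) :
  0 < t -> 2^-1 <= beta -> dotM M T1 = phi1 ->
  4 * dotM M (c *m T1) - t * dotM C' C' <=
  4 * t * dotM (c^T *m M - (nu / beta) *: M) (c^T *m M - (nu / beta) *: M) + 8 * (`|nu| * `|phi1|).
Proof.
move=> t0 hb phi1E; set a := c^T *m M - _.
have b0 : 0 < beta by apply: lt_le_trans hb; rewrite invr_gt0.
have ET : T1 = t *: C' + \tr T1 *: C.
  by rewrite /C' scalerA divff ?gt_eqF// scale1r subrK.
clearbody C'.
(* Pair [ET] with [M]: the known value $\langle M, T_1\rangle$ determines the component of $T_1$
   along [C], since $\langle M, C\rangle$ stays away from 0. *)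
have E1 : \tr T1 = (phi1 - t * dotM M C') / beta.
  apply/(canRL (mulfK _)); first by rewrite gt_eqF.
  by rewrite -phi1E [in dotM M T1]ET dotMDr !dotMZr -/beta; ring.
have E2 : dotM M (c *m T1) = t * dotM a C' + nu * phi1 / beta.
  rewrite [in LHS]ET mulmxDr -!scalemxAr dotMDr !dotMZr -/nu E1 dotM_mull.
  rewrite /a dotMBl dotMZl; field; by rewrite gt_eqF.
clearbody a.
have sq : 4 * t * dotM a C' - t * dotM C' C' <= 4 * t * dotM a a.
  have := mulr_ge0 (ltW t0) (dotM_ge0 (C' - 2 *: a)).
  rewrite !(dotMBl, dotMBr, dotMZl, dotMZr) (dotMC C' a).
  by move: (dotM a a) (dotM a C') (dotM C' C') => p q r; nra.
have nb : nu * phi1 / beta <= 2 * (`|nu| * `|phi1|).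
  rewrite (le_trans (ler_norm _))// normrM normrM mulrC ler_wpM2r ?mulr_ge0//.
  rewrite normfV gtr0_norm// -[2]invrK lef_pV2 ?posrE ?invr_gt0//.
rewrite E2 mulrDr -[4 * (nu * _ / _)]/(4 * _) mulrA.
lra.
Qed.

Section Uniform.
Variables (D : set 'rV[R]_4) (k : nat) (B : 'M[R]_(4, k)) (R0 : R).
Hypotheses (cD : compact D) (DO : D `<=` Omega).

Let I : Type := ('rV[R]_4 * 'M[R]_(k, 4) * 'M[R]_k)%type.
Let P (i : I) : Prop := [/\ D i.1.1, forall j l, `|i.1.2 j l| <= R0,
  forall j l, `|i.2 j l| <= 1 & 2^-1 <= dotM (Mc i.2) i.2].

Let PD i : P i -> D i.1.1. Proof. by case. Qed.
Let bX j l : bnd P (fun i => i.1.2 j l). Proof. by exists R0 => i []. Qed.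
Let bC j l : bnd P (fun i => i.2 j l). Proof. by exists 1 => i []. Qed.

Lemma bnd_norm T (Q : T -> Prop) (F : T -> R) : bnd Q F -> bnd Q (fun i => `|F i|).
Proof. by move=> [K HK]; exists K => i Qi; rewrite normr_id HK. Qed.

Lemma bnd_dotM T (Q : T -> Prop) m n (F G : T -> 'M[R]_(m, n)) :
  (forall j l, bnd Q (fun i => F i j l)) -> (forall j l, bnd Q (fun i => G i j l)) ->
  bnd Q (fun i => dotM (F i) (G i)).
Proof. by move=> bF bG; apply: bnd_sum => j; apply: bnd_sum => l; exact: bndM. Qed.

Let bMc j l : bnd P (fun i => Mc i.2 j l).
Proof.
have E (C : 'M[R]_k) : Mc C j l = (1 + dotM C C / 2) * (j == l)%:R - C j l.
  by rewrite !mxE mulr_natr.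
under eq_fun do rewrite E.
apply: (bndB _ (bC j l)); apply: (bndM _ (bnd_cst _ _)).
apply: bndD; first exact: bnd_cst.
by apply: (bndM _ (bnd_cst _ _)); exact: bnd_dotM.
Qed.

Let bZB m j l : bnd P (fun i => (Zm v i.1.1 i.1.2 m *m B) j l).
Proof.
apply: bnd_mulmx => {j l} j l; last exact: bnd_cst.
under eq_fun do rewrite mxE.
apply: (bnd_zeta sol cD DO PD) => n; under eq_fun do rewrite mxE; exact: bX.
Qed.

Let bnu m : bnd P (fun i => dotM (Mc i.2) (Zm v i.1.1 i.1.2 m *m B *m i.2)).
Proof. by apply: bnd_dotM => // j l; apply: bnd_mulmx. Qed.

Let bsq m : bnd P (fun i =>
  let a := (Zm v i.1.1 i.1.2 m *m B)^T *m Mc i.2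
     - (dotM (Mc i.2) (Zm v i.1.1 i.1.2 m *m B *m i.2) / dotM (Mc i.2) i.2) *: Mc i.2 in
  dotM a a).
Proof.
have binv : bnd P (fun i => (dotM (Mc i.2) i.2)^-1).
  exists 2 => i [_ _ _ hb]; have b0 := lt_le_trans (_ : 0 < 2^-1 :> R) hb.
  by rewrite normfV gtr0_norm ?b0// -[2]invrK lef_pV2 ?posrE ?b0.
have ba j l : bnd P (fun i => ((Zm v i.1.1 i.1.2 m *m B)^T *m Mc i.2
     - (dotM (Mc i.2) (Zm v i.1.1 i.1.2 m *m B *m i.2) / dotM (Mc i.2) i.2) *: Mc i.2) j l).
  have E (A M : 'M[R]_k) z : (A - z *: M) j l = A j l - z * M j l by rewrite !mxE.
  under eq_fun do rewrite E.
  apply: bndB; last by apply: bndM => //; exact: bndM.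
  by apply: bnd_mulmx => // j' l'; under eq_fun do rewrite mxE.
exact: bnd_dotM.
Qed.

Lemma bnd_unif T (Q : T -> Prop) (J : finType) (F : J -> T -> R) :
  (forall j, bnd Q (F j)) -> exists K, 0 <= K /\ forall j i, Q i -> `|F j i| <= K.
Proof.
move=> bF; have [K HK] := bnd_sum (index_enum J) (fun j => bnd_norm (bF j)).
exists `|K|; split => // j i Qi; apply: le_trans (ler_norm K).
apply: le_trans (HK i Qi); apply: le_trans (ler_norm _).
by rewrite (bigD1 j)//= lerDl sumr_ge0.
Qed.

Lemma gram_Mc (C : 'M[R]_k) : C^T = C -> dotM C C <= 1 ->
  exists2 N : 'M[R]_k, Mc C = N^T *m N & forall r j, `|N r j| <= 2.
Proof.
move=> sC C1; have [|u u0|N EN] := @cholesky _ k (Mc C).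
- exact: Mc_tr.
- apply: lt_le_trans (Mc_pos C u); rewrite divr_gt0// lt_neqAle dotM_ge0 andbT eq_sym.
  by apply: contra u0 => /eqP u0; apply/eqP; apply: dotM_eq0; rewrite u0.
exists N => // r j.
(* Column [j] of [N] has squared length $M(C)_{jj} = 1 + |C|^2/2 - C_{jj} \le 5/2$. *)
have : N r j ^+ 2 <= Mc C j j.
  rewrite EN mxE (bigD1 r)//= mxE -expr2 lerDl sumr_ge0// => i _.
  by rewrite mxE -expr2 sqr_ge0.
have := dotM_entry C j j; rewrite !mxE eqxx mulr1n ler_norml => h1 h2.
have c1 : -1 <= C j j by nra.
by apply/andP; split; nra.
Qed.

(** For each frame vector, [second_variation] with [Z = Zm] followed by [absorb_linear] bounds
    [phi2]. Summed over the frame, what is left to estimate is the left side of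
    [summed_pde_inequality]. The constant must not depend on the point, on the minimizer or on
    [phi]. *)
Lemma differential_inequality : exists K : R, 0 <= K /\
  forall (y : 'rV[R]_4) (X : 'M[R]_(k, 4)) (C : 'M[R]_k) (phi : 'rV[R]_4 -> R)
    (g : 'rV[R]_4) (phi2 : 'rV[R]_4 -> R),
  D y -> (forall j l, `|X j l| <= R0) -> minimizer (hessian v y) B X C ->
  0 < \tr (X *m hessian v y *m X^T) ->
  phi y = dotM (Mc C) (X *m hessian v y *m X^T) ->
  (forall f, jet2 (fun s => phi (y + s *: f)) (\sum_l f 0 l * g 0 l) (phi2 f)) ->
  (forall f, \forall s \near (0 : R), forall X1 C1, X1 *m B = 1%:M ->
     phi (y + s *: f) <= dotM (Mc C1) (X1 *m hessian v (y + s *: f) *m X1^T)) ->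
  \sum_m phi2 (frame (A1 v y) (Ac v y) (Ad v y) m) <=
  K * (\tr (X *m hessian v y *m X^T) + \sum_l `|g 0 l|).
Proof.
pose I2 : Type := ('rV[R]_4 * 'rV[R]_4 * R)%type.
(* A point, a direction [u] and the size of $Wu$. The directions will be rows of $NX$, with entries
   of [N] at most 2 and entries of [X] at most [R0]. *)
pose P2 (i : I2) := [/\ D i.1.1, forall j, `|i.1.2 0 j| <= k%:R * (2 * R0) &
  forall l, `|D1 i.1.2 (partial l v) i.1.1| <= i.2].
have PD2 i : P2 i -> D i.1.1 by case.
have bu j : bnd P2 (fun i => i.1.2 0 j) by exists (k%:R * (2 * R0)) => i [].
have sp l : small P2 snd (fun i => D1 i.1.2 (partial l v) i.1.1).
  by exists 1 => i [_ _]; rewrite mul1r.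
have [Ke HKe] := small_error sol cD DO PD2 bu sp.
have [Kd [Kd0 HKd]] := bnd_unif (bnd_drift sol cD DO (fun y (Dy : D y) => Dy)).
have [Ka [Ka0 HKa]] := bnd_unif bsq.
have [Kn [Kn0 HKn]] := bnd_unif bnu.
have [Kf [Kf0 HKf]] := bnd_unif (fun mj : 'I_4 * 'I_4 =>
  bnd_frame sol cD DO (fun y (Dy : D y) => Dy) mj.1 mj.2).
pose Kb := \sum_l \sum_j k%:R * 2 * `|B l j|.
have Kb0 : 0 <= Kb by do 2 (apply: sumr_ge0 => ? _); rewrite !mulr_ge0.
exists (k%:R * (`|Ke| * Kb) + Kd + \sum_(m < 4) (4 * Ka + 8 * (Kn * Kf))); split.
  apply: addr_ge0; first by apply: addr_ge0 => //; rewrite !mulr_ge0.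
  by apply: sumr_ge0 => m _; apply: addr_ge0; rewrite !mulr_ge0.
move=> y X C phi g phi2 Dy HX mXC t0 phiy jphi touch.
have Oy := DO Dy; have pW : psd (hessian v y).
  by split; [exact: (hessian_sym sol Oy)|move=> u; exact: (hessian_psd sol u Oy)].
have [XB XW TC C1 sC] := mXC.
set W := hessian v y in mXC XW TC pW phiy t0 *.
set t := \tr (X *m W *m X^T) in t0 TC *.
pose G := \sum_l `|g 0 l|; rewrite -/G.
have G0 : 0 <= G by exact: sumr_ge0.
have trC : \tr C = 1.
  by apply: (mulfI (lt0r_neq0 t0)); rewrite mulr1 -mxtraceZ -TC.
have Cle j l : `|C j l| <= 1.
  rewrite -(@expr_le1 _ 2)// -normrX ger0_norm ?sqr_ge0//.
  exact: le_trans (dotM_entry C j l) C1.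
have hb : 2^-1 <= dotM (Mc C) C by rewrite dotM_Mc trC mulr1; lra.
have PI : P (y, X, C) by split.
have [N EN HN] := gram_Mc sC C1.
have per_m m : phi2 (frame (A1 v y) (Ac v y) (Ad v y) m) <=
   (dotM (N^T *m N) (X *m ddW v (frame (A1 v y) (Ac v y) (Ad v y) m) y *m X^T)
    - 2 * dotM (N^T *m N) (2 *: (Zm v y X m *m dW v (frame (A1 v y) (Ac v y) (Ad v y) m) y *m X^T)
       - Zm v y X m *m W *m (Zm v y X m)^T))
   + (4 * t * Ka + 8 * (Kn * (Kf * G))).
  set f := frame _ _ _ m.
  have [||] := @second_variation R k W (dW v f y) (ddW v f y)
     (fun s => hessian v (y + s *: f)) B X C (fun s => phi (y + s *: f))
     (\sum_l f 0 l * g 0 l) (phi2 f) _ (jetM_hessian f Oy) (jphi f) pW (dW_sym sol f Oy) mXC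
     _ (touch f) (Zm v y X m) t0.
  - by rewrite scale0r addr0.
  - by rewrite scale0r addr0.
  move=> E1 /le_trans; apply; rewrite -EN -addrA lerD2l.
  apply: le_trans (absorb_linear _ t0 hb E1) _.
  apply: lerD.
    rewrite ler_wpM2l ?mulr_ge0 ?(ltW t0)//.
    exact: le_trans (ler_norm _) (HKa m (y, X, C) PI).
  rewrite ler_wpM2l// ler_pM//; first exact: HKn m (y, X, C) PI.
  rewrite (le_trans (ler_norm_sum _ _ _))// mulr_sumr ler_sum// => l _.
  by rewrite normrM ler_wpM2r// (HKf (m, l) y Dy).
apply: (le_trans (ler_sum _ (fun m _ => per_m m))); rewrite big_split /=.
have sum1 := summed_pde_inequality sol X Oy N.
apply: (le_trans (lerD sum1 (lexx _))).
have errs : \sum_r A1 v y / - v y * error_term v y (row r (N *m X)) <= k%:R * (`|Ke| * Kb) * t.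
  apply: le_trans (_ : \sum_(r < k) (`|Ke| * Kb * t) <= _); last first.
    by rewrite sumr_const card_ord -[leLHS]mulr_natl mulrA.
  apply: ler_sum => r _.
  apply: le_trans (ler_norm _) _.
  apply: le_trans (HKe (y, row r (N *m X), t * Kb) _) _; last first.
    rewrite /= -mulrA [Kb * t]mulrC ler_wpM2r ?mulr_ge0 ?(ltW t0)//.
    exact: ler_norm.
  split => //= [j|l].
    rewrite !mxE (le_trans (ler_norm_sum _ _ _))//.
    apply: le_trans (_ : \sum_(i < k) 2 * R0 <= _); last first.
      by rewrite sumr_const card_ord -[leLHS]mulr_natl.
    by apply: ler_sum => i _; rewrite normrM ler_pM.
  (* By $XW = TB^T$ and $T = tC$, the gradient variation along this row is $t$ times an entry of
     $NCB^T$; hence it is linear in $t$. *)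
  rewrite D1_partial -row_mul -mulmxA -/W XW TC mxE.
  rewrite -scalemxAl -scalemxAr mxE normrM gtr0_norm// ler_wpM2l ?(ltW t0)//.
  rewrite mulmxA mxE (le_trans (ler_norm_sum _ _ _))//.
  rewrite /Kb (bigD1 l)//= ler_wpDr//.
    by do 2 (apply: sumr_ge0 => ? _); rewrite !mulr_ge0.
  apply: ler_sum => j _; rewrite normrM [B^T _ _]mxE ler_wpM2r//.
  rewrite mxE (le_trans (ler_norm_sum _ _ _))//.
  apply: le_trans (_ : \sum_(i < k) 2 <= _); last first.
    by rewrite sumr_const card_ord -[leLHS]mulr_natl.
  by apply: ler_sum => i _; rewrite normrM -[leRHS]mulr1 ler_pM.
(* The first order condition along a coordinate direction, read off with [Z = 0], identifies the
   drift with the gradient of the test function. *)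
have gE l : dotM (N^T *m N) (X *m dW v (delta_mx 0 l) y *m X^T) = g 0 l.
  have [||] := @second_variation R k W (dW v (delta_mx 0 l) y) (ddW v (delta_mx 0 l) y)
     (fun s => hessian v (y + s *: delta_mx 0 l)) B X C (fun s => phi (y + s *: delta_mx 0 l))
     (\sum_j (delta_mx 0 l : 'rV[R]_4) 0 j * g 0 j) (phi2 (delta_mx 0 l)) _
     (jetM_hessian _ Oy) (jphi _) pW (dW_sym sol _ Oy) mXC
     _ (touch _) 0 t0.
  - by rewrite scale0r addr0.
  - by rewrite scale0r addr0.
  rewrite -EN => -> _; rewrite (bigD1 l)//= big1 ?addr0 => [|j jl].
    by rewrite mxE !eqxx mul1r.
  by rewrite mxE eqxx (negPf jl) mul0r.
have drifts : \sum_l drift v y l * dotM (N^T *m N) (X *m dW v (delta_mx 0 l) y *m X^T) <= Kd * G.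
  rewrite mulr_sumr; apply: ler_sum => l _; rewrite gE.
  by apply: le_trans (ler_norm _) _; rewrite normrM ler_wpM2r// HKd.
rewrite !big_const_ord /=.
have p0 : 0 <= k%:R * (`|Ke| * Kb) by rewrite !mulr_ge0.
move: (\sum_(r < k) _) (\sum_(l < 4) _) (k%:R * (`|Ke| * Kb)) p0 errs drifts => S1 S2 p p0 errs drifts.
have nf : 0 <= Kn * Kf by rewrite mulr_ge0.
have := mulr_ge0 p0 G0; have := mulr_ge0 Kd0 (ltW t0); have := mulr_ge0 Ka0 G0.
have := mulr_ge0 nf (ltW t0).
move: (ltW t0) G0.
lra.
Qed.

End Uniform.
End DifferentialInequality.

(** * The Hopf lemma for viscosity supersolutions *)

Section EuclideanSpace.
Variables (R : realType) (n : nat).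
Implicit Types (x y z a : 'rV[R]_n.+1) (S : set 'rV[R]_n.+1).

(** The ambient norm is the maximum norm; the barrier needs the smooth Euclidean one, kept
    squared. *)
Definition sqn z : R := \sum_l z 0 l ^+ 2.

Lemma sqn_ge0 z : 0 <= sqn z.
Proof. by apply: sumr_ge0 => l _; exact: sqr_ge0. Qed.

Lemma sqn_eq0 z : sqn z <= 0 -> z = 0.
Proof.
move=> z0; apply/rowP => l; rewrite mxE; apply/eqP; rewrite -sqrf_eq0 eq_le sqr_ge0 andbT.
by apply: le_trans z0; rewrite /sqn (bigD1 l)//= lerDl sumr_ge0// => i _; exact: sqr_ge0.
Qed.

Lemma entry_le_norm z l : `|z 0 l| <= `|z|.
Proof.
rewrite [leRHS]/Num.norm /= mx_normrE.
by apply/bigmax_geP; right => /=; exists (0, l).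
Qed.

Lemma norm_le_entries z (c : R) : 0 <= c -> (forall l, `|z 0 l| <= c) -> `|z| <= c.
Proof.
move=> c0 H; rewrite [leLHS]/Num.norm /= mx_normrE; apply/bigmax_leP; split => // -[i j] _ /=.
by rewrite (ord1 i).
Qed.

Lemma sqn_le z (c : R) : `|z| <= c -> sqn z <= n.+1%:R * c ^+ 2.
Proof.
move=> zc; apply: le_trans (_ : \sum_(l < n.+1) c ^+ 2 <= _).
  apply: ler_sum => l _; apply: sqr_le_of_norm_le.
  exact: le_trans (entry_le_norm z l) zc.
by rewrite sumr_const card_ord -[leLHS]mulr_natl.
Qed.

Lemma norm_le_sqn z (c : R) : 0 <= c -> sqn z <= c ^+ 2 -> `|z| <= c.
Proof.
move=> c0 zc; apply: norm_le_entries => // l.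
rewrite -(@ler_pXn2r _ 2)// ?nnegrE// -normrX ger0_norm ?sqr_ge0//.
by apply: le_trans zc; rewrite /sqn (bigD1 l)//= lerDl sumr_ge0// => i _; exact: sqr_ge0.
Qed.

Lemma sqn_line y a f (s : R) : sqn (y + s *: f - a) =
  sqn (y - a) + s * (2 * \sum_l f 0 l * (y - a) 0 l) + s ^+ 2 * sqn f.
Proof.
rewrite /sqn !mulr_sumr -!big_split; apply: eq_bigr => l _; rewrite !mxE /=; ring.
Qed.

Lemma sqn_half a z : sqn a / 2 - sqn z <= sqn (a + z).
Proof.
rewrite -subr_ge0 /sqn mulr_suml -!sumrB; apply: sumr_ge0 => l _; rewrite !mxE.
rewrite (_ : _ - _ = (a 0 l + 2 * z 0 l) ^+ 2 / 2); last by field.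
by rewrite divr_ge0 ?sqr_ge0.
Qed.

Lemma cts_sum (T : topologicalType) (I : Type) (r : seq I) (F : I -> T -> R) (p : T) :
  (forall i, {for p, continuous (F i)}) ->
  {for p, continuous (fun t => \sum_(i <- r) F i t)}.
Proof.
move=> cF; elim: r => [|i r IH].
  rewrite (_ : (fun t => _) = fun=> 0); first exact: cst_continuous.
  by apply/funext => t; rewrite big_nil.
rewrite (_ : (fun t => _) = fun t => F i t + \sum_(j <- r) F j t).
  exact: continuousD.
by apply/funext => t; rewrite big_cons.
Qed.

Lemma cts_sqn a x : {for x, continuous (fun y => sqn (y - a))}.
Proof.
apply: cts_sum => l.
have H : {for x, continuous (fun y : 'rV[R]_n.+1 => y 0 l - a 0 l)}.
  by apply: continuousB; [exact: coord_continuous|exact: cst_continuous].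
rewrite (_ : (fun y => _) = fun y : 'rV[R]_n.+1 => (y 0 l - a 0 l) * (y 0 l - a 0 l)).
  by apply: continuousM.
by apply/funext => y; rewrite !mxE expr2.
Qed.

Lemma closed_criterion S :
  (forall x, ~ S x -> exists2 r : R, 0 < r & forall y, `|y - x| < r -> ~ S y) -> closed S.
Proof.
move=> H x clx; apply: contrapT => nSx; have [r r0 Hr] := H x nSx.
have [y [Sy By]] := clx _ (nbhsx_ballx x r r0).
by apply: (Hr y) => //; move: By; rewrite -ball_normE /ball_/= distrC.
Qed.

Lemma compact_criterion S x0 (r : R) : (forall x, S x -> `|x - x0| <= r) ->
  closed S -> compact S.
Proof.
move=> bS; apply: bounded_closed_compact.
exists (`|x0| + r); split; first exact: num_real.
move=> M hM x Sx /=; apply: ltW; apply: le_lt_trans hM.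
by rewrite -[x](subrK x0) (le_trans (ler_normD _ _))// addrC lerD2l bS.
Qed.

Lemma compact_ball x0 (r : R) : compact [set x | `|x - x0| <= r].
Proof.
apply: (@compact_criterion _ x0 r) => //; apply: closed_criterion => x /= /negP.
rewrite -ltNge => hx; exists (`|x - x0| - r); first by rewrite subr_gt0.
move=> y; rewrite distrC => hy; apply/negP; rewrite -ltNge.
have : `|x - x0| <= `|x - y| + `|y - x0| by rewrite -[x - x0](subrKA y) ler_normD.
lra.
Qed.

End EuclideanSpace.

Lemma triangle_estimate (R : realType) (n : nat) (y x0 x1 x2 : 'rV[R]_n.+1) (r dl N : R) :
  `|y - x2| <= dl -> dl <= r / 2 -> `|x2 - x0| <= r / 2 -> `|x1 - x0| <= r / (4 * N) ->
  1 <= N -> `|y - x1 + (y - x2)| <= 4 * r.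
Proof.
move=> h1 h2 h3 h4 N1.
have r0 : 0 <= r by have := normr_ge0 (x2 - x0); move: h3; move: `|x2 - x0| => t; lra.
have h5 : r / (4 * N) <= r.
  by rewrite ler_pdivrMr ?ler_peMr//; lra.
have t1 : `|y - x1 + (y - x2)| <= `|y - x1| + `|y - x2| by exact: ler_normD.
have t2 : `|y - x1| <= `|y - x0| + `|x1 - x0|.
  by rewrite -[y - x1](subrKA x0) [`|x1 - x0|]distrC ler_normD.
have t3 : `|y - x0| <= `|y - x2| + `|x2 - x0| by rewrite -[y - x0](subrKA x2) ler_normD.
lra.
Qed.

Lemma scalar_estimate (R : realType) (eps th r zz : R) :
  0 < eps -> 0 <= th -> th <= 3 / 2 -> `|zz| <= 4 * r -> `|eps * th * -2 * zz| <= eps * (12 * r).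
Proof.
move=> e0 t0 t1 hz.
rewrite !normrM (gtr0_norm e0) (ger0_norm t0) normrN (ger0_norm (ler0n _ 2)) -!mulrA.
apply: ler_wpM2l; first exact: ltW.
have -> : 12 * r = 3 / 2 * (2 * (4 * r)) by field.
by apply: ler_pM => //; apply: ler_wpM2l.
Qed.

(** The value of [beta] makes the elliptic term $8\beta Q$ exceed the trace term and the right side
    together, with margin $2\rho/K_e$. Here [a] bounds the sum of the squared frame lengths and
    $\varepsilon b$ the gradient of the test function. *)
Lemma barrier_arith (R : realType) (eps th P Q beta rho Ke K a b gy sg : R) :
  0 < eps -> 0 <= K -> 0 < Ke -> 0 < rho -> th <= 3 / 2 -> 0 <= P -> P <= a ->
  rho / (4 * Ke) <= Q -> 0 <= b -> beta = 1 + Ke / rho * (6 * a + K * (1 + b)) ->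
  gy <= eps -> sg <= eps * b ->
  eps * (th * (- 4 * P) + 8 * beta * Q) <= K * (gy + sg) -> False.
Proof.
move=> eps0 K0 Ke0 rho0 th2 P0 Pa Q1 b0 betaE hy hs ineq.
have a0 : 0 <= a by exact: le_trans Pa.
have A0 : 0 <= 6 * a + K * (1 + b) by rewrite addr_ge0 ?mulr_ge0// addr_ge0.
have beta0 : 0 <= beta.
  by rewrite betaE; apply: addr_ge0 => //; apply: mulr_ge0 => //; apply: divr_ge0; exact: ltW.
have rhs : K * (gy + sg) <= eps * (K * (1 + b)).
  by rewrite mulrCA ler_wpM2l// mulrDr mulr1 lerD.
have lhs : eps * (- (6 * a) + 2 * beta * (rho / Ke)) <=
    eps * (th * (- 4 * P) + 8 * beta * Q).
  rewrite ler_wpM2l ?(ltW eps0)// lerD//.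
    have h : 0 <= P * (3 / 2 - th) by rewrite mulr_ge0// subr_ge0.
    rewrite (_ : th * (- 4 * P) = 4 * (P * (3 / 2 - th)) - 6 * P); last by field.
    by move: h; move: (P * _) => t; lra.
  have -> : 2 * beta * (rho / Ke) = 8 * beta * (rho / (4 * Ke)) by field; rewrite gt_eqF.
  by rewrite ler_wpM2l// mulr_ge0.
have := le_trans lhs (le_trans ineq rhs); rewrite ler_pM2l//.
have -> : 2 * beta * (rho / Ke) = 2 * (rho / Ke) + 2 * (6 * a + K * (1 + b)).
  by rewrite betaE; field; rewrite !gt_eqF.
have : 0 < rho / Ke by rewrite divr_gt0.
move: A0; have : 0 <= K * (1 + b) by rewrite mulr_ge0// addr_ge0.
move: (rho / Ke) (K * _) => t1 t2; lra.
Qed.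

Section Hopf.
Variables (R : realType) (n : nat) (G : 'rV[R]_n.+1 -> R) (x0 : 'rV[R]_n.+1) (r : R).
Variables (J : finType) (fr : 'rV[R]_n.+1 -> J -> 'rV[R]_n.+1) (K Ke Kf : R).
Hypotheses (r0 : 0 < r) (K0 : 0 <= K) (Ke0 : 0 < Ke) (Gx0 : G x0 = 0).
Hypothesis G_ge0 : forall x, `|x - x0| <= r -> 0 <= G x.
Hypothesis G_cts : forall x, `|x - x0| < r -> {for x, continuous G}.
Hypothesis elliptic : forall y z, `|y - x0| <= r ->
  sqn z <= Ke * \sum_m (\sum_l fr y m 0 l * z 0 l) ^+ 2.
Hypothesis fr_bnd : forall y m, `|y - x0| <= r -> sqn (fr y m) <= Kf.
(* [G] is a viscosity supersolution of a linear elliptic inequality, tested by touching from below. *)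
Hypothesis supersol : forall y (phi : 'rV[R]_n.+1 -> R) (g : 'rV[R]_n.+1) phi2,
  `|y - x0| < r ->
  (forall f, jet2 (fun s => phi (y + s *: f)) (\sum_l f 0 l * g 0 l) (phi2 f)) ->
  phi y = G y -> (forall f, \forall s \near (0 : R), phi (y + s *: f) <= G (y + s *: f)) ->
  (G y = 0 -> g = 0) /\
  (0 < G y -> \sum_m phi2 (fr y m) <= K * (G y + \sum_l `|g 0 l|)).

(** For $\rho = |b-a|^2$ the set $w \ge 0$ is the closed ball with diameter $[a,b]$, which meets the
    sphere about [a] through [b] only at [b]. The quadratic term replaces the exponential of the
    usual Hopf barrier. *)
Definition barrier (beta rho : R) (a b x : 'rV[R]_n.+1) : R :=
  let w := rho - sqn (x - a) - sqn (x - b) in w + beta * w ^+ 2.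

Lemma jet2_barrier beta rho (a b y f : 'rV[R]_n.+1)
    (w := rho - sqn (y - a) - sqn (y - b))
    (dw := - 2 * \sum_l f 0 l * ((y - a) + (y - b)) 0 l) :
  jet2 (fun s => barrier beta rho a b (y + s *: f))
    ((1 + 2 * beta * w) * dw)
    ((1 + 2 * beta * w) * (- 4 * sqn f) + 2 * beta * dw ^+ 2).
Proof.
have jw : jet2 (fun s => rho - sqn (y + s *: f - a) - sqn (y + s *: f - b)) dw (- 4 * sqn f).
  rewrite (_ : (fun s => _) = fun s => w + (s * dw + s * s * (- 2 * sqn f))).
    have jid := @jet2_id R.
    by apply: jet2_eq (jet2D (jet2_cst w) (jet2D (jet2M jid (jet2_cst dw))
      (jet2M (jet2M jid jid) (jet2_cst (- 2 * sqn f))))) _ _; ring.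
  apply/funext => s; rewrite !sqn_line /w /dw.
  have -> : \sum_l f 0 l * (y - a + (y - b)) 0 l =
    \sum_l f 0 l * (y - a) 0 l + \sum_l f 0 l * (y - b) 0 l.
    by rewrite -big_split; apply: eq_bigr => l _; rewrite [(_ + (y - b)) 0 l]mxE mulrDr.
  ring.
have := jet2D jw (jet2Z beta (jet2M jw jw)).
rewrite scale0r addr0 -/w => j.
rewrite (_ : (fun s => _) = fun s => (rho - sqn (y + s *: f - a) - sqn (y + s *: f - b)) +
  beta * ((rho - sqn (y + s *: f - a) - sqn (y + s *: f - b)) *
          (rho - sqn (y + s *: f - a) - sqn (y + s *: f - b)))); last first.
  by apply/funext => s; rewrite /barrier expr2.
by apply: jet2_eq j _ _; ring.
Qed.

Lemma cts_G_zero_closed : closed [set x | `|x - x0| <= r / 2 /\ G x = 0].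
Proof.
apply: closed_criterion => x /= nx.
have [hx|hx] := leP `|x - x0| (r / 2); last first.
  exists (`|x - x0| - r / 2); first by rewrite subr_gt0.
  move=> y; rewrite distrC => hy [hy' _].
  have : `|x - x0| <= `|x - y| + `|y - x0| by rewrite -[x - x0](subrKA y) ler_normD.
  lra.
have Gx : G x != 0 by apply/eqP => Gx; apply: nx.
have hx' : `|x - x0| < r by have := r0; lra.
have g0 : 0 < `|G x| by rewrite normr_gt0.
have [e e0 He] := cts_ball (G_cts hx') g0.
exists e => // y hy [_ Gy]; have := He y hy.
by rewrite Gy sub0r normrN ltxx.
Qed.

(** [x2] is a zero of [G] nearest to [x1] in Euclidean distance. As [x0] is a zero, that distance is
    at most $r/4$ once the factor [n.+1] has paid for passing from the maximum norm, so the ball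
    about [x1] stays in the region of radius $r/2$. *)
Lemma touching_point x1 : `|x1 - x0| < r / (4 * n.+1%:R) -> G x1 != 0 ->
  exists x2, [/\ `|x2 - x0| < r / 2, G x2 = 0, 0 < sqn (x2 - x1) &
    forall x, sqn (x - x1) < sqn (x2 - x1) -> `|x - x0| < r / 2 /\ 0 < G x].
Proof.
move=> hx1 Gx1.
have n1 : 1 <= n.+1%:R :> R by rewrite ler1n.
have x14 : `|x1 - x0| < r / 4.
  apply: lt_le_trans hx1 _; rewrite ler_pM2l// lef_pV2 ?posrE ?mulr_gt0 ?ltr0n//.
  by rewrite ler_peMr.
have cZ : compact [set x | `|x - x0| <= r / 2 /\ G x = 0].
  by apply: (compact_criterion (x0 := x0) (r := r / 2)) cts_G_zero_closed => x [].
have [|x2 [hx2 Gx2] x2min] := cts_min cZ _ (fun x _ => @cts_sqn _ _ x1 x).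
  by exists x0; split => //; rewrite subrr normr0 divr_ge0// ltW.
have sq0 : sqn (x0 - x1) <= (r / 4) ^+ 2.
  apply: le_trans (sqn_le (c := r / (4 * n.+1%:R)) _) _; first by rewrite distrC ltW.
  rewrite (_ : _ * _ = (r / 4) ^+ 2 / n.+1%:R); last first.
    have : n.+1%:R != 0 :> R by rewrite pnatr_eq0.
    by move: (n.+1%:R) => N N0; field.
  by rewrite ler_pdivrMr ?ltr0n// ler_peMr// sqr_ge0.
have x02 : sqn (x2 - x1) <= sqn (x0 - x1).
  by apply: x2min; split => //; rewrite subrr normr0 divr_ge0// ltW.
have inD x : sqn (x - x1) <= sqn (x2 - x1) -> `|x - x0| < r / 2.
  move=> hx; have r4 : 0 <= r / 4 by rewrite divr_ge0// ltW.
  have := norm_le_sqn r4 (le_trans hx (le_trans x02 sq0)).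
  have : `|x - x0| <= `|x - x1| + `|x1 - x0| by rewrite -[x - x0](subrKA x1) ler_normD.
  lra.
exists x2; split => //; first exact: inD.
  rewrite lt_neqAle sqn_ge0 andbT; apply: contra Gx1 => /eqP h.
  have /eqP : x2 - x1 = 0 by apply: sqn_eq0; rewrite -h.
  by rewrite subr_eq0 => /eqP <-; rewrite Gx2.
move=> x hx; have hx0 := inD x (ltW hx); split => //.
rewrite lt_neqAle; apply/andP; split; last by apply: G_ge0; have := r0; lra.
apply/eqP => Gx; have := x2min x (conj (ltW hx0) (esym Gx)).
by rewrite leNgt hx.
Qed.

(** On a small ball [S] about the touching point, $G - \varepsilon h$ has a minimum in the interior,
    where $\varepsilon h$ plus a constant touches [G] from below. If [G] vanishes there, the nonzero
    gradient of the barrier is contradictory; otherwise [barrier_arith] applies. *)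
Lemma hopf_contradiction x1 : `|x1 - x0| < r / (4 * n.+1%:R) -> G x1 = 0.
Proof.
move=> hx1; apply/eqP; apply: contraT => Gx1.
have [x2 [hx2 Gx2 rho0 outside]] := touching_point hx1 Gx1.
set rho := sqn (x2 - x1) in rho0 outside.
have J0 : 0 <= #|J|%:R :> R by exact: ler0n.
pose N : R := n.+1%:R.
have N0 : 0 < N by rewrite ltr0n.
have Kf0 : 0 <= `|Kf| by [].
pose beta := 1 + Ke / rho * (6 * (#|J|%:R * `|Kf|) + K * (1 + 12 * (N * r))).
have beta1 : 1 <= beta.
  rewrite lerDl mulr_ge0 ?divr_ge0 ?(ltW rho0) ?(ltW Ke0)//.
  rewrite addr_ge0 ?mulr_ge0// addr_ge0// !mulr_ge0 ?(ltW N0) ?(ltW r0)//.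
pose w x := rho - sqn (x - x1) - sqn (x - x2).
have w2 : w x2 = 0 by rewrite /w /rho !subrr /sqn [X in - X]big1 ?subr0// => l _; rewrite mxE expr0n.
have cw : {for x2, continuous w}.
  apply: continuousB; last exact: cts_sqn.
  by apply: continuousB; [exact: cst_continuous|exact: cts_sqn].
have b0 : 0 < (4 * beta)^-1 by rewrite invr_gt0; lra.
have [d1 d10 Hd1] := cts_ball cw b0.
have rho16 : 0 < rho / 16 by rewrite divr_gt0.
have [d2 d20 Hd2] := cts_ball (@cts_sqn _ _ x2 x2) rho16.
(* On [S], $|w| < 1/(4\beta)$ keeps the factor $1 + 2\beta w$ in $[1/2, 3/2]$, $|x-x_2|^2 < \rho/16$
   keeps the gradient away from 0, and [S] stays in the domain of the hypotheses. *)
pose dl := Num.min (Num.min d1 d2) (r / 2) / 2.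
have m0 : 0 < Num.min (Num.min d1 d2) (r / 2) by rewrite !lt_min d10 d20 divr_gt0.
have dl0 : 0 < dl by rewrite divr_gt0.
have [ld1 ld2 ldr] : [/\ dl < d1, dl < d2 & dl < r / 2].
  have h1 : Num.min (Num.min d1 d2) (r / 2) <= d1 by rewrite !ge_min lexx.
  have h2 : Num.min (Num.min d1 d2) (r / 2) <= d2 by rewrite !ge_min lexx orbT.
  have h3 : Num.min (Num.min d1 d2) (r / 2) <= r / 2 by rewrite ge_min lexx orbT.
  by rewrite /dl; split; lra.
pose S : set 'rV[R]_n.+1 := [set x | `|x - x2| <= dl].
have cS : compact S := @compact_ball _ _ x2 dl.
have S_in (x : 'rV[R]_n.+1) : S x -> `|x - x0| < r.
  move=> Sx; have : `|x - x0| <= `|x - x2| + `|x2 - x0| by rewrite -[x - x0](subrKA x2) ler_normD.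
  by move: Sx; rewrite /S /=; lra.
have S_w (x : 'rV[R]_n.+1) : S x -> `|w x| < (4 * beta)^-1.
  by move=> Sx; have := Hd1 x (le_lt_trans Sx ld1); rewrite w2 subr0.
have S_q (x : 'rV[R]_n.+1) : S x -> sqn (x - x2) < rho / 16.
  move=> Sx; have := Hd2 x (le_lt_trans Sx ld2).
  rewrite subrr (_ : sqn 0 = 0) ?subr0 ?ger0_norm ?sqn_ge0//.
  by rewrite /sqn big1// => l _; rewrite mxE expr0n.
pose h := barrier beta rho x1 x2.
have hE (x : 'rV[R]_n.+1) : h x = w x + beta * w x ^+ 2 by [].
have bw (x : 'rV[R]_n.+1) : S x -> `|beta * w x| <= 1 / 4.
  move=> Sx; rewrite normrM gtr0_norm; last by lra.
  have := ltW (S_w x Sx); rewrite -(ler_pM2l (_ : 0 < beta)); last by lra.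
  by rewrite invfM mulrCA divff ?mulr1 ?div1r// gt_eqF//; lra.
have h1 (x : 'rV[R]_n.+1) : S x -> h x <= 1.
  move=> Sx; rewrite hE expr2 mulrA.
  have := bw x Sx; have := S_w x Sx.
  have : (4 * beta)^-1 <= 1 / 4.
    by rewrite div1r lef_pV2 ?posrE; lra.
  rewrite !ler_norml !ltr_norml => hb /andP[? ?] /andP[? ?]; nra.
have h_le0 (x : 'rV[R]_n.+1) : S x -> w x <= 0 -> h x <= 0.
  move=> Sx wx; rewrite hE expr2 mulrA.
  by have := bw x Sx; rewrite ler_norml => /andP[? ?]; nra.
have h2 : h x2 = 0 by rewrite hE w2 expr0n mulr0 addr0.
have G_S (x : 'rV[R]_n.+1) : S x -> 0 <= G x by move=> /S_in /ltW; exact: G_ge0.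
(* On the part of the boundary of S where w >= 0 we are strictly inside the ball where G > 0. *)
have [eps eps0 bdry] : exists2 eps : R, 0 < eps &
    forall x, `|x - x2| = dl -> eps * h x <= G x.
  pose S' : set 'rV[R]_n.+1 := [set x | `|x - x2| = dl /\ 0 <= w x].
  have cw' x : {for x, continuous w}.
    apply: continuousB; last exact: cts_sqn.
    by apply: continuousB; [exact: cst_continuous|exact: cts_sqn].
  have cS' : compact S'.
    apply: (compact_criterion (x0 := x2) (r := dl)) => [x []-> //|].
    apply: closed_criterion => x nx.
    have [hx|/eqP hx] := eqVneq `|x - x2| dl; last first.
      exists (Num.norm (Num.norm (x - x2) - dl)); first by rewrite normr_gt0 subr_eq0; apply/eqP.
      move=> y hy [hy' _]; move: hy; rewrite -hy'.
      have := ler_dist_dist (x - x2) (y - x2).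
      by rewrite (_ : x - x2 - (y - x2) = x - y) ?[`|y - x|]distrC; [lra|rewrite opprB addrA subrK].
    have wx : w x < 0 by rewrite ltNge; apply/negP => wx; exact: nx.
    have [|e e0 He] := cts_ball (cw' x) (_ : 0 < - w x); first by rewrite oppr_gt0.
    exists e => // y hy [_ wy]; have := He y hy.
    by rewrite ltr_norml => /andP[? ?]; lra.
  have posS' x : S' x -> 0 < G x.
    move=> [hx wx]; apply: (proj2 (outside x _)).
    move: wx; rewrite /w.
    have : 0 < sqn (x - x2).
      rewrite lt_neqAle sqn_ge0 andbT; apply/eqP => hq.
      have : x - x2 = 0 by apply: sqn_eq0; rewrite -hq.
      by move=> hz; move: hx; rewrite hz normr0 => hz'; move: dl0; rewrite -hz' ltxx.
    by lra.
  have SS' x : S' x -> S x by move=> [hx _]; rewrite /S /= hx.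
  have [S0|/set0P S0] := eqVneq S' set0.
    exists 1 => // x hx; have Sx : S x by rewrite /S /= hx.
    rewrite mul1r (le_trans _ (G_S x Sx))// h_le0//.
    have [//|wx] := leP (w x) 0.
    have : S' x by split => //; exact: ltW.
    by rewrite S0.
  have [|c Sc cmin] := cts_min cS' S0 (w := G).
    by move=> x /SS' /S_in; exact: G_cts.
  exists (G c); first exact: posS'.
  move=> x hx; have Sx : S x by rewrite /S /= hx.
  have [wx|wx] := leP (w x) 0.
    apply: le_trans (G_S x Sx); rewrite pmulr_rle0 ?posS'//; exact: h_le0.
  apply: le_trans (cmin x _); last by split => //; exact: ltW.
  by rewrite ler_piMr ?h1// ltW// posS'.
have ch x : {for x, continuous h}.
  have cw' : {for x, continuous w}.
    apply: continuousB; last exact: cts_sqn.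
    by apply: continuousB; [exact: cst_continuous|exact: cts_sqn].
  rewrite (_ : h = fun x => w x + beta * (w x * w x)); last first.
    by apply/funext => z; rewrite hE expr2.
  apply: continuousD => //; apply: continuousM; first exact: cst_continuous.
  exact: continuousM.
have Sx2 : S x2 by rewrite /S /= subrr normr0 ltW.
have [y [Sy yint ymin]] : exists y, [/\ S y, `|y - x2| < dl &
    forall x, S x -> G y - eps * h y <= G x - eps * h x].
  have [||y Sy ymin] := cts_min cS _ (w := fun x => G x - eps * h x); first by exists x2.
    move=> x /S_in Sx; apply: continuousB; first exact: G_cts.
    by apply: continuousM; [exact: cst_continuous|exact: ch].
  have [yint|yint] := ltP `|y - x2| dl; first by exists y.
  (* If the minimum is reached on the boundary, where $G \ge \varepsilon h$, it is nonnegative;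
     since the difference vanishes at the centre [x2], that point is a minimum too. *)
  exists x2; split => //; first by rewrite subrr normr0.
  move=> x Sx; apply: le_trans (ymin x Sx).
  rewrite Gx2 h2 mulr0 subr0 subr_ge0 bdry//.
  by apply/eqP; rewrite eq_le yint andbT.
pose mu := G y - eps * h y.
have mu0 : mu <= 0.
  by have := ymin x2 Sx2; rewrite Gx2 h2 mulr0 subr0.
pose g := (eps * (1 + 2 * beta * w y) * -2) *: ((y - x1) + (y - x2)).
have Sy' := ltW (S_in y Sy).
have [|||gz ineq] := @supersol y (fun x => eps * h x + mu) g
   (fun f => eps * ((1 + 2 * beta * w y) * (- 4 * sqn f) + 2 * beta *
       (- 2 * \sum_l f 0 l * ((y - x1) + (y - x2)) 0 l) ^+ 2)) (S_in y Sy).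
- move=> f; have := jet2D (jet2Z eps (jet2_barrier beta rho x1 x2 y f)) (jet2_cst mu).
  move/jet2_eq; apply; last by rewrite addr0.
  rewrite addr0 !mulr_sumr; apply: eq_bigr => l _; rewrite [g 0 l]mxE -/(w y).
  by ring.
- by rewrite /mu addrC subrK.
- move=> f; have oS : open [set x | `|x - x2| < dl].
    have -> : [set x | `|x - x2| < dl] = ball x2 dl.
      by apply/seteqP; rewrite -ball_normE; split => z /=; rewrite distrC.
    exact: ball_open.
  apply: filterS (open_line_near f oS yint) => s /= hs.
  have := ymin (y + s *: f) (ltW hs); rewrite -/mu; lra.
set z := y - x1 + (y - x2) in g gz ineq *.
have zE : z = (x2 - x1) + 2 *: (y - x2).
  by apply/rowP => l; rewrite !mxE; ring.
(* [sqn_half] gives $\rho/2 - 4|y-x_2|^2$, and the last term is below $\rho/4$ on [S]. *)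
have z4 : rho / 4 <= sqn z.
  have := sqn_half (x2 - x1) (2 *: (y - x2)); rewrite -zE -/rho.
  have -> : sqn (2 *: (y - x2)) = 4 * sqn (y - x2).
    by rewrite /sqn mulr_sumr; apply: eq_bigr => l _; rewrite mxE; ring.
  have := S_q y Sy; lra.
have := bw y Sy; rewrite ler_norml => /andP[bw1 bw2].
set th := 1 + 2 * beta * w y in g gz ineq *.
have [th1 th2] : 2^-1 <= th /\ th <= 3 / 2 by rewrite /th -mulrA; split; lra.
have [Gy0|Gy0] := eqVneq (G y) 0.
  have gz0 := gz Gy0.
  have : z = 0.
    have : (eps * th * -2) != 0 by rewrite !mulf_neq0// ?oppr_eq0 ?pnatr_eq0// gt_eqF//; lra.
    by move=> c0; apply: (scalerI c0); rewrite scaler0 -gz0.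
  move=> z0; move: z4; rewrite z0 (_ : sqn 0 = 0); first by lra.
  by rewrite /sqn big1// => l _; rewrite mxE expr0n.
have Gy : 0 < G y by rewrite lt_neqAle eq_sym Gy0 G_S.
have {gz}ineq := ineq Gy.
pose P := \sum_m sqn (fr y m); pose Q := \sum_m (\sum_l fr y m 0 l * z 0 l) ^+ 2.
have LHS_E : \sum_m eps * (th * (- 4 * sqn (fr y m)) + 2 * beta *
    (- 2 * \sum_l fr y m 0 l * z 0 l) ^+ 2) = eps * (th * (- 4 * P) + 8 * beta * Q).
  rewrite /P /Q !mulr_sumr -big_split mulr_sumr; apply: eq_bigr => m _ /=.
  ring.
rewrite {}LHS_E in ineq.
have P1 : P <= #|J|%:R * `|Kf|.
  apply: le_trans (_ : \sum_(m : J) `|Kf| <= _).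
    apply: ler_sum => m _; exact: le_trans (fr_bnd m Sy') (ler_norm _).
  by rewrite sumr_const -[leLHS]mulr_natl.
have P0 : 0 <= P by apply: sumr_ge0 => m _; exact: sqn_ge0.
have Q1 : rho / (4 * Ke) <= Q.
  have := le_trans z4 (elliptic z Sy'); rewrite -/Q => hQ.
  rewrite ler_pdivrMr; last by rewrite mulr_gt0.
  lra.
have g1 : \sum_l `|g 0 l| <= eps * (12 * (N * r)).
  apply: le_trans (_ : \sum_(l < n.+1) (eps * (12 * r)) <= _); last first.
    by rewrite sumr_const card_ord -[leLHS]mulr_natl -/N le_eqVlt; apply/orP; left; apply/eqP; ring.
  have zn : `|z| <= 4 * r.
    have N1 : 1 <= N by rewrite ler1n.
    apply: triangle_estimate (ltW yint) (ltW ldr) (ltW hx2) (ltW hx1) N1.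
  move=> {Q1 P1 P0 ineq}.
  apply: ler_sum => l _; rewrite [g 0 l]mxE.
  apply: (scalar_estimate eps0 _ th2 (le_trans (entry_le_norm z l) zn)).
  by apply: le_trans th1; rewrite invr_ge0.
have hy1 : G y <= eps.
  have : G y <= eps * h y by rewrite -subr_le0.
  by move/le_trans; apply; rewrite ler_piMr ?(ltW eps0) ?h1.
have NR0 : 0 <= 12 * (N * r) by rewrite mulr_ge0// mulr_ge0// ltW.
by case: (barrier_arith eps0 K0 Ke0 rho0 th2 P0 P1 Q1 NR0 (erefl beta) hy1 g1 ineq).
Qed.

End Hopf.

(** * Local constancy of the rank *)

Section RankPositive.
Variable R : realType.

Lemma psd_kernel n (Q : 'M[R]_n) (u : 'rV_n) : psd Q -> (u *m Q *m u^T) 0 0 = 0 -> u *m Q = 0.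
Proof.
move=> [sQ Q0] uQ.
set q := u *m Q in uQ *; apply: dotM_eq0; rewrite leNgt; apply/negP => q0.
have H (s : R) : 0 <= 2 * s * dotM q q + s ^+ 2 * (q *m Q *m q^T) 0 0.
  have := Q0 (u + s *: q); congr (0 <= _).
  have E1 : (q *m q^T) 0 0 = dotM q q by rewrite dotM_tr /mxtrace big_ord1.
  have E2 : (q *m Q *m u^T) 0 0 = dotM q q.
    by rewrite -E1 /q -mulmxA -[in RHS]mulmxA trmx_mul sQ -!mulmxA.
  have -> : (u + s *: q) *m Q *m (u + s *: q)^T = q *m u^T + s *: (q *m q^T) +
      (s *: (q *m Q *m u^T) + s ^+ 2 *: (q *m Q *m q^T)).
    rewrite linearD linearZ /= !(mulmxDl, mulmxDr) -!(scalemxAl, scalemxAr) -/q.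
    by rewrite scalerA expr2 addrA -!addrA.
  clearbody q; move: uQ E1 E2.
  move: (q *m u^T) (q *m q^T) (q *m Q *m u^T) (q *m Q *m q^T) => a b c d ha hb hc.
  by rewrite !mxE ha hb hc; ring.
(* With $p = |q|^2$ and $d = qQq^T$ this choice makes the quadratic equal to $-p^2(2+d)/(1+d)^2 <
   0$. *)
have := H (- (dotM q q / (1 + (q *m Q *m q^T) 0 0))).
have : 0 <= (q *m Q *m q^T) 0 0 by exact: Q0.
move: (dotM q q) ((q *m Q *m q^T) 0 0) q0 => p d p0 d0 {Q0 H}.
have d1 : 0 < 1 + d by apply: ltr_pwDl.
have -> : 2 * - (p / (1 + d)) * p + (- (p / (1 + d))) ^+ 2 * d =
  - (p ^+ 2 * (2 + d) / (1 + d) ^+ 2) by field; rewrite gt_eqF.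
rewrite oppr_ge0 leNgt divr_gt0 ?exprn_gt0// mulr_gt0 ?exprn_gt0//; exact: ltr_pwDl.
Qed.

Lemma rank_le_of_left_inverse n k (W : 'M[R]_n) (X : 'M[R]_(k, n)) (B : 'M[R]_(n, k)) :
  X *m B = 1%:M -> X *m W = 0 -> (\rank W + k <= n)%N.
Proof.
move=> XB XW; rewrite addnC; have := mulmx0_rank_max XW; apply: leq_trans.
by rewrite leq_add2r -{1}(mxrank1 R k) -XB mxrankM_maxl.
Qed.

(** Coercivity makes the left kernels of [W] and [B] meet in 0, so [B] is injective on the kernel of
    [W], whose dimension is then at most [k]. *)
Lemma rank_ge_of_coercive n k (W : 'M[R]_n) (B : 'M[R]_(n, k)) (c : R) : 0 < c ->
  (forall u : 'rV_n, c * dotM u u <= (u *m W *m u^T) 0 0 + dotM (u *m B) (u *m B)) ->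
  (n <= \rank W + k)%N.
Proof.
move=> c0 coer.
have E0 : (kermx W :&: kermx B)%MS = 0.
  apply/eqP/rowV0P => u; rewrite sub_capmx => /andP[/sub_kermxP uW /sub_kermxP uB].
  apply: dotM_eq0; rewrite -(pmulr_rle0 _ c0) (le_trans (coer u))//.
  by rewrite uW uB mul0mx mxE add0r /dotM big1// => i _; rewrite big1// => j _; rewrite mxE mul0r.
have := mxrank_mul_ker (kermx W) B; rewrite E0 mxrank0 addn0 mxrank_ker => E.
by rewrite -leq_subLR -E rank_leq_col.
Qed.

Definition kernel_basis n (W : 'M[R]_n) : 'M[R]_(n, \rank (kermx W)) := (row_base (kermx W))^T.

Lemma kernel_basis_inverse n (W : 'M[R]_n) : exists X : 'M[R]_(_, n),
  X *m kernel_basis W = 1%:M /\ X *m W = 0.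
Proof.
rewrite /kernel_basis; set N := row_base (kermx W).
have NW : N *m W = 0 by apply/sub_kermxP; rewrite eq_row_base.
have fN : row_free N := row_base_free _.
have uN : N *m N^T \in unitmx.
  rewrite -row_free_unit -kermx_eq0; apply/rowV0P => y /sub_kermxP yN.
  have : y *m N = 0.
    apply: dotM_eq0; rewrite dotM_tr trmx_mul mulmxA -[y *m N *m N^T]mulmxA yN mul0mx.
    by rewrite mxtrace0.
  by move=> h; apply: (row_free_inj fN); rewrite h mul0mx.
exists (invmx (N *m N^T) *m N); split; first by rewrite -mulmxA mulVmx.
by rewrite -mulmxA NW mulmx0.
Qed.

(** [c] is the minimum of the form $W + BB^T$ on the Euclidean unit sphere. It is positive because a
    kernel vector of [W] is a combination of the columns of $B$, hence 0 if also orthogonal to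
    them. *)
Lemma coercive_exists n (W : 'M[R]_n.+1) : psd W -> exists2 c : R, 0 < c &
  forall u : 'rV_n.+1, c * dotM u u <=
    (u *m W *m u^T) 0 0 + dotM (u *m kernel_basis W) (u *m kernel_basis W).
Proof.
move=> pW; set B := kernel_basis W.
pose Q (u : 'rV[R]_n.+1) := (u *m (W + B *m B^T) *m u^T) 0 0.
have QE u : Q u = (u *m W *m u^T) 0 0 + dotM (u *m B) (u *m B).
  by rewrite /Q mulmxDr mulmxDl mxE dotM_tr /mxtrace big_ord1 trmx_mul !mulmxA.
have dE (u : 'rV[R]_n.+1) : dotM u u = sqn u.
  by rewrite /dotM big_ord1; apply: eq_bigr => j _; rewrite expr2.
pose S : set 'rV[R]_n.+1 := [set u | sqn (u - 0) = 1].
have cQ x : {for x, continuous Q}.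
  rewrite (_ : Q = fun u => \sum_i \sum_j u 0 i * (W + B *m B^T) i j * u 0 j); last first.
    apply/funext => u; rewrite /Q mxE exchange_big /=; apply: eq_bigr => j _.
    by rewrite [X in X * _]mxE mulr_suml [_^T _ _]mxE.
  apply: cts_sum => i; apply: cts_sum => j.
  apply: continuousM; last exact: coord_continuous.
  by apply: continuousM; [exact: coord_continuous|exact: cst_continuous].
have cS : compact S.
  apply: (compact_criterion (x0 := 0) (r := 1)) => [x Sx|].
    by apply: norm_le_sqn => //; rewrite expr1n -Sx.
  apply: closed_criterion => x nx.
  have x0 : 0 < `|sqn (x - 0) - 1| by rewrite normr_gt0 subr_eq0; apply/eqP.
  have [e e0 He] := cts_ball (@cts_sqn R n 0 x) x0.
  exists e => // y yx Sy; have := He y yx.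
  by rewrite Sy distrC ltxx.
have S0 : S !=set0.
  exists (delta_mx 0 0); rewrite /S /= /sqn (bigD1 0)//= big1 => [|i i0].
    by rewrite !mxE !eqxx subr0 expr1n addr0.
  by rewrite !mxE (negPf i0) andbF subr0 expr0n.
have [u Su umin] := cts_min cS S0 (fun x _ => cQ x).
have Q0 x : 0 <= Q x by rewrite QE addr_ge0 ?dotM_ge0//; exact: (proj2 pW).
exists (Q u).
  rewrite lt_neqAle Q0 andbT; apply/eqP => /esym Qu.
  have : u = 0.
    have a0 : 0 <= (u *m W *m u^T) 0 0 by exact: (proj2 pW).
    have b0 := dotM_ge0 (u *m B); rewrite QE in Qu.
    have uW : u *m W = 0 by apply: (psd_kernel pW); lra.
    have uB : u *m B = 0 by apply: dotM_eq0; lra.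
    have /submxP[y Ey] : (u <= row_base (kermx W))%MS by rewrite eq_row_base; apply/sub_kermxP.
    apply: dotM_eq0; rewrite dotM_tr {2}Ey trmx_mul mulmxA -/(kernel_basis W) uB mul0mx.
    by rewrite mxtrace0.
  move=> u0; move: Su; rewrite /S /= u0 subr0 /sqn big1 => [|i _]; last by rewrite mxE expr0n.
  by move/esym/eqP; rewrite oner_eq0.
move=> z; rewrite -QE dE.
have [z0|z0] := leP (sqn z) 0.
  by rewrite (sqn_eq0 z0) [sqn 0]big1 ?mulr0 ?Q0// => i _; rewrite mxE expr0n.
pose a := (Num.sqrt (sqn z))^-1.
have a2 : a ^+ 2 = (sqn z)^-1 by rewrite exprVn sqr_sqrtr ?ltW.
have Sz : S (a *: z).
  rewrite /S /= subr0 (_ : sqn (a *: z) = a ^+ 2 * sqn z).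
    by rewrite a2 mulVf// gt_eqF.
  by rewrite /sqn mulr_sumr; apply: eq_bigr => i _; rewrite mxE exprMn.
have := umin _ Sz; rewrite [Q (a *: z)](_ : _ = a ^+ 2 * Q z).
  by rewrite a2 mulrC ler_pdivlMr.
rewrite /Q linearZ /= -!scalemxAl -scalemxAr scalerA -expr2.
by move: (z *m _ *m _) => M; rewrite mxE.
Qed.

Lemma coercive_near n k (W0 W : 'M[R]_n) (B : 'M[R]_(n, k)) (c : R) : 0 <= c ->
  (forall u : 'rV_n, c * dotM u u <= (u *m W0 *m u^T) 0 0 + dotM (u *m B) (u *m B)) ->
  dotM (W - W0) (W - W0) <= (c / 2) ^+ 2 ->
  forall u : 'rV_n, c / 2 * dotM u u <= (u *m W *m u^T) 0 0 + dotM (u *m B) (u *m B).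
Proof.
move=> c0 coer hD u; have := coer u.
have -> : W = W0 + (W - W0) by rewrite subrKC.
move: (W - W0) hD => E hE.
have -> : (u *m (W0 + E) *m u^T) 0 0 = (u *m W0 *m u^T) 0 0 + dotM E (u^T *m u).
  by rewrite mulmxDr mulmxDl mxE (dotM_outer E).
have h1 : dotM E (u^T *m u) ^+ 2 <= (c / 2 * dotM u u) ^+ 2.
  apply: le_trans (dotM_CS _ _) _; rewrite exprMn ler_pM ?dotM_ge0//.
  by have := psd_dotM_le (psd_outer u); rewrite tr_outer.
have h2 : 0 <= c / 2 * dotM u u by rewrite mulr_ge0 ?dotM_ge0 ?divr_ge0.
have : - (c / 2 * dotM u u) <= dotM E (u^T *m u).
  rewrite lerNl; apply: (le_trans (ler_norm _)); rewrite normrN.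
  by rewrite -(@ler_pXn2r _ 2) ?nnegrE// -normrX ger0_norm ?sqr_ge0.
move: (dotM u u) (dotM E _) => p q; lra.
Qed.

End RankPositive.

Section EntrywiseNorm.
Variables (R : realType) (m n : nat).
Implicit Types (E Y : 'M[R]_(m, n)).

Definition mx_l1 E : R := \sum_i \sum_j `|E i j|.

Lemma mx_l1_0 : mx_l1 0 = 0.
Proof. by apply: big1 => i _; apply: big1 => j _; rewrite mxE normr0. Qed.

Lemma mx_l1B E Y : mx_l1 (E - Y) = mx_l1 (Y - E).
Proof. by apply: eq_bigr => i _; apply: eq_bigr => j _; rewrite !mxE distrC. Qed.

Lemma mx_l1_entry E i j : `|E i j| <= mx_l1 E.
Proof.
rewrite /mx_l1 (bigD1 i)//= (bigD1 j)//= -addrA lerDl addr_ge0// sumr_ge0// => a _.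
exact: sumr_ge0.
Qed.

Lemma dotM_l1 Y E (K : R) : (forall i j, `|Y i j| <= K) -> dotM Y E <= K * mx_l1 E.
Proof.
move=> HK; rewrite /mx_l1 mulr_sumr; apply: ler_sum => i _.
rewrite mulr_sumr; apply: ler_sum => j _.
by apply: le_trans (ler_norm _) _; rewrite normrM ler_wpM2r.
Qed.

Lemma dotM_le_l1 E : dotM E E <= mx_l1 E ^+ 2.
Proof. by rewrite expr2; apply: dotM_l1; exact: mx_l1_entry. Qed.

End EntrywiseNorm.

Lemma dotM_conj_le (R : realType) n k (M : 'M[R]_k) (X : 'M[R]_(k, n)) (K : R) (a b : 'M[R]_n) :
  (forall i j, `|(X^T *m M *m X) i j| <= K) ->
  dotM M (X *m a *m X^T) <= dotM M (X *m b *m X^T) + K * mx_l1 (a - b).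
Proof.
move=> HK.
have E W : dotM M (X *m W *m X^T) = dotM (X^T *m M *m X) W.
  by rewrite !dotM_tr !trmx_mul trmxK !mulmxA mxtrace_mulC !mulmxA.
rewrite !E -lerBlDl -dotMBr.
exact: dotM_l1.
Qed.

Section ConstantRank.
Variables (R : realType) (Omega : set 'rV[R]_4) (v : 'rV[R]_4 -> R).
Hypothesis sol : solution Omega v.

Let Cv : Ck_on Omega 4 v. Proof. by have [] := sol. Qed.

Lemma psd_hessian x : Omega x -> psd (hessian v x).
Proof.
by move=> Ox; split; [exact: (hessian_sym sol Ox)|move=> u; exact: (hessian_psd sol u Ox)].
Qed.

Lemma cts_hessian x i j : Omega x -> {for x, continuous (fun y => hessian v y i j)}.
Proof.
move=> Ox; rewrite (_ : (fun y => _) = partial i (partial j v)); last first.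
  by apply/funext => y; rewrite mxE.
exact: Ck_on_cts (Ck_on_partial i (Ck_on_partial j Cv)) Ox.
Qed.

Definition hessian_dist (x y : 'rV[R]_4) : R := mx_l1 (hessian v y - hessian v x).

Lemma hessian_distC x y : hessian_dist x y = hessian_dist y x.
Proof. exact: mx_l1B. Qed.

Lemma cts_hessian_dist x : Omega x -> {for x, continuous (hessian_dist x)}.
Proof.
move=> Ox; apply: cts_sum => i; apply: cts_sum => j.
rewrite (_ : (fun y => _) = fun y => `|hessian v y i j - hessian v x i j|); last first.
  by apply/funext => y; move: (hessian v y) (hessian v x) => a b; rewrite !mxE.
apply: (@continuous_comp _ _ _ (fun y => hessian v y i j - hessian v x i j) Num.norm).
  by apply: continuousB; [exact: cts_hessian|exact: cst_continuous].
exact: norm_continuous.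
Qed.

Lemma hessian_dist_near x (e : R) : Omega x -> 0 < e ->
  exists2 r : R, 0 < r & forall y, `|y - x| < r -> hessian_dist x y < e.
Proof.
move=> Ox e0; have [r r0 Hr] := cts_ball (cts_hessian_dist Ox) e0.
have E : hessian_dist x x = 0 by rewrite /hessian_dist subrr mx_l1_0.
exists r => // y /Hr; rewrite E subr0; apply: le_lt_trans; exact: ler_norm.
Qed.

End ConstantRank.

(** * The minimum as a function of the point *)

Section ValueFunction.
Variables (R : realType) (T : Type) (D : set T) (n k : nat) (W : T -> 'M[R]_n) (B : 'M[R]_(n, k)).
Hypothesis pW : forall x, D x -> psd (W x).

(** The function $G$, evaluated through an arbitrary selection [F] of minimizers; regularity comes
    from comparison with competitors, not from [F]. *)
Definition value (F : T -> 'M[R]_(k, n) * 'M[R]_k) (x : T) : R :=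
  dotM (Mc (F x).2) ((F x).1 *m W x *m (F x).1^T).

Lemma minimizers_exist (Xr : 'M[R]_(k, n)) (c K : R) : 0 < c -> Xr *m B = 1%:M ->
  (forall x, D x -> \tr (Xr *m W x *m Xr^T) <= K) ->
  (forall x (u : 'rV_n), D x ->
     c * dotM u u <= (u *m W x *m u^T) 0 0 + dotM (u *m B) (u *m B)) ->
  exists F R0, forall x, D x ->
    minimizer (W x) B (F x).1 (F x).2 /\ forall j l, `|(F x).1 j l| <= R0.
Proof.
move=> c0 XrB trK coer; pose r2 := (K + k%:R) / c.
have H x : exists p : 'M[R]_(k, n) * 'M[R]_k,
    D x -> minimizer (W x) B p.1 p.2 /\ dotM p.1 p.1 <= r2.
  have [Dx|nDx] := pselect (D x); last by exists (0, 0).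
  have [X [C [mXC cX]]] := minimizer_exists (pW Dx) c0 XrB (fun u => coer x u Dx).
  exists (X, C) => _; split => //=.
  by rewrite ler_pdivlMr// mulrC (le_trans cX)// lerD2r trK.
have [F HF] := choice H; exists F, (r2 + 1) => x Dx.
have [mF bF] := HF x Dx; split => // j l.
have h := le_trans (dotM_entry (F x).1 j l) bF.
have r20 : 0 <= r2 by apply: le_trans h; exact: sqr_ge0.
rewrite -(@ler_pXn2r _ 2) ?nnegrE ?addr_ge0// -normrX ger0_norm ?sqr_ge0// (le_trans h)//.
have -> : (r2 + 1) ^+ 2 = r2 + (r2 ^+ 2 + r2 + 1) by ring.
by rewrite lerDl !addr_ge0// sqr_ge0.
Qed.

Variables (F : T -> 'M[R]_(k, n) * 'M[R]_k) (R0 : R).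
Hypothesis mF : forall x, D x -> minimizer (W x) B (F x).1 (F x).2.
Hypothesis bF : forall x, D x -> forall j l, `|(F x).1 j l| <= R0.

Lemma value_ge0 x : D x -> 0 <= value F x.
Proof.
move=> Dx; have /andP[+ _] := minimizer_value_bounds (pW Dx) (mF Dx).
by apply: le_trans; rewrite divr_ge0// minimizer_tr_ge0//; exact: pW.
Qed.

Lemma value_le x X1 C1 : D x -> X1 *m B = 1%:M ->
  value F x <= dotM (Mc C1) (X1 *m W x *m X1^T).
Proof. by move=> Dx; apply: minimizer_le; [exact: pW|exact: mF]. Qed.

Lemma value_eq0 x : D x -> value F x = 0 -> (F x).1 *m W x = 0.
Proof.
move=> Dx Vx; have /andP[h _] := minimizer_value_bounds (pW Dx) (mF Dx).
have [_ XW TC _ _] := mF Dx.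
suff t0 : \tr ((F x).1 *m W x *m (F x).1^T) = 0 by rewrite XW TC t0 scale0r mul0mx.
have t0 := minimizer_tr_ge0 (F x).1 (pW Dx).
rewrite -/(value F x) Vx in h; apply/eqP; rewrite eq_le t0 andbT.
by move: h; rewrite pmulr_lle0// invr_gt0.
Qed.

(** The minimizer at [x] is admissible at [y], and its value is linear in the matrix with uniformly
    bounded coefficients. *)
Lemma value_lipschitz : exists2 K : R, 0 <= K & forall x y, D x -> D y ->
  value F y <= value F x + K * mx_l1 (W y - W x).
Proof.
have bX j l : bnd D (fun x => (F x).1 j l) by exists R0 => x Dx; exact: bF.
have bM j l : bnd D (fun x => Mc (F x).2 j l).
  exists 3 => x Dx; have [_ _ _ C1 _] := mF Dx; set C := (F x).2 in C1 *.
  have c0 := dotM_ge0 C.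
  have : `|C j l| <= 1.
    by rewrite -(@expr_le1 _ 2)// -normrX ger0_norm ?sqr_ge0// (le_trans (dotM_entry C j l)).
  rewrite !mxE; move: (dotM C C) (C j l) C1 c0 => d e d1 d0 e1.
  apply: (le_trans (ler_normB _ _)).
  have : `|(1 + d / 2) *+ (j == l)| <= 2.
    case: (j == l); last by rewrite mulr0n normr0.
    by rewrite mulr1n ger0_norm ?addr_ge0 ?divr_ge0//; lra.
  by move: e1; move: `|e| `|_ *+ _| => a b; lra.
have [K [K0 HK]] := bnd_unif (fun ij : 'I_n * 'I_n => bnd_mulmx
   (bnd_mulmx (M := fun x => (F x).1^T) (fun i j => eq_ind_r (bnd D) (bX j i)
       (funext (fun x => mxE _ _ i j))) bM) bX ij.1 ij.2).
exists K => // x y Dx Dy; have [XB _ _ _ _] := mF Dx.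
apply: le_trans (value_le (F x).2 Dy XB) _.
by apply: dotM_conj_le => i j; exact: HK (i, j) x Dx.
Qed.

End ValueFunction.

Lemma jetM_cst (R : realType) m n (M : 'M[R]_(m, n)) : jetM (fun=> M) 0 0.
Proof. by move=> i j; rewrite mxE; exact: jet2_cst. Qed.

Section LocallyConstantRank.
Variables (R : realType) (Omega : set 'rV[R]_4) (v : 'rV[R]_4 -> R).
Hypothesis sol : solution Omega v.

Section Supersolution.
Variables (D : set 'rV[R]_4) (k : nat) (B : 'M[R]_(4, k)) (R0 : R).
Variable F : 'rV[R]_4 -> 'M[R]_(k, 4) * 'M[R]_k.
Hypotheses (cD : compact D) (DO : D `<=` Omega).
Hypothesis mF : forall x, D x -> minimizer (hessian v x) B (F x).1 (F x).2.
Hypothesis bF : forall x, D x -> forall j l, `|(F x).1 j l| <= R0.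

Let G := value (hessian v) F.
Let pW x : D x -> psd (hessian v x). Proof. by move=> /DO; exact: psd_hessian. Qed.

(** Let $h$ be the value along a line with the minimizer at [y] frozen. It satisfies $h \ge G \ge 0
    = h(0)$, so $h'(0) = 0$, and $h - \phi \ge 0$ vanishes at 0, so $\phi$ has the same derivative.
    This settles the case $t = 0$, where [second_variation] does not apply. *)
Lemma touching_zero_gradient y (phi : 'rV[R]_4 -> R) (g : 'rV[R]_4) phi2 : D y ->
  (forall f, jet2 (fun s => phi (y + s *: f)) (\sum_l f 0 l * g 0 l) (phi2 f)) ->
  phi y = G y ->
  (forall f, \forall s \near (0 : R), D (y + s *: f) /\ phi (y + s *: f) <= G (y + s *: f)) ->
  G y = 0 -> g = 0.
Proof.
move=> Dy jphi phiy touch Gy.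
have gf (f : 'rV[R]_4) : \sum_l f 0 l * g 0 l = 0.
  have [XB _ _ _ _] := mF Dy.
  pose h s := dotM (Mc (F y).2) ((F y).1 *m hessian v (y + s *: f) *m (F y).1^T).
  have jh := jet2_dotM (jetM_cst (Mc (F y).2))
    (jetM_mul (jetM_mul (jetM_cst (F y).1) (jetM_hessian sol f (DO Dy))) (jetM_cst (F y).1^T)).
  rewrite -/h in jh.
  have h0 : h 0 = 0 by rewrite /h scale0r addr0.
  have p0 : phi (y + 0 *: f) = 0 by rewrite scale0r addr0 phiy.
  have hG : \forall s \near (0 : R), 0 <= G (y + s *: f) /\ phi (y + s *: f) <= G (y + s *: f) <= h s.
    near=> s; have [Ds phis] : D (y + s *: f) /\ phi (y + s *: f) <= G (y + s *: f).
      by near: s; exact: touch.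
    by rewrite phis (value_ge0 pW mF Ds) (value_le pW mF _ Ds XB).
  have hge : \forall s \near (0 : R), h 0 <= h s.
    by apply: filterS hG => s [h1 /andP[_ h2]]; rewrite h0 (le_trans h1).
  have [bh _] := jet2_ge0 jh hge.
  have [] := jet2_ge0 (jet2B jh (jphi f)) _; last by rewrite {}bh sub0r => /eqP; rewrite oppr_eq0 => /eqP.
    by apply: filterS hG => s [_ /andP[h1 h2]]; rewrite h0 p0 subrr subr_ge0 (le_trans h1).
apply/rowP => l; rewrite mxE -(gf (delta_mx 0 l)) (bigD1 l)//= big1 ?addr0 => [|j jl].
  by rewrite mxE !eqxx mul1r.
by rewrite mxE eqxx (negPf jl) mul0r.
Unshelve. all: by end_near. Qed.

Lemma value_supersolution : exists K : R, 0 <= K /\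
  forall y (phi : 'rV[R]_4 -> R) (g : 'rV[R]_4) phi2, D y ->
  (forall f, jet2 (fun s => phi (y + s *: f)) (\sum_l f 0 l * g 0 l) (phi2 f)) ->
  phi y = G y ->
  (forall f, \forall s \near (0 : R), D (y + s *: f) /\ phi (y + s *: f) <= G (y + s *: f)) ->
  (G y = 0 -> g = 0) /\
  (0 < G y -> \sum_m phi2 (frame (A1 v y) (Ac v y) (Ad v y) m) <= K * (G y + \sum_l `|g 0 l|)).
Proof.
have [K [K0 HK]] := differential_inequality sol B R0 cD DO.
(* The factor 2 comes from $\mathrm{tr}\,T \le 2G$. *)
exists (2 * K); split; first by rewrite mulr_ge0.
move=> y phi g phi2 Dy jphi phiy touch; split; first exact: touching_zero_gradient touch.
move=> Gy; have /andP[G1 G2] := minimizer_value_bounds (pW Dy) (mF Dy).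
have t0 := lt_le_trans Gy G2.
apply: le_trans (HK y (F y).1 (F y).2 phi g phi2 Dy (bF Dy) (mF Dy) t0 phiy jphi _) _.
  move=> f; near=> s => X1 C1 X1B.
  have [Ds phis] : D (y + s *: f) /\ phi (y + s *: f) <= G (y + s *: f) by near: s; exact: touch.
  exact: le_trans phis (value_le pW mF C1 Ds X1B).
rewrite -mulrA mulrCA ler_wpM2l//.
have S0 : 0 <= \sum_l `|g 0 l| by exact: sumr_ge0.
move: G1; rewrite -/(value (hessian v) F y) -/G.
move: (\tr _) (G y) (\sum_l _) S0 => t p q q0 h; lra.
Unshelve. all: by end_near. Qed.

End Supersolution.
End LocallyConstantRank.

Lemma connected_locally_constant (T : topologicalType) (U : Type) (A : set T) (f : T -> U) :
  A !=set0 -> open A -> connected A -> (forall x, A x -> \forall y \near x, f y = f x) ->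
  exists r, forall x, A x -> f x = r.
Proof.
move=> [x0 Ax0] oA cA loc; exists (f x0).
have open_f (P : set U) : open [set x | A x /\ P (f x)].
  rewrite openE => x [Ax Px]; near=> y; split.
    by near: y; exact: open_nbhs_nbhs.
  suff -> : f y = f x by [].
  by near: y; exact: loc.
have E : [set x | A x /\ f x = f x0] = A.
  apply: cA; first by exists x0.
    exists [set x | A x /\ f x = f x0]; first exact: (open_f [set u | u = f x0]).
    by apply/seteqP; split => x [] //.
  exists (~` [set x | A x /\ f x <> f x0]).
    by apply: open_closedC; exact: (open_f [set u | u <> f x0]).
  apply/seteqP; split => x [Ax].
    by move=> fx; split => // -[].
  by move=> nx; split => //; apply: contrapT => fx; exact: nx.
by move=> x; rewrite -{1}E => -[].
Unshelve. all: by end_near. Qed.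

Lemma near_of_ball (R : realType) (V : normedModType R) (x : V) (r : R) (P : set V) : 0 < r ->
  (forall y, `|y - x| < r -> P y) -> \forall y \near x, P y.
Proof.
move=> r0 Hr; apply/nbhs_ballP; exists r => //= y; rewrite -ball_normE /ball_/= distrC; exact: Hr.
Qed.

Section LocalRank.
Variables (R : realType) (Omega : set 'rV[R]_4) (v : 'rV[R]_4 -> R).
Hypothesis sol : solution Omega v.

Let oO : open Omega. Proof. by have [] := sol. Qed.

Lemma local_coercivity x0 (B := kernel_basis (hessian v x0)) : Omega x0 ->
  exists r c : R, [/\ 0 < r, 0 < c, forall x, `|x - x0| <= r -> Omega x &
    forall x (u : 'rV_4), `|x - x0| <= r ->
      c * dotM u u <= (u *m hessian v x *m u^T) 0 0 + dotM (u *m B) (u *m B)].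
Proof.
move=> Ox0; have [c c0 coer] := coercive_exists (psd_hessian sol Ox0).
have c20 : 0 < c / 2 by rewrite divr_gt0.
have [r1 r10 Hr1] := hessian_dist_near sol Ox0 c20.
have [r2 r20 Hr2] := ball_in oO Ox0.
have m0 : 0 < Num.min r1 r2 by rewrite lt_min r10.
have lt_m (t : R) : t <= Num.min r1 r2 / 2 -> t < r1 /\ t < r2.
  move=> ht; have : t < Num.min r1 r2 by rewrite (le_lt_trans ht)// gtr_pMr// invf_lt1// ltr1n.
  by rewrite lt_min => /andP.
exists (Num.min r1 r2 / 2), (c / 2); split => //; first by rewrite divr_gt0.
  by move=> x /lt_m[_ /Hr2].
move=> x u /lt_m[hx _]; apply: coercive_near u => //; first exact: ltW.
apply: le_trans (dotM_le_l1 _) _; rewrite -/(hessian_dist v x0 x).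
have d0 : 0 <= hessian_dist v x0 x by do 2 (apply: sumr_ge0 => ? _).
rewrite ler_pXn2r// ?nnegrE; last exact: ltW c20.
exact: ltW (Hr1 x hx).
Qed.

Lemma cts_of_lipschitz (G : 'rV[R]_4 -> R) (D : set 'rV[R]_4) (K : R) x :
  0 <= K -> Omega x -> D x -> (exists2 r : R, 0 < r & forall y, `|y - x| < r -> D y) ->
  (forall x y, D x -> D y -> G y <= G x + K * hessian_dist v x y) -> {for x, continuous G}.
Proof.
move=> K0 Ox Dx [r r0 Hr] HG.
apply/(cvgrPdist_lt (FF := nbhs_filter x)) => e e0.
have K1 : 0 < K + 1 by rewrite ltr_wpDl.
have [r1 r10 Hr1] := hessian_dist_near sol Ox (divr_gt0 e0 K1).
have m0 : 0 < Num.min r r1 by rewrite lt_min r0.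
apply/nbhs_ballP; exists (Num.min r r1) => //= y.
rewrite -ball_normE /ball_/= distrC lt_min => /andP[yr yr1].
have h1 := HG x y Dx (Hr y yr); have h2 := HG y x (Hr y yr) Dx.
rewrite hessian_distC in h2.
have : K * hessian_dist v x y < e.
  apply: le_lt_trans (_ : K * (e / (K + 1)) < _).
    by rewrite ler_wpM2l// ltW// Hr1.
  by rewrite mulrCA gtr_pMr// ltr_pdivrMr// mul1r ltrDl.
by move: h1 h2; move: (K * _) (G x) (G y) => a b c *; rewrite ltr_norml; apply/andP; split; lra.
Qed.

(** Coercivity with the fixed [B] gives rank at least $4-k$ nearby. The vanishing of $G$ gives $XW =
    0$ with $XB = 1$, hence rank at most $4-k$. *)
Lemma rank_locally_constant x0 : Omega x0 -> exists2 r : R, 0 < r &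
  forall x, `|x - x0| < r -> Omega x /\ \rank (hessian v x) = \rank (hessian v x0).
Proof.
move=> Ox0; have [r [c [r0 c0 DO coer]]] := local_coercivity Ox0.
have [Xr [XrB XrW]] := kernel_basis_inverse (hessian v x0).
have rk0 : (\rank (hessian v x0) + \rank (kermx (hessian v x0)) = 4)%N.
  by rewrite mxrank_ker subnKC// rank_leq_row.
move: (kernel_basis (hessian v x0)) coer Xr XrB XrW.
move: (\rank (kermx _)) rk0 => k rk0 B coer Xr XrB XrW.
pose D : set 'rV[R]_4 := [set x | `|x - x0| <= r].
have cD : compact D := @compact_ball _ _ x0 r.
have pW x : D x -> psd (hessian v x) by move=> /DO; exact: psd_hessian.
have [Kt HKt] : bnd D (fun x => \tr (Xr *m hessian v x *m Xr^T)).
  apply: bnd_sum => i; apply: bnd_mulmx => *; last exact: bnd_cst.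
  apply: bnd_mulmx => *; first exact: bnd_cst.
  exact: (bnd_hessian sol cD DO (fun x (Dx : D x) => Dx)).
have trK x : D x -> \tr (Xr *m hessian v x *m Xr^T) <= Kt.
  by move=> Dx; apply: le_trans (ler_norm _) (HKt x Dx).
have [F [R0 HF]] := minimizers_exist pW c0 XrB trK coer.
have mF x Dx := (HF x Dx).1; have bF x Dx := (HF x Dx).2.
have [Kl Kl0 lip] := value_lipschitz pW mF bF.
have [K [K0 super]] := value_supersolution sol cD DO mF bF.
have [Ke [Ke0 ell]] := frame_elliptic sol cD DO (fun x (Dx : D x) => Dx).
have [Kf [Kf0 HKf]] := bnd_unif (fun mj : 'I_4 * 'I_4 =>
  bnd_frame sol cD DO (fun y (Dy : D y) => Dy) mj.1 mj.2).
have Dx0 : D x0 by rewrite /D /= subrr normr0 ltW.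
have interior x : `|x - x0| < r -> exists2 e : R, 0 < e & forall y, `|y - x| < e -> D y.
  move=> hx; exists (r - `|x - x0|); first by rewrite subr_gt0.
  move=> y hy; rewrite /D /= -[y - x0](subrKA x) (le_trans (ler_normD _ _))//.
  by rewrite -lerBrDr ltW.
(* The competitor [Xr] with [C = 0] has value 0, since its rows lie in the kernel at [x0]. *)
have G0 : value (hessian v) F x0 = 0.
  apply/eqP; rewrite eq_le (value_ge0 pW mF Dx0) andbT.
  have := value_le pW mF 0 Dx0 XrB; rewrite XrW mul0mx.
  by rewrite (_ : dotM _ 0 = 0)// -(scale0r 0) dotMZr mul0r.
have hopf x : `|x - x0| < r / (4 * 4%:R) -> value (hessian v) F x = 0.
  apply: (@hopf_contradiction _ _ _ _ _ _ (fun y => frame (A1 v y) (Ac v y) (Ad v y))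
    K Ke (4%:R * Kf ^+ 2) r0 K0 Ke0 G0).
  - by move=> y Dy; exact: (value_ge0 pW mF).
  - move=> y hy; apply: (cts_of_lipschitz Kl0 (DO _ (ltW hy)) (ltW hy : D y) (interior y hy)).
    exact: lip.
  - move=> y z Dy; apply: le_trans (ell y z Dy) _.
    apply: ler_wpM2l; first exact: ltW.
    by apply: ler_sum => m _; rewrite mxE; under eq_bigr do rewrite [_^T _ _]mxE.
  - move=> y m Dy; apply: sqn_le; apply: norm_le_entries => // l.
    exact: HKf (m, l) y Dy.
  - move=> y phi g phi2 hy jphi phiy touch.
    apply: (super y phi g phi2 (ltW hy) jphi phiy) => f.
    have oB : open [set x : 'rV[R]_4 | `|x - x0| < r].
      have -> : [set x | `|x - x0| < r] = ball x0 r.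
        by apply/seteqP; rewrite -ball_normE; split => z /=; rewrite distrC.
      exact: ball_open.
    apply: filterS2 (open_line_near f oB hy) (touch f) => s hs ht.
    by split => //; exact: ltW.
exists (r / (4 * 4%:R)); first by rewrite divr_gt0// mulr_gt0.
move=> x hx.
have Dx : D x.
  rewrite /D /= ltW// (lt_le_trans hx)// ler_pdivrMr ?mulr_gt0// ler_peMr ?(ltW r0)//.
  by rewrite -natrM ler1n.
split; first exact: DO.
have XW := value_eq0 pW mF Dx (hopf x hx).
have [XB _ _ _ _] := mF x Dx.
have h1 := rank_le_of_left_inverse XB XW.
have h2 := rank_ge_of_coercive c0 (fun u => coer x u Dx).
have rank_eq (a b : nat) : (b + k = 4)%N -> (a + k <= 4)%N -> (4 <= a + k)%N -> a = b.
  by move=> <- ak bk; apply/(@addIn k)/eqP; rewrite eqn_leq ak.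
exact: rank_eq rk0 h1 h2.
Qed.

End LocalRank.

Theorem corollary4p2 (R : realType) (Omega : set 'rV[R]_4) (v : 'rV[R]_4 -> R)
    (Omega_domain : is_domain Omega)
    (v_C4 : Ck_on Omega 4 v)
    (v_lt0 : forall x, Omega x -> v x < 0)
    (v_convex : convex_on Omega v)
    (v_eqn : forall x, Omega x -> \det (pde_matrix v x) = 16^-1) :
  exists r : nat, forall x, Omega x -> \rank (hessian v x) = r.
Proof.
have [nonempty oO cO] := Omega_domain.
have sol : solution Omega v.
  split => // x Ox; apply: pde_real oO Ox _ (v_eqn x Ox).
  by do 2 apply: Ck_onW.
apply: (connected_locally_constant nonempty oO cO) => x Ox.
have [r r0 Hr] := rank_locally_constant sol Ox.
by apply: (near_of_ball r0) => y hy; exact: (Hr y hy).2.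
Qed.
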